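(* Let $\mathbb F$ be a free Carnot group of step 2, rank $m$ and topological dimension $n$, and let $\mathbb W$ and $\mathbb L$ be two complementary subgroups of $\mathbb F$ such that $\mathbb L$ is one-dimensional. Let $\Omega$ be an open subset of $\mathbb W$ and let $\psi\colon\Omega\to\mathbb L$ be a continuous function. Choose an adapted basis and exponential coordinates on $\mathbb F$ as described in the context. Assume that there exists $\omega=(\omega_2,\dots,\omega_m)\in C(\Omega;\mathbb R^{m-1})$ such that $D^\psi\psi=\omega$ holds in the distributional sense on $\Omega$. Then the following facts hold. (a) For every $j=2,\dots,m$ and for every integral curve $\gamma\colon[0,T]\to\Omega$ of $D^\psi_j$, the map $\psi\circ\gamma\colon[0,T]\to\mathbb L$ is Lipschitz and the Lipschitz constant only depends on $j$ and $\omega$. (b) $D^\psi\psi=\omega$ holds in the broad* sense on $\Omega$.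
   Context: **Free Carnot groups of step 2.** The free Carnot group $\mathbb F$ of step 2 and rank $m$ ($m\ge2$) is the connected, simply connected Lie group whose Lie algebra has a basis $X_1,\dots,X_m$, $Y_{\ell s}$ ($1\le s<\ell\le m$) with $[X_\ell,X_s]=Y_{\ell s}$ for $1\le s<\ell\le m$ and all $Y_{\ell s}$ central; its layers are $V_1=\mathrm{span}\{X_j\}$, $V_2=\mathrm{span}\{Y_{\ell s}\}$ and its dimension is $n=m+\frac{m(m-1)}2$. Dilations $\delta_\lambda$ ($\lambda>0$) multiply $V_j$ by $\lambda^j$. Complementary subgroups $\mathbb W,\mathbb L$ are subgroups closed under all $\delta_\lambda$ with $\mathbb F=\mathbb W\cdot\mathbb L$ and $\mathbb W\cap\mathbb L=\{e\}$. If $\mathbb L$ is one-dimensional, the basis $X_1,\dots,X_m$ of $V_1$ is chosen so that $\mathbb L=\exp(\mathrm{span}\{X_1\})$ and $\mathbb W=\exp(\mathrm{span}(\{X_2,\dots,X_m\}\cup\{Y_{\ell s}\}))$. **Coordinates.** Identify $\mathbb F$ with $\mathbb R^n$ via $(x,y)\leftrightarrow\exp(\sum_jx_jX_j+\sum_{s<\ell}y_{\ell s}Y_{\ell s})$; the product is $(q\cdot q')_j=x_j+x_j'$, $(q\cdot q')_{\ell s}=y_{\ell s}+y'_{\ell s}+\frac12(x_\ell x'_s-x'_\ell x_s)$. Then $\mathbb L=\{(x_1,0,\dots,0)\}\equiv\mathbb R$ and $\mathbb W=\{x_1=0\}\equiv\mathbb R^{n-1}$. Functions with values in $\mathbb L$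 are regarded as real-valued. Fix a homogeneous norm $\|\cdot\|$ on $\mathbb F$ (i.e. $\|\delta_\lambda x\|=\lambda\|x\|$, $\|xy\|\le\|x\|+\|y\|$, $\|x^{-1}\|=\|x\|$, $\|x\|=0$ iff $x=e$); $B(a,r)=\{x:\|a^{-1}x\|<r\}$. **Projected vector fields.** For continuous $\psi\colon\Omega\to\mathbb L$ and $j=2,\dots,m$, on $\Omega$ set $$D^\psi_j=\partial_{x_j}-\psi\,\partial_{y_{j1}}+\tfrac12\sum_{j<\ell\le m}x_\ell\,\partial_{y_{\ell j}}-\tfrac12\sum_{1<s<j}x_s\,\partial_{y_{js}},\qquad D^\psi=(D^\psi_2,\dots,D^\psi_m).$$ An integral curve of $D^\psi_j$ is a $C^1$ curve $\gamma$ with $\dot\gamma=D^\psi_j\circ\gamma$. **Distributional sense.** $D^\psi\psi=\omega$ holds in the distributional sense on $\Omega$ if for all $j=2,\dots,m$ and all $\xi\in C^\infty_c(\Omega)$ $$\int_\Omega\Big(-\psi\,\partial_{x_j}\xi+\tfrac{\psi^2}2\partial_{y_{j1}}\xi-\tfrac12\sum_{j<\ell\le m}x_\ell\psi\,\partial_{y_{\ell j}}\xi+\tfrac12\sum_{1<s<j}x_s\psi\,\partial_{y_{js}}\xi\Big)dx\,dy=\int_\Omega\omega_j\,\xi\,dx\,dy.$$ **Broad\* sense.** $D^\psi\psi=\omega$ holds in the broad* sense on $\Omega$ if for every $a_0\in\Omega$ there exist $0<\delta_2<\delta_1$ with $\overline{B(a_0,\delta_1)}\cap\mathbb W\subseteq\Omega$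 and maps $E_j\colon(\overline{B(a_0,\delta_2)}\cap\mathbb W)\times[-\delta_2,\delta_2]\to\overline{B(a_0,\delta_1)}\cap\mathbb W$, $j=2,\dots,m$, such that for all $a\in\overline{B(a_0,\delta_2)}\cap\mathbb W$ and all $j$: (i) $t\mapsto E_j(a,t)$ is $C^1$ and solves $\dot\gamma=D^\psi_j\circ\gamma$, $\gamma(0)=a$ on $[-\delta_2,\delta_2]$; (ii) $\psi(E_j(a,t))-\psi(a)=\int_0^t\omega_j(E_j(a,s))\,ds$ for all $t\in[-\delta_2,\delta_2]$.
   Formalization: In (a), one Lipschitz constant for all curves fails if ω_j is unbounded (m=2, ψ=x_2²/2, ω_2=x_2); instead each ψ∘γ is Lipschitz, with a constant depending only on j, ω and a set A⊆Ω that contains the curve and on which ω_j is bounded (A=Ω if ω_j is bounded). *)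

(* Defs.v *)
From HB Require Import structures.
From mathcomp Require Import all_boot all_order all_algebra.
From mathcomp Require Import all_classical all_reals all_analysis.
From mathcomp Require Import ring.

Set Implicit Arguments.
Unset Strict Implicit.
Unset Printing Implicit Defensive.

Import Order.TTheory GRing.Theory Num.Theory.
Import numFieldNormedType.Exports.

Local Open Scope classical_set_scope.
Local Open Scope ring_scope.

Section lebesgue_measure_tuple.
Variable R : realType.
Local Notation mR := (measurableTypeR R).

Definition cons_pair N (p : mR * N.-tuple mR) : N.+1.-tuple mR :=
  [the N.+1.-tuple mR of p.1 :: p.2].

Lemma measurable_cons_pair N : measurable_fun setT (@cons_pair N).
Proof. by apply: measurable_cons. Qed.

Lemma measurable_preimage_cons_pair N (A : set (N.+1.-tuple mR)) :
  measurable A -> measurable (@cons_pair N @^-1` A).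
Proof.
by move=> mA; rewrite -[X in measurable X]setTI; exact: measurable_cons_pair.
Qed.

Section step.
Variables (N : nat) (mu : {sigma_finite_measure set (N.-tuple mR) -> \bar R}).

Definition lebesgue_step : set (N.+1.-tuple mR) -> \bar R :=
  pushforward (@lebesgue_measure R \x mu)%E (@cons_pair N).

Let lebesgue_step0 : lebesgue_step set0 = 0%E.
Proof. by rewrite /lebesgue_step /pushforward preimage_set0 measure0. Qed.

Let lebesgue_step_ge0 A : (0 <= lebesgue_step A)%E.
Proof. by rewrite /lebesgue_step /pushforward measure_ge0. Qed.

Let lebesgue_step_sigma_additive : semi_sigma_additive lebesgue_step.
Proof.
move=> F mF tF mUF; rewrite /lebesgue_step /pushforward preimage_bigcup.
apply: measure_semi_sigma_additive.
- by move=> n; exact: measurable_preimage_cons_pair.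
- apply/trivIsetP => /= i j _ _ ij; rewrite -preimage_setI.
  by move/trivIsetP : tF => /(_ _ _ _ _ ij) ->//; rewrite preimage_set0.
- by rewrite -preimage_bigcup; exact: measurable_preimage_cons_pair.
Qed.

HB.instance Definition _ := isMeasure.Build _ _ _ lebesgue_step
  lebesgue_step0 lebesgue_step_ge0 lebesgue_step_sigma_additive.

Let uncons (t : N.+1.-tuple mR) : mR * N.-tuple mR :=
  (thead t, [tuple of behead t]).

Let lebesgue_step_sigma_finite : sigma_finite setT lebesgue_step.
Proof.
have /sigma_finiteP[F [TF ndF Foo]] := sigma_finiteT (@lebesgue_measure R).
have /sigma_finiteP[G [TG ndG Goo]] := sigma_finiteT mu.
exists (fun k => uncons @^-1` (F k `*` G k)).
  apply/seteqP; split => // t _.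
  have [k _ Fk] : (\bigcup_k F k) (uncons t).1 by rewrite -TF.
  have [l _ Gl] : (\bigcup_k G k) (uncons t).2 by rewrite -TG.
  exists (maxn k l) => //; split => /=.
    by move: Fk; exact/subsetPset/ndF/leq_maxl.
  by move: Gl; exact/subsetPset/ndG/leq_maxr.
move=> k; have [mF Fk] := Foo k; have [mG Gk] := Goo k; split.
  rewrite -[X in measurable X]setTI.
  suff : measurable_fun setT uncons by apply => //; exact: measurableX.
  apply/measurable_fun_pairP; split; last exact: measurable_behead.
  exact: measurable_tnth.
rewrite /lebesgue_step /pushforward (_ : _ @^-1` _ = F k `*` G k).
  by rewrite product_measure1E// lte_mul_pinfty// ge0_fin_numE.
rewrite -comp_preimage (_ : uncons \o _ = id)// funeqE => -[x t] /=.
by rewrite /uncons theadE; congr (_, _); exact/val_inj.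
Qed.

HB.instance Definition _ := Measure_isSigmaFinite.Build _ _ _
  lebesgue_step lebesgue_step_sigma_finite.

End step.

Fixpoint lebesgue_tuple N :
    {sigma_finite_measure set (N.-tuple mR) -> \bar R} :=
  match N with
  | 0 => [the {sigma_finite_measure set (0.-tuple mR) -> \bar R} of
            dirac ([tuple] : 0.-tuple mR)]
  | N'.+1 => [the {sigma_finite_measure set (N'.+1.-tuple mR) -> \bar R} of
            lebesgue_step (lebesgue_tuple N')]
  end.

Lemma lebesgue_tuple_box N (A : 'I_N -> set mR) :
  (forall i, measurable (A i)) ->
  lebesgue_tuple N [set t | forall i, A i (tnth t i)] =
  (\prod_(i < N) lebesgue_measure (A i))%E.
Proof.
elim: N A => [|N IH] A mA.
  rewrite big_ord0 /= /dirac/= indicE mem_set//.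
  by case.
rewrite big_ord_recl /= /lebesgue_step /pushforward.
rewrite (_ : _ @^-1` _ =
  A ord0 `*` [set t : N.-tuple mR | forall i, A (lift ord0 i) (tnth t i)]).
  rewrite product_measure1E//.
    by rewrite (IH (fun i => A (lift ord0 i))).
  rewrite (_ : mkset _ =
    \bigcap_(i in [set: 'I_N]) [set t | A (lift ord0 i) (tnth t i)]).
    apply: fin_bigcap_measurable => // i _.
    rewrite -[X in measurable X]setTI.
    exact: (@measurable_tnth _ mR N i).
  by apply/seteqP; split => t /= h i; [move=> _|]; apply: h.
apply/seteqP; split => -[x t] /=.
  move=> h; split; first by have := h ord0; rewrite tnth0.
  by move=> i; have := h (lift ord0 i); rewrite tnthS.
move=> [h0 h] i; case: (unliftP ord0 i) => [j ->|->].
  by rewrite tnthS; exact: h.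
by rewrite tnth0.
Qed.

End lebesgue_measure_tuple.

Section euclidean.
Variables (R : realType) (N : nat).

Definition row_of_tuple (t : N.-tuple (measurableTypeR R)) : 'rV[R]_N :=
  \row_i (tnth t i : R).

Definition integral_rV (D : set 'rV[R]_N) (f : 'rV[R]_N -> R) : R :=
  \int[lebesgue_tuple R N]_(t in row_of_tuple @^-1` D) f (row_of_tuple t).

Definition partials (s : seq 'I_N) (f : 'rV[R]_N -> R) : 'rV[R]_N -> R :=
  foldr (fun k g p => 'D_(delta_mx ord0 k) g p) f s.

Definition smooth (f : 'rV[R]_N -> R) : Prop :=
  forall s : seq 'I_N, continuous (partials s f) /\
    forall k p, derivable (partials s f) p (delta_mx ord0 k).

(* Functions in C^oo_c(Omega) are represented by their extension by 0 *)
Definition test_function (Omega : set 'rV[R]_N) (xi : 'rV[R]_N -> R) : Prop :=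
  [/\ smooth xi, compact (closure [set p | xi p != 0])
    & closure [set p | xi p != 0] `<=` Omega].

(* The derivative relative to [I]: one-sided at the endpoints of an interval *)
Definition derive_within (I : set R) (gamma : R -> 'rV[R]_N) (t : R)
    (v : 'rV[R]_N) : Prop :=
  (s - t)^-1 *: (gamma s - gamma t) @[s --> within I t^'] --> v.

Definition C1_with_derivative (I : set R) (gamma dgamma : R -> 'rV[R]_N) :=
  {within I, continuous dgamma} /\
  forall t, I t -> derive_within I gamma t (dgamma t).

End euclidean.

Definition oriented_integral (R : realType) (a b : R) (f : R -> R) : R :=
  if a <= b then \int[lebesgue_measure]_(s in `[a, b]) f s
  else - \int[lebesgue_measure]_(s in `[b, a]) f s.

(* Indices are 0-based: X_1, ..., X_m are indexed by the elements 0, ..., m-1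
   of ['I_m], and Y_{l s} by the pair (l, s).  [hidx m] indexes X_2, ..., X_m. *)
Definition hidx m := {j : 'I_m | (0 < j)%N}.
Definition vidx m := {p : 'I_m * 'I_m | (p.2 < p.1)%N}.
Definition widx (m : nat) := (hidx m + vidx m)%type.

Definition upper m (v : vidx m) : 'I_m := (val v).1.
Definition lower m (v : vidx m) : 'I_m := (val v).2.

Lemma lt0_of_hidx m (j : hidx m) : (0 < m)%N.
Proof. exact: leq_ltn_trans (ltn_ord (val j)). Qed.

(* The index (j, 1) of Y_{j 1} *)
Definition vidx1 m (j : hidx m) : vidx m :=
  exist _ (val j, Ordinal (lt0_of_hidx j)) (valP j).

Definition vdim m : nat := #|{: vidx m}|.
Definition wdim m : nat := #|{: widx m}|.

Notation carnot R m := ('rV[R]_m * 'rV[R]_(vdim m))%type.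

(* W = {x_1 = 0}, identified with R^(n-1) by dropping x_1 *)
Notation wspace R m := 'rV[R]_(wdim m).

Section group.
Variables (R : realType) (m : nat).
Implicit Types q : carnot R m.

Definition xc q (i : 'I_m) : R := q.1 ord0 i.
Definition yc q (v : vidx m) : R := q.2 ord0 (enum_rank v).

Definition point (x : 'I_m -> R) (y : vidx m -> R) : carnot R m :=
  (\row_i x i, \row_k y (enum_val k)).

Definition mulF q q' : carnot R m :=
  point (fun i => xc q i + xc q' i)
    (fun v => yc q v + yc q' v +
       2^-1 * (xc q (upper v) * xc q' (lower v) -
               xc q' (upper v) * xc q (lower v))).

Definition invF q : carnot R m := - q.

Definition dilF (r : R) q : carnot R m :=
  point (fun i => r * xc q i) (fun v => r ^+ 2 * yc q v).

Definition homogeneous_norm (nrm : carnot R m -> R) : Prop :=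
  [/\ forall r q, 0 < r -> nrm (dilF r q) = r * nrm q,
      forall q q', nrm (mulF q q') <= nrm q + nrm q',
      forall q, nrm (invF q) = nrm q
    & forall q, nrm q = 0 <-> q = 0].

Definition ballF (nrm : carnot R m -> R) (a : carnot R m) (r : R) :=
  [set q : carnot R m | nrm (mulF (invF a) q) < r].

(* Coordinates on W; [xW p i] is 0 for the first index *)
Definition xW (p : wspace R m) (i : 'I_m) : R :=
  if (insub i : option (hidx m)) is Some j
  then p ord0 (enum_rank (inl j : widx m)) else 0.
Definition yW (p : wspace R m) (v : vidx m) : R :=
  p ord0 (enum_rank (inr v : widx m)).

Definition embW (p : wspace R m) : carnot R m := point (xW p) (yW p).

Definition homogeneous_subgroup (G : set (carnot R m)) : Prop :=
  [/\ G 0, forall q q', G q -> G q' -> G (mulF q q'),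
      forall q, G q -> G (invF q)
    & forall r q, 0 < r -> G q -> G (dilF r q)].

Definition complementary (W L : set (carnot R m)) : Prop :=
  [/\ homogeneous_subgroup W, homogeneous_subgroup L,
      forall q, exists w l, [/\ W w, L l & q = mulF w l]
    & W `&` L = [set 0]].

(* exp(span X_1) *)
Definition lineX1 : set (carnot R m) :=
  [set q | (forall i : 'I_m, (0 < i)%N -> xc q i = 0) /\ forall v, yc q v = 0].

Lemma xc_point x y i : xc (point x y) i = x i.
Proof. by rewrite /xc mxE. Qed.

Lemma yc_point x y v : yc (point x y) v = y v.
Proof. by rewrite /yc mxE enum_rankK. Qed.

Lemma eq_carnot q q' : xc q =1 xc q' -> yc q =1 yc q' -> q = q'.
Proof.
case: q q' => [x y] [x' y'] ex ey; congr (_, _); apply/rowP => i.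
  exact: ex.
by have := ey (enum_val i); rewrite /yc enum_valK.
Qed.

Lemma xcN q i : xc (- q) i = - xc q i. Proof. by rewrite /xc mxE. Qed.
Lemma ycN q v : yc (- q) v = - yc q v. Proof. by rewrite /yc mxE. Qed.
Lemma xc0 i : xc 0 i = 0. Proof. by rewrite /xc mxE. Qed.
Lemma yc0 v : yc 0 v = 0. Proof. by rewrite /yc mxE. Qed.

Lemma mulFA : associative mulF.
Proof.
move=> p q r; apply: eq_carnot => [i|v]; first by rewrite !xc_point addrA.
by rewrite !yc_point !xc_point; ring.
Qed.

Lemma mul0F : left_id 0 mulF.
Proof.
move=> q; apply: eq_carnot => [i|v]; rewrite ?xc_point ?yc_point ?xc0 ?yc0.
  by rewrite add0r.
by rewrite !mul0r !mulr0 subrr mulr0 add0r addr0.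
Qed.

Lemma mulNF : left_inverse 0 invF mulF.
Proof.
move=> q; apply: eq_carnot => [i|v];
  rewrite ?xc_point ?yc_point ?xc0 ?yc0 ?xcN ?ycN; first by rewrite addNr.
ring.
Qed.

Lemma xW0 p (i : 'I_m) : i = 0%N :> nat -> xW p i = 0.
Proof. by move=> i0; rewrite /xW insubF // i0. Qed.

Lemma range_embW :
  range embW = [set q | forall i : 'I_m, i = 0%N :> nat -> xc q i = 0].
Proof.
apply/seteqP; split => [_ [p _ <-] i i0|q q0]; first by rewrite xc_point xW0.
exists (\row_k match enum_val k with
               | inl j => xc q (val j) | inr v => yc q v end) => //.
apply: eq_carnot => [i|v]; rewrite ?xc_point ?yc_point; last first.
  by rewrite /yW mxE enum_rankK.
rewrite /xW; case: insubP => [j _ ji|]; first by rewrite mxE enum_rankK ji.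
by rewrite -eqn0Ngt => /eqP/q0 ->.
Qed.

Lemma complementary_embW_lineX1 : complementary (range embW) lineX1.
Proof.
rewrite range_embW; split.
- split => [i _|q q' hq hq' i i0|q hq i i0|r q _ hq i i0] /=.
  + by rewrite xc0.
  + by rewrite xc_point hq// hq'// addr0.
  + by rewrite xcN hq// oppr0.
  + by rewrite xc_point hq// mulr0.
- split => [|q q' [hx hy] [hx' hy']|q [hx hy]|r q _ [hx hy]].
  + by split=> [i _|v]; rewrite ?xc0 ?yc0.
  + split=> [i i0|v]; first by rewrite xc_point hx// hx'// addr0.
    have up0 : (0 < upper v)%N by exact: leq_ltn_trans (valP v).
    by rewrite yc_point hy hy' (hx _ up0) (hx' _ up0) !mul0r subrr mulr0 !addr0.
  + by split=> [i i0|v]; rewrite ?xcN ?ycN ?hx ?hy ?oppr0.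
  + by split=> [i i0|v]; rewrite ?xc_point ?yc_point ?hx ?hy ?mulr0.
- move=> q; pose l : carnot R m :=
    point (fun i => if (0 < i)%N then 0 else xc q i) (fun=> 0).
  have Ll : lineX1 l.
    by split=> [i i0|v]; rewrite ?xc_point ?yc_point ?i0.
  exists (mulF q (invF l)), l; split => //.
  + by move=> i i0; rewrite xc_point xcN xc_point i0 ltnn subrr.
  + by rewrite -mulFA mulNF; apply: eq_carnot => [i|v];
      rewrite ?xc_point ?yc_point ?xc0 ?yc0; ring.
- apply/seteqP; split => [q [/= W0 [hx hy]]|q ->]; last first.
    by split=> [i _|]; last split=> [i _|v]; rewrite ?xc0 ?yc0.
  apply: eq_carnot => [i|v]; rewrite ?xc0 ?yc0 ?hy//.
  by have [/W0//|i0] := posnP i; rewrite hx.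
Qed.

End group.

Section projected.
Variables (R : realType) (m : nat).
Implicit Types (Omega : set (wspace R m)) (psi : wspace R m -> R).
Implicit Types (omega : hidx m -> wspace R m -> R).

Definition basisW (k : widx m) : wspace R m := delta_mx ord0 (enum_rank k).
Definition eX (j : hidx m) : wspace R m := basisW (inl j).
Definition eY (v : vidx m) : wspace R m := basisW (inr v).

Definition Dpsi psi (j : hidx m) (p : wspace R m) : wspace R m :=
  eX j - psi p *: eY (vidx1 j)
  + 2^-1 *: (\sum_(v : vidx m | lower v == val j) xW p (upper v) *: eY v)
  - 2^-1 *: (\sum_(v : vidx m | (upper v == val j) && (0 < lower v)%N)
               xW p (lower v) *: eY v).

Definition integral_curve Omega psi (j : hidx m) (I : set R)
    (gamma : R -> wspace R m) : Prop :=
  (forall t, I t -> Omega (gamma t)) /\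
  C1_with_derivative I gamma (Dpsi psi j \o gamma).

Definition distributional Omega psi omega : Prop :=
  forall (j : hidx m) (xi : wspace R m -> R), test_function Omega xi ->
  integral_rV Omega (fun p =>
      - psi p * 'D_(eX j) xi p
      + psi p ^+ 2 / 2 * 'D_(eY (vidx1 j)) xi p
      - 2^-1 * (\sum_(v : vidx m | lower v == val j)
                  xW p (upper v) * psi p * 'D_(eY v) xi p)
      + 2^-1 * (\sum_(v : vidx m | (upper v == val j) && (0 < lower v)%N)
                  xW p (lower v) * psi p * 'D_(eY v) xi p))
  = integral_rV Omega (fun p => omega j p * xi p).

Definition closed_ballW (nrm : carnot R m -> R) (a : wspace R m) (r : R) :
    set (wspace R m) := [set p | closure (ballF nrm (embW a) r) (embW p)].

Definition broad_star (nrm : carnot R m -> R) Omega psi omega : Prop :=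
  forall a0, Omega a0 -> exists d1 d2 : R,
  [/\ 0 < d2, d2 < d1, closed_ballW nrm a0 d1 `<=` Omega &
  exists E : hidx m -> wspace R m -> R -> wspace R m,
  forall a, closed_ballW nrm a0 d2 a -> forall j : hidx m,
  [/\ forall t, t \in `[- d2, d2] -> closed_ballW nrm a0 d1 (E j a t),
      E j a 0 = a,
      integral_curve Omega psi j `[- d2, d2] (E j a) &
      forall t, t \in `[- d2, d2] ->
        psi (E j a t) - psi a =
        oriented_integral 0 t (fun s => omega j (E j a s))]].

End projected.

(* Main.v *)
(**
Fix [j] and write [D^psi_j = X - psi Y], where [Y] is the derivative along
[y_{j1}] and [X] is an affine field commuting with [Y].  Move a smooth bump [xi]
along an integral curve [gamma] by the flows of [X] and [Y].  Since
[gamma' = X - psi(gamma) Y], the equation tested against [xi] gives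
  [d/dt int psi xi = int omega xi - 1/2 int (psi - psi(gamma))^2 Y xi].
This is Dafermos' argument for the Burgers equation: if [xi] increases along [Y]
except in a thin layer at [gamma], the last term is at most the small contribution
of that layer, where [psi] is close to [psi(gamma)]; mirroring the bump gives the
opposite inequality.  Letting the support of [xi] shrink to [gamma] yields
[(psi o gamma)' = omega_j o gamma], hence (a) with any bound of [omega_j] as
constant, and the integral identity of (b).  The curves required in (b) are given
by Peano's theorem.
*)

Require Import Defs.
From HB Require Import structures.
From mathcomp Require Import all_boot all_order all_algebra.
From mathcomp Require Import all_classical all_reals all_analysis.
From mathcomp Require Import measurable_realfun.
From mathcomp Require Import ring lra.

Set Implicit Arguments.
Unset Strict Implicit.
Unset Printing Implicit Defensive.

Import Order.TTheory GRing.Theory Num.Theory.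
Import numFieldNormedType.Exports.

Local Open Scope classical_set_scope.
Local Open Scope ring_scope.

(** * A class of smooth functions *)

(** The obstacle is the size of [Y xi]: the bump drops to zero inside the layer, so [Y xi] blows up
    as the layer thins, and smallness of [(psi - psi(gamma))^2] there does not by itself control the
    product. An integration by parts does: the steep part of [Y xi] is dominated in the layer by
    [bramp * cutoff'], whose integral is minus that of [bramp' * cutoff], and [bramp'] is at most a
    constant times [ramp]. That constant depends only on the length [ep] of the bump, whence the
    order of choice [de], [ep], [e2], [s], [et]. Both flows are explicit affine maps because the
    linear part of [X] squares to zero; the mass of the moving bump is constant, so averages of
    [psi] at two times can be compared. As [psi] is continuous on [Omega] only, the analysis is done
    with globally continuous functions, obtained by composition with a retraction onto a closed
    cube. Continuity of the homogeneous norm is not among its axioms, so its comparison with the sup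
    norm is derived from them. *)

Section flat.
Variable R : realType.
Implicit Types (P : {poly R}) (x y : R).

(** The functions [P(1/x) exp(-1/x)], extended by zero, form one family closed under
    differentiation, which the single function [exp(-1/x)] is not; [flat_deriv] is the action of the
    derivative on [P]. *)
Definition flat P x : R := if 0 < x then P.[x^-1] * expR (- x^-1) else 0.

Definition flat_deriv P : {poly R} := 'X^2 * (P - P^`()).

(** The term of degree [n + 2] of the exponential series is at most [expR y]. *)
Lemma exprM_expRN_le n y : 0 < y -> y ^+ n * expR (- y) <= n.+2`!%:R / y ^+ 2.
Proof.
move=> y0; have := expR_ge1Dxn n.+1 (ltW y0).
move=> /(le_trans (ler_wpDl ler01 (lexx _))).
rewrite ler_pdivrMr ?ltr0n ?fact_gt0// => le1.
rewrite expRN ler_pdivlMr ?exprn_gt0// mulrAC ler_pdivrMr ?expR_gt0//.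
by rewrite -exprD addn2 mulrC in le1 *; rewrite (le_trans le1)// mulrC.
Qed.

(** With [y = 1/x] the decay of the exponential becomes a factor [x ^+ 2], which makes [flat P]
    differentiable at 0 with derivative 0. *)
Lemma flat_quadratic P : exists2 C, 0 <= C & forall x, `|flat P x| <= C * x ^+ 2.
Proof.
exists (\sum_(i < size P) `|P`_i| * i.+2`!%:R).
  by apply: sumr_ge0 => i _; apply: mulr_ge0.
move=> x; rewrite /flat; case: ifPn => x0; last first.
  rewrite normr0 mulr_ge0 ?sqr_ge0//.
  by apply: sumr_ge0 => i _; apply: mulr_ge0.
rewrite horner_coef mulr_suml (le_trans (ler_norm_sum _ _ _))// mulr_suml.
apply: ler_sum => i _; rewrite -mulrA normrM -mulrA ler_wpM2l//.
rewrite ger0_norm; last by rewrite mulr_ge0 ?expR_ge0 ?exprn_ge0 ?invr_ge0 ?ltW.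
apply: le_trans (exprM_expRN_le _ _) _; first by rewrite invr_gt0.
by rewrite exprVn invrK.
Qed.

Lemma is_derive_flat P x : is_derive x 1 (flat P) (flat (flat_deriv P) x).
Proof.
have [x0|x0|->] := ltgtP x 0.
- have -> : flat (flat_deriv P) x = 0 by rewrite /flat ltNge (ltW x0).
  apply: (@near_eq_is_derive _ _ _ (cst 0)).
  near=> y; rewrite /flat ifN// -leNgt ltW//.
  by near: y; exact: lt_nbhsl.
- rewrite {2}/flat x0.
  apply: (@near_eq_is_derive _ _ _
      (fun y => (horner P \o GRing.inv) y * (expR \o (fun z => - z^-1)) y)).
    near=> y; rewrite /flat ifT//.
    by near: y; exact: lt_nbhsr.
  have dV : is_derive x 1 (@GRing.inv R) (- x^-2).
    have h : is_derive x 1 (@GRing.inv R \o id) (- x ^- 2 *: 1).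
      by apply: is_deriveV; rewrite gt_eqF.
    by apply: is_derive_eq; rewrite scaler1.
  apply: is_derive_eq.
  rewrite /flat_deriv !hornerE /= /GRing.scale /=.
  by rewrite !exprVn; ring.
have -> : flat (flat_deriv P) 0 = 0 by rewrite /flat ltxx.
have [C C0 hC] := flat_quadratic P.
suff h : h^-1 *: ((flat P \o shift 0) (h *: 1) - flat P 0) @[h --> 0^'] --> (0 : R).
  apply: DeriveDef; first by apply/cvg_ex; exists 0.
  by apply/cvg_lim.
rewrite {2}/flat ltxx.
apply/cvgrPdist_le => e e0; near=> h.
rewrite sub0r normrN subr0 /= addr0 normrZ normfV.
have h0 : h != 0 by near: h; exact: nbhs_dnbhs_neq.
rewrite ler_pdivrMl ?normr_gt0// (le_trans (hC _))//.
rewrite [h *: 1]mulr1 -real_normK ?num_real// expr2 mulrA mulrC ler_wpM2l//.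
have he : `|h| <= e / (C + 1).
  by near: h; apply: dnbhs0_le; rewrite divr_gt0// ltr_wpDl.
apply: le_trans (_ : (C + 1) * `|h| <= _); first by rewrite ler_wpM2r// lerDl.
by rewrite mulrC -ler_pdivlMr// ltr_wpDl.
Unshelve. all: by end_near. Qed.

Definition flatexp : R -> R := flat 1.
Definition flatexp' : R -> R := flat 'X^2.

Lemma is_derive_flatexp x : is_derive x 1 flatexp (flatexp' x).
Proof.
by have := is_derive_flat 1 x; rewrite /flat_deriv derivC subr0 mulr1.
Qed.

Lemma flatexp_gt0 x : 0 < x -> 0 < flatexp x.
Proof. by move=> x0; rewrite /flatexp /flat x0 hornerC mul1r expR_gt0. Qed.

Lemma flatexp_eq0 x : x <= 0 -> flatexp x = 0.
Proof. by rewrite leNgt => x0; rewrite /flatexp /flat (negbTE x0). Qed.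

Lemma flatexp_ge0 x : 0 <= flatexp x.
Proof. by have [/flatexp_eq0->//|/flatexp_gt0/ltW] := leP x 0. Qed.

Lemma flatexp_le1 x : flatexp x <= 1.
Proof.
rewrite /flatexp /flat; case: ifPn => // x0.
by rewrite hornerC mul1r expR_le1 oppr_le0 invr_ge0 ltW.
Qed.

Lemma flatexp_homo : {homo flatexp : x y / x <= y}.
Proof.
move=> x y xy; have [/flatexp_eq0->|x0] := leP x 0; first exact: flatexp_ge0.
rewrite /flatexp /flat x0 (lt_le_trans x0 xy) !hornerC !mul1r ler_expR lerN2.
by rewrite lef_pV2// posrE (lt_le_trans x0).
Qed.

(** This relation later bounds the slope of [cutoff] by a small multiple of [cutoff] itself, away
    from 0. *)
Lemma flatexp'E x : flatexp' x = flatexp x / x ^+ 2.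
Proof.
rewrite /flatexp' /flatexp /flat; case: ifPn => // _; last by rewrite mul0r.
by rewrite hornerC mul1r hornerXn exprVn mulrC.
Qed.

Lemma flatexp'_ge0 x : 0 <= flatexp' x.
Proof. by rewrite flatexp'E divr_ge0 ?flatexp_ge0 ?sqr_ge0. Qed.

Lemma flatexp'_eq0 x : x <= 0 -> flatexp' x = 0.
Proof. by move=> x0; rewrite flatexp'E flatexp_eq0 ?mul0r. Qed.

Lemma flatexp'_le2 x : flatexp' x <= 2.
Proof.
rewrite /flatexp' /flat; case: ifPn => // x0.
rewrite hornerXn expRN ler_pdivrMr ?expR_gt0// mulrC -ler_pdivrMr//.
have := @expR_ge1Dxn _ x^-1 1; rewrite invr_ge0 (ltW x0) => /(_ isT).
by apply: le_trans; rewrite lerDr.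
Qed.

End flat.

Section smooth_class.
Variables (R : realType) (N : nat).
Implicit Types (f g : 'rV[R]_N -> R) (p v : 'rV[R]_N).

(** A syntactic class: derivatives are found by structural recursion and stay inside it, so that
    smoothness, a statement about all iterated partials, needs no Leibniz or chain rule of higher
    order. *)
Inductive smooth_class : ('rV[R]_N -> R) -> Prop :=
| smooth_class_cst c : smooth_class (fun=> c)
| smooth_class_coord i : smooth_class (fun p => p ord0 i)
| smooth_class_add f g :
    smooth_class f -> smooth_class g -> smooth_class (f \+ g)
| smooth_class_mul f g :
    smooth_class f -> smooth_class g -> smooth_class (f \* g)
| smooth_class_flat P f : smooth_class f -> smooth_class (flat P \o f).

Lemma differentiable_flat P (x : R) : differentiable (flat P : R -> R) x.
Proof. by apply/derivable1_diffP; have [] := is_derive_flat P x. Qed.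

Lemma smooth_class_differentiable f p : smooth_class f -> differentiable f p.
Proof.
elim=> {f} [c|i|f g _ df _ dg|f g _ df _ dg|P f _ df].
- exact: differentiable_cst.
- exact: differentiable_coord.
- exact: differentiableD.
- exact: differentiableM.
- by apply: differentiable_comp => //; exact: differentiable_flat.
Qed.

Lemma smooth_class_derivable f p v : smooth_class f -> derivable f p v.
Proof. by move=> /smooth_class_differentiable df; apply: diff_derivable. Qed.

Lemma smooth_class_continuous f : smooth_class f -> continuous f.
Proof. by move=> cf p; apply/differentiable_continuous/smooth_class_differentiable. Qed.

Lemma derive_flat_comp P f p v : differentiable f p ->
  'D_v (flat P \o f) p = flat (flat_deriv P) (f p) * 'D_v f p.
Proof.
move=> df; have dP := differentiable_flat P (f p).
rewrite deriveE; last exact: differentiable_comp.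
rewrite diff_comp//= (deriv1E (iffRL (derivable1_diffP _ _) dP)) -deriveE//.
by rewrite derive1E (@derive_val _ _ _ _ _ _ _ (is_derive_flat P (f p))) mulrC.
Qed.

Lemma derive_coord i p v : 'D_v (fun p : 'rV[R]_N => p ord0 i) p = v ord0 i.
Proof.
have := @derive_mx R _ 1 N id p v; move=> /(_ (@derivable_id _ _ _ _)).
by rewrite derive_id => /matrixP/(_ ord0 i); rewrite mxE => ->.
Qed.

Lemma smooth_class_derive f v : smooth_class f -> smooth_class ('D_v f).
Proof.
elim=> {f} [c|i|f g sf df sg dg|f g sf df sg dg|P f sf df].
- have -> : 'D_v (fun=> c : R) = (fun=> 0) :> ('rV[R]_N -> R).
    by apply/funext => p; rewrite derive_cst.
  exact: smooth_class_cst.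
- have -> : 'D_v (fun p => p ord0 i : R) = (fun=> v ord0 i).
    by apply/funext => p; rewrite derive_coord.
  exact: smooth_class_cst.
- have -> : 'D_v (f \+ g) = 'D_v f \+ 'D_v g.
    by apply/funext => p; rewrite deriveD//; exact: smooth_class_derivable.
  exact: smooth_class_add.
- have -> : 'D_v (f \* g) = (f \* 'D_v g) \+ (g \* 'D_v f).
    by apply/funext => p; rewrite deriveM//; exact: smooth_class_derivable.
  by apply: smooth_class_add; exact: smooth_class_mul.
- have -> : 'D_v (flat P \o f) = (flat (flat_deriv P) \o f) \* 'D_v f.
    by apply/funext => p; rewrite derive_flat_comp//; exact: smooth_class_differentiable.
  by apply: smooth_class_mul => //; exact: smooth_class_flat.
Qed.

Lemma smooth_class_partials s f : smooth_class f -> smooth_class (partials s f).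
Proof. by move=> sf; elim: s => //= k s; exact: smooth_class_derive. Qed.

Lemma smooth_class_smooth f : smooth_class f -> smooth f.
Proof.
move=> sf s; have ss := smooth_class_partials s sf; split.
  exact: smooth_class_continuous.
by move=> k p; exact: smooth_class_derivable.
Qed.

Lemma smooth_class_prod (I : Type) (r : seq I) (F : I -> 'rV[R]_N -> R) :
  (forall i, smooth_class (F i)) -> smooth_class (fun p => \prod_(i <- r) F i p).
Proof.
move=> sF; elim: r => [|i r IH].
  by under eq_fun do rewrite big_nil; exact: smooth_class_cst.
by under eq_fun do rewrite big_cons; exact: smooth_class_mul.
Qed.

Lemma smooth_class_sum (I : Type) (r : seq I) (F : I -> 'rV[R]_N -> R) :
  (forall i, smooth_class (F i)) -> smooth_class (fun p => \sum_(i <- r) F i p).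
Proof.
move=> sF; elim: r => [|i r IH].
  by under eq_fun do rewrite big_nil; exact: smooth_class_cst.
by under eq_fun do rewrite big_cons; exact: smooth_class_add.
Qed.

End smooth_class.

(** * Integration over row vectors *)

Section row_norm.
Variables (R : realType) (N : nat).
Implicit Types (p q : 'rV[R]_N) (c : R).

Lemma row_normE p : `|p| = \big[Num.max/0]_ij `|p ij.1 ij.2|.
Proof. exact: mx_normrE. Qed.

Lemma row_norm_leP p c : 0 <= c -> (`|p| <= c) <-> (forall i, `|p ord0 i| <= c).
Proof.
move=> c0; rewrite row_normE; split => [pc i|pc].
  by apply: le_trans pc; apply: (@le_bigmax _ _ _ 0 (fun ij => `|p ij.1 ij.2|) (ord0, i)).
by apply: bigmax_le => // -[i j] _ /=; rewrite ord1.
Qed.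

Lemma row_norm_ltP p c : 0 < c -> (`|p| < c) <-> (forall i, `|p ord0 i| < c).
Proof.
move=> c0; rewrite row_normE; split => [pc i|pc].
  by apply: le_lt_trans pc; apply: (@le_bigmax _ _ _ 0 (fun ij => `|p ij.1 ij.2|) (ord0, i)).
by apply: bigmax_lt => // -[i j] _ /=; rewrite ord1.
Qed.

Lemma coord_le_norm p i : `|p ord0 i| <= `|p|.
Proof. by move: i; apply/(row_norm_leP p (normr_ge0 p)). Qed.

End row_norm.

Section integral_tuple.
Variable R : realType.
Local Notation mR := (measurableTypeR R).
Local Notation mu N := (lebesgue_tuple R N).

Lemma measurable_tuple_box N (A : 'I_N -> set mR) :
  (forall i, measurable (A i)) ->
  measurable [set t : N.-tuple mR | forall i, A i (tnth t i)].
Proof.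
move=> mA; rewrite (_ : mkset _ =
    \bigcap_(i in [set: 'I_N]) [set t | A i (tnth t i)]).
  apply: fin_bigcap_measurable => // i _.
  rewrite -[X in measurable X]setTI.
  exact: (@measurable_tnth _ mR N i).
by apply/seteqP; split => t /= h i; [move=> _|]; apply: h.
Qed.

Lemma row_of_tuple_nbhs N (t : N.-tuple mR) (U : set 'rV[R]_N) :
  nbhs (row_of_tuple t) U ->
  exists2 d, 0 < d &
    forall s : N.-tuple mR, (forall i, `|tnth t i - tnth s i : R| < d) -> U (row_of_tuple s).
Proof.
move=> /nbhs_normP[d /= d0 dU]; exists d => // s ts; apply: dU => /=.
by apply/row_norm_ltP => // i; rewrite !mxE.
Qed.

(** Tuples carry the product sigma-algebra, row vectors the topology of the sup norm. An open set is
    a countable union of cubes with rational centres, enumerated through [pickle]. *)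
Lemma measurable_row_of_tuple_open N (U : set 'rV[R]_N) :
  open U -> measurable (@row_of_tuple R N @^-1` U).
Proof.
move=> oU.
pose box (c : {ffun 'I_N -> int} * nat) : set (N.-tuple mR) :=
  [set t | forall i, [set x : mR | `|x - (c.1 i)%:~R / c.2.+1%:R : R| < 2 / c.2.+1%:R]
                     (tnth t i)].
pose F n : set (N.-tuple mR) :=
  if unpickle n is Some c then
    if pselect (box c `<=` @row_of_tuple R N @^-1` U) then box c else set0
  else set0.
have -> : @row_of_tuple R N @^-1` U = \bigcup_n F n.
  apply/seteqP; split => [t Ut|t [n _]]; last first.
    rewrite /F; case: unpickle => // c; case: pselect => // h /= bt; exact: (h _ bt).
  have [d d0 hd] := row_of_tuple_nbhs (open_nbhs_nbhs (conj oU Ut)).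
  (* Two points of a cube of half-side [2 / k.+1] are less than [4 / k.+1] apart, hence less than
     [d]; the floor puts [t] within [1 / k.+1] of the centre. *)
  pose k := Num.truncn (4 / d).
  have kd : 4 / k.+1%:R < d.
    by rewrite ltr_pdivrMr// mulrC -ltr_pdivrMr//; exact: truncnS_gt.
  pose c := ([ffun i => Num.floor ((tnth t i : R) * k.+1%:R)], k).
  have bt : box c t.
    move=> i /=; rewrite ffunE.
    set x : R := tnth t i.
    have := floor_itv (x * k.+1%:R).
    rewrite intrD => /andP[h1 h2].
    have {1}-> : x = x * k.+1%:R / k.+1%:R by rewrite mulfK.
    rewrite -mulrBl normrM [X in _ * X < _]ger0_norm// ltr_pM2r ?invr_gt0//.
    by rewrite ger0_norm ?subr_ge0//; lra.
  exists (pickle c) => //; rewrite /F pickleK; case: pselect => // -[] s bs.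
  apply: hd => i; apply: le_lt_trans kd.
  have -> : 4 / k.+1%:R = 2 / k.+1%:R + 2 / k.+1%:R :> R.
    by rewrite -mulrDl -natrD.
  have := bt i; have := bs i => /= /ltW hs /ltW ht.
  rewrite -(subrKA ((c.1 i)%:~R / k.+1%:R)) (le_trans (ler_normD _ _))//.
  by rewrite lerD// distrC.
apply: bigcupT_measurable => n; rewrite /F; case: unpickle => // c.
case: pselect => [h|h] /=; last exact: measurable0.
apply: (measurable_tuple_box (A := fun i => [set x : mR |
  `|x - (c.1 i)%:~R / c.2.+1%:R : R| < 2 / c.2.+1%:R])) => i.
rewrite (_ : mkset _ = ball ((c.1 i)%:~R / c.2.+1%:R : R) (2 / c.2.+1%:R)).
  exact: measurable_ball.
by apply/seteqP; split => x /=; rewrite /ball /= distrC.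
Qed.

Lemma measurable_fun_row_of_tuple N (f : 'rV[R]_N -> R) :
  continuous f -> measurable_fun setT (f \o @row_of_tuple R N).
Proof.
move=> /continuousP cf; apply: (measurability _ (RGenOpens.measurableE R)).
move=> _ [_ [a [b ->] <-]]; rewrite setTI comp_preimage.
apply: measurable_row_of_tuple_open; apply: cf; exact: interval_open.
Qed.

Section bounded_support.
Context d (T : measurableType d) (m : {measure set T -> \bar R}).

Lemma integrable_bounded_support (f : T -> R) (B : set T) C :
  measurable_fun setT f -> measurable B -> (m B < +oo)%E ->
  (forall x, `|f x| <= C) -> (forall x, f x != 0 -> B x) ->
  m.-integrable setT (EFin \o f).
Proof.
move=> mf mB mBoo fC fB.
apply: (@le_integrable _ _ _ _ _ _ _ (fun x => (C * \1_B x)%:E)) => //.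
- exact/measurable_EFinP.
- move=> x _ /=; rewrite lee_fin [leRHS]ger0_norm; last first.
    by rewrite mulr_ge0// (le_trans _ (fC x)).
  have [->|fx] := eqVneq (f x) 0.
    by rewrite normr0 mulr_ge0// (le_trans _ (fC x)).
  by rewrite indicE mem_set ?mulr1//; exact: fB.
- under eq_fun do rewrite EFinM.
  apply: integrableZl => //; apply/integrableP; split; first exact/measurable_EFinP.
  under eq_integral do rewrite gee0_abs ?lee_fin//.
  by rewrite integral_indic// setIT.
Qed.

End bounded_support.

End integral_tuple.

Section compact_support.
Variable R : realType.
Local Notation mR := (measurableTypeR R).
Local Notation mu N := (lebesgue_tuple R N).

Lemma closed_norm_le N M : closed [set p : 'rV[R]_N | `|p| <= M].
Proof.
have -> : [set p : 'rV[R]_N | `|p| <= M] = Num.norm @^-1` [set x | x <= M] by [].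
by apply: closed_comp => [p _|]; [exact: norm_continuous|exact: closed_le].
Qed.

Lemma compact_norm_le N M : compact [set p : 'rV[R]_N | `|p| <= M].
Proof.
apply: bounded_closed_compact; last exact: closed_norm_le.
exists M; split; first exact: num_real.
by move=> x Mx p /= pM; rewrite (le_trans pM)// ltW.
Qed.

Lemma compact_ball_le N (p0 : 'rV[R]_N) d : compact [set p : 'rV[R]_N | `|p - p0| <= d].
Proof.
apply: bounded_closed_compact.
  exists (`|p0| + d); split; first exact: num_real.
  move=> x hx p /= pd; rewrite -(subrK p0 p) (le_trans (ler_normD _ _))//.
  by rewrite (le_trans _ (ltW hx))// addrC lerD2l.
have -> : [set p | `|p - p0| <= d] = (fun p => p - p0) @^-1` [set p | `|p| <= d] by [].
apply: closed_comp; last exact: closed_norm_le.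
by move=> p _; apply: continuousB; [move=> ?; exact: cvg_id|exact: cst_continuous].
Qed.

Lemma continuous_bounded_on (T : topologicalType) (A : set T) (f : T -> R) :
  compact A -> {within A, continuous f} ->
  exists C, forall p, A p -> `|f p| <= C.
Proof.
move=> cA cf; have [[a Aa]|A0] := pselect (A !=set0); last first.
  by exists 0 => p Ap; case: A0; exists p.
have cnf : {within A, continuous (fun p => `|f p|)}.
  by move=> p; apply: continuous_comp; [exact: cf|exact: norm_continuous].
have [|c cA' hc] := compact_EVT_max _ cA cnf; first by exists a.
by exists `|f c| => p Ap; apply: hc; rewrite inE.
Qed.

(** The support is only asked to be bounded, a condition that passes to sums and products without
    handling closures. *)
Definition Cc N (f : 'rV[R]_N -> R) : Prop :=
  continuous f /\ exists M, forall p, f p != 0 -> `|p| <= M.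

Lemma Cc_bounded N (f : 'rV[R]_N -> R) : Cc f -> exists C, forall p, `|f p| <= C.
Proof.
move=> [cf [M fM]].
have [|C hC] := continuous_bounded_on (@compact_norm_le N M) (f := f).
  exact: continuous_subspaceT.
exists (Num.max C 0) => p; have [->|/fM/hC fC] := eqVneq (f p) 0.
  by rewrite normr0 le_max lexx orbT.
by rewrite le_max fC.
Qed.

Lemma CcM N (f g : 'rV[R]_N -> R) : continuous f -> Cc g -> Cc (f \* g).
Proof.
move=> cf [cg [M gM]]; split; first by move=> p; apply: continuousM; [exact: cf|exact: cg].
by exists M => p /=; rewrite mulf_eq0 negb_or => /andP[_ /gM].
Qed.

Lemma CcD N (f g : 'rV[R]_N -> R) : Cc f -> Cc g -> Cc (f \+ g).
Proof.
move=> [cf [M fM]] [cg [M' gM]]; split; first by move=> p; apply: continuousD;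
  [exact: cf|exact: cg].
exists (Num.max M M') => p /= fg0; rewrite le_max.
have [f0|/fM->//] := eqVneq (f p) 0.
by rewrite f0 add0r in fg0; rewrite gM ?orbT.
Qed.

Lemma CcZ N c (f : 'rV[R]_N -> R) : Cc f -> Cc (fun p => c * f p).
Proof. by move=> Cf; apply: (CcM (f := cst c)) => //; exact: cst_continuous. Qed.

Definition rV_integral N (f : 'rV[R]_N -> R) : R :=
  \int[mu N]_t f (row_of_tuple t).

Definition cube N (p : 'rV[R]_N) (d : R) : set (N.-tuple mR) :=
  [set t | forall i, (`[p ord0 i - d, p ord0 i + d]%classic : set mR) (tnth t i)].

Lemma measurable_cube N (p : 'rV[R]_N) d : measurable (cube p d).
Proof.
apply: (measurable_tuple_box
    (A := fun i => `[p ord0 i - d, p ord0 i + d]%classic : set mR)) => i.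
exact: measurable_itv.
Qed.

Lemma lebesgue_tuple_cube N (p : 'rV[R]_N) d : 0 < d ->
  mu N (cube p d) = ((2 * d) ^+ N)%:E.
Proof.
move=> d0; rewrite (lebesgue_tuple_box
    (A := fun i => `[p ord0 i - d, p ord0 i + d]%classic : set mR)); last first.
  by move=> i; exact: measurable_itv.
rewrite (eq_bigr (fun=> (2 * d)%:E)); last first.
  move=> i _; rewrite /= lebesgue_measure_itv /= lte_fin ifT; last by lra.
  by rewrite -EFinB; congr EFin; ring.
by rewrite prodEFin big_const_ord iter_mulr_1.
Qed.

Lemma lebesgue_tuple_cube_lty N (p : 'rV[R]_N) d : 0 < d ->
  (mu N (cube p d) < +oo)%E.
Proof. by move=> /(lebesgue_tuple_cube p) ->; rewrite ltry. Qed.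

Lemma cubeP N (p : 'rV[R]_N) d (t : N.-tuple mR) : 0 <= d ->
  cube p d t <-> `|row_of_tuple t - p| <= d.
Proof.
move=> d0; rewrite row_norm_leP//; split => h i; move: (h i).
  by rewrite /= in_itv /= !mxE ler_distl.
by rewrite /= in_itv /= !mxE ler_distl.
Qed.

Lemma integrable_Cc N (f : 'rV[R]_N -> R) : Cc f ->
  (mu N).-integrable setT (EFin \o (f \o @row_of_tuple R N)).
Proof.
move=> Cf; have [C hC] := Cc_bounded Cf; case: Cf => [cf [M fM]].
have M0 : 0 < Num.max M 1 by rewrite lt_max ltr01 orbT.
apply: (integrable_bounded_support _ (@measurable_cube N 0 (Num.max M 1))
         _ (C := C)) => //.
- exact: measurable_fun_row_of_tuple.
- exact: lebesgue_tuple_cube_lty.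
- by move=> t; exact: hC.
- move=> t /fM tM; apply/cubeP; first exact: ltW.
  by rewrite subr0 le_max tM.
Qed.

Lemma rV_integralD N (f g : 'rV[R]_N -> R) : Cc f -> Cc g ->
  rV_integral (f \+ g) = rV_integral f + rV_integral g.
Proof. by move=> /integrable_Cc Cf /integrable_Cc Cg; exact: RintegralD. Qed.

Lemma rV_integralZ N c (f : 'rV[R]_N -> R) : Cc f ->
  rV_integral (fun p => c * f p) = c * rV_integral f.
Proof. by move=> /integrable_Cc Cf; exact: RintegralZl. Qed.

Lemma rV_integral_ge0 N (f : 'rV[R]_N -> R) : (forall p, 0 <= f p) -> 0 <= rV_integral f.
Proof. by move=> f0; apply: Rintegral_ge0. Qed.

Lemma le_rV_integral N (f g : 'rV[R]_N -> R) : Cc f -> Cc g ->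
  (forall p, f p <= g p) -> rV_integral f <= rV_integral g.
Proof.
by move=> /integrable_Cc Cf /integrable_Cc Cg fg; apply: le_Rintegral.
Qed.

Lemma eq_rV_integral N (f g : 'rV[R]_N -> R) : f =1 g -> rV_integral f = rV_integral g.
Proof. by move=> /funext->. Qed.

(** The minimum of [f] on the closed cube, times the volume of the cube, is a positive lower
    bound. *)
Lemma rV_integral_gt0 N (f : 'rV[R]_N -> R) p0 d : 0 < d -> Cc f ->
  (forall p, 0 <= f p) -> (forall p, `|p - p0| <= d -> 0 < f p) ->
  0 < rV_integral f.
Proof.
move=> d0 Cf f0 fd.
have cB := @compact_ball_le N p0 d.
have [||c] := EVT_min_rV _ cB (f := f).
- by exists p0; rewrite /= subrr normr0 ltW.
- exact: continuous_subspaceT Cf.1.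
rewrite inE /= => /fd fc hc.
have d2 : 0 < (2 * d) ^+ N by rewrite exprn_gt0// mulr_gt0.
apply: (lt_le_trans (mulr_gt0 fc d2)).
have -> : f c * (2 * d) ^+ N = \int[mu N]_t (f c * \1_(cube p0 d) t).
  rewrite /Rintegral; under lebesgue_integral_definition.eq_integral do rewrite EFinM.
  rewrite ge0_integralZl//.
  - rewrite integral_indic ?setIT; [|by []|exact: measurable_cube].
    transitivity (fine ((f c)%:E * mu N (cube p0 d))%E); last by [].
    by rewrite lebesgue_tuple_cube.
  - apply/measurable_EFinP; apply: measurable_indic; exact: measurable_cube.
  - by rewrite lee_fin ltW.
apply: le_Rintegral => //.
- apply: (integrable_bounded_support _ (measurable_cube p0 d) _ (C := f c)) => //.
  + apply: measurable_funM => //; apply: measurable_indic; exact: measurable_cube.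
  + exact: lebesgue_tuple_cube_lty.
  + move=> t; rewrite indicE; case: (_ \in _); rewrite ?mulr1 ?mulr0 ?normr0 ?(ltW fc)//.
    by rewrite ger0_norm// ltW.
  + move=> t; rewrite indicE; case: (boolP (t \in _)) => [/set_mem//|_].
    by rewrite mulr0 eqxx.
- exact: integrable_Cc.
- move=> t _; rewrite indicE; case: (boolP (_ \in _)); last by rewrite mulr0.
  by rewrite inE mulr1 => /(cubeP _ _ (ltW d0)) tp; apply: hc; rewrite inE.
Qed.

End compact_support.

(** * Integrals of partial derivatives vanish *)

Section integral_derivative.
Variable R : realType.
Local Notation mR := (measurableTypeR R).
Local Notation mu N := (lebesgue_tuple R N).

Definition consV N (x : R) (q : 'rV[R]_N) : 'rV[R]_N.+1 :=
  \row_i oapp (fun j => q ord0 j) x (unlift ord0 i).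

Lemma consV0 N x (q : 'rV[R]_N) : consV x q ord0 ord0 = x.
Proof. by rewrite mxE unlift_none. Qed.

Lemma consVS N x (q : 'rV[R]_N) j : consV x q ord0 (lift ord0 j) = q ord0 j.
Proof. by rewrite mxE liftK. Qed.

Lemma consVB N x y (q r : 'rV[R]_N) : consV x q - consV y r = consV (x - y) (q - r).
Proof.
apply/rowP => i; rewrite !mxE.
by case: (unliftP ord0 i) => [j _|_] /=; rewrite ?mxE.
Qed.

Lemma norm_consV_le N x (q : 'rV[R]_N) c :
  `|consV x q| <= c <-> `|x| <= c /\ `|q| <= c.
Proof.
split=> [qc|[xc qc]].
  have c0 : 0 <= c by rewrite (le_trans _ qc).
  move/(row_norm_leP _ c0) : qc => h; split; first by have := h ord0; rewrite consV0.
  by apply/row_norm_leP => // i; have := h (lift ord0 i); rewrite consVS.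
have c0 : 0 <= c by rewrite (le_trans _ qc).
apply/row_norm_leP => // i; case: (unliftP ord0 i) => [j ->|->].
  by rewrite consVS; move/row_norm_leP : qc; apply.
by rewrite consV0.
Qed.

Lemma lipschitz1_continuous (V W : normedModType R) (f : V -> W) :
  (forall x y, `|f x - f y| <= `|x - y|) -> continuous f.
Proof.
move=> fL x; apply/cvgrPdist_lt => e e0.
by apply/nbhs_normP; exists e => // y /= /(le_lt_trans (fL _ _)).
Qed.

Lemma consV_continuousl N (q : 'rV[R]_N) : continuous (fun x => consV x q).
Proof.
apply: lipschitz1_continuous => x y; rewrite consVB subrr.
by apply/norm_consV_le; rewrite normr0.
Qed.

Lemma consV_continuousr N x : continuous (@consV N x).
Proof.
apply: lipschitz1_continuous => q r; rewrite consVB subrr.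
by apply/norm_consV_le; rewrite normr0.
Qed.

Lemma row_of_cons_pair N (p : mR * N.-tuple mR) :
  row_of_tuple (cons_pair p) = consV p.1 (row_of_tuple p.2).
Proof.
apply/rowP => i; case: (unliftP ord0 i) => [j ->|->].
  by rewrite consVS !mxE tnthS.
by rewrite consV0 mxE tnth0.
Qed.

Lemma integrable_cons_pair N (f : 'rV[R]_N.+1 -> R) : Cc f ->
  (lebesgue_measure \x mu N)%E.-integrable setT
    (fun p => (f (row_of_tuple (cons_pair p)))%:E).
Proof.
move=> Cf; have [C hC] := Cc_bounded Cf; case: Cf => [cf [M fM]].
have M0 : 0 < Num.max M 1 by rewrite lt_max ltr01 orbT.
apply: (integrable_bounded_support _
   (measurable_preimage_cons_pair (@measurable_cube R N.+1 0 (Num.max M 1)))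
         _ (C := C)) => //.
- apply: (measurableT_comp (measurable_fun_row_of_tuple cf)).
  exact: measurable_cons_pair.
- exact: (@lebesgue_tuple_cube_lty R N.+1 0 _ M0).
- move=> t /= /fM tM; apply/cubeP; first exact: ltW.
  by rewrite subr0 le_max tM.
Qed.

Lemma integral_cons_pair N (f : 'rV[R]_N.+1 -> R) : Cc f ->
  (\int[mu N.+1]_t (f (row_of_tuple t))%:E =
   \int[lebesgue_measure \x mu N]_p (f (row_of_tuple (cons_pair p)))%:E)%E.
Proof.
move=> Cf; rewrite [LHS](integral_pushforward (@measurable_cons_pair R N)) //.
- apply/measurable_EFinP; apply: measurable_fun_row_of_tuple; exact: Cf.1.
- exact: integrable_cons_pair.
Qed.

(** The fundamental theorem of calculus on [[-A, A]], with [A] strictly beyond the support so that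
    [f] vanishes at both ends. *)
Lemma integral_derive1 (f df : R -> R) M : continuous df ->
  (forall x : R, is_derive x 1 f (df x)) -> (forall x, f x != 0 -> `|x| <= M) ->
  (forall x, df x != 0 -> `|x| <= M) ->
  (\int[lebesgue_measure]_x (df x)%:E = 0)%E.
Proof.
move=> cdf fdf fM dfM.
pose A := Num.max M 0 + 1.
have A0 : 0 < A by rewrite ltr_wpDl// le_max lexx orbT.
have MA : M < A by rewrite ltr_pwDr// le_max lexx.
have f0 x : A <= `|x| -> f x = 0.
  by move=> Ax; apply/eqP; apply: contraTT Ax => /fM xM; rewrite -ltNge (le_lt_trans xM).
pose I : set R := `[- A, A]%classic.
have -> : (\int[lebesgue_measure]_x (df x)%:E =
           \int[lebesgue_measure]_(x in I) (df x)%:E)%E.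
  rewrite [RHS]integral_mkcond; apply: lebesgue_integral_definition.eq_integral => x _.
  rewrite patchE; case: ifPn => // /negP xA; congr EFin.
  apply/eqP; apply/negPn/negP => /dfM xM; apply: xA; rewrite inE /I /= in_itv /=.
  by rewrite -ler_norml (le_trans xM)// ltW.
have cf x : {for x, continuous f}.
  by apply/differentiable_continuous/derivable1_diffP; have [] := fdf x.
rewrite (continuous_FTC2 (F := f)).
- by rewrite !f0 ?subee// ?normrN ?ger0_norm// ltW.
- by rewrite gtrN.
- exact: continuous_subspaceT.
- split.
  + by move=> x _; have [] := fdf x.
  + by apply: cvg_at_right_filter; exact: cf.
  + by apply: cvg_at_left_filter; exact: cf.
- by move=> x _; rewrite derive1E; have [_ ->] := fdf x.
Qed.

(** A directional derivative sees only the restriction to one line; this carries it between spaces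
    of different dimension. *)
Lemma is_derive_along (V1 V2 : normedModType R) (f : V1 -> R) (g : V2 -> R)
    (a v : V1) (b w : V2) d :
  (forall h, f (h *: v + a) = g (h *: w + b)) ->
  is_derive a v f d -> is_derive b w g d.
Proof.
move=> fg [fav fd].
have fgq : (fun h : R => h^-1 *: ((f \o shift a) (h *: v) - f a)) =
           (fun h : R => h^-1 *: ((g \o shift b) (h *: w) - g b)).
  apply/funext => h /=; rewrite fg; congr (_ *: (_ - _)).
  by have := fg 0; rewrite !scale0r !add0r.
by apply: DeriveDef; [move: fav; rewrite /derivable fgq|rewrite -fd /derive fgq].
Qed.

(** Induction on the dimension by Fubini. The order of integration depends on [i]: for the first
    coordinate the inner integral is one-dimensional, otherwise it falls under the induction
    hypothesis. *)
Lemma integral_partial N (i : 'I_N) (f df : 'rV[R]_N -> R) :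
  Cc f -> Cc df -> (forall p, is_derive p (delta_mx ord0 i : 'rV[R]_N) f (df p)) ->
  (\int[mu N]_t (df (row_of_tuple t))%:E = 0)%E.
Proof.
elim: N i f df => [[]//|N IH] i f df Cf Cdf fdf.
rewrite integral_cons_pair//.
have intdf := integrable_cons_pair Cdf.
have [_ [M fM]] := Cf; have [_ [M' dfM]] := Cdf.
case: (unliftP ord0 i) => [j ij|i0].
- rewrite -integral12_prod_meas1//; apply: integral0_eq => x _.
  rewrite /fubini_F /=; under lebesgue_integral_definition.eq_integral do rewrite
    row_of_cons_pair/=.
  apply: (IH j (f \o consV x) (df \o consV x)).
  + split; last by exists M => q /= /fM /norm_consV_le[].
    by move=> q; apply: continuous_comp; [exact: consV_continuousr|exact: Cf.1].
  + split; last by exists M' => q /= /dfM /norm_consV_le[].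
    by move=> q; apply: continuous_comp; [exact: consV_continuousr|exact: Cdf.1].
  + move=> q; apply: is_derive_along (fdf (consV x q)) => h /=.
    congr f; apply/rowP => k; rewrite ij !mxE eqxx /=.
    case: (unliftP ord0 k) => [l ->|->] /=; rewrite ?mxE /=.
      by rewrite (inj_eq lift_inj).
    by rewrite mulr0 add0r.
- rewrite -integral21_prod_meas1//; apply: integral0_eq => t _.
  rewrite /fubini_G /=; under lebesgue_integral_definition.eq_integral do rewrite
    row_of_cons_pair/=.
  apply: (@integral_derive1 (fun x => f (consV x (row_of_tuple t))) _ (Num.max M M')).
  + by move=> q; apply: continuous_comp; [exact: consV_continuousl|exact: Cdf.1].
  + move=> x; apply: is_derive_along (fdf (consV x _)) => h /=.
    congr f; apply/rowP => k; rewrite i0 !mxE eqxx /=.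
    case: (unliftP ord0 k) => [l ->|->] //=.
    by rewrite mulr0 add0r.
  + by move=> x /fM /norm_consV_le[xM _]; rewrite le_max xM.
  + by move=> x /dfM /norm_consV_le[xM _]; rewrite le_max xM orbT.
Qed.

Lemma rV_integral_derive N (i : 'I_N) (f df : 'rV[R]_N -> R) :
  Cc f -> Cc df -> (forall p, is_derive p (delta_mx ord0 i : 'rV[R]_N) f (df p)) ->
  rV_integral df = 0.
Proof.
by move=> Cf Cdf fdf; rewrite /rV_integral /Rintegral (integral_partial Cf Cdf fdf).
Qed.

End integral_derivative.

(** * Integrals against a moving function *)

Section moving.
Variable R : realType.

Lemma derive_le_increment (f df : R -> R) (u v C : R) :
  (forall t : R, u < t < v -> is_derive t 1 f (df t)) ->
  (forall t, u < t < v -> df t <= C) ->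
  forall s t, u < s -> s <= t -> t < v -> f t - f s <= C * (t - s).
Proof.
move=> fdf dfC s t us st tv.
have sub x : s <= x <= t -> u < x < v.
  by move=> /andP[sx xt]; rewrite (lt_le_trans us sx) (le_lt_trans xt tv).
have [x xst ->] : exists2 x, x \in `[s, t] & f t - f s = df x * (t - s).
  apply: MVT_segment => //.
    move=> x; rewrite in_itv /= => /andP[/ltW sx /ltW xt]; apply: fdf.
    by apply: sub; rewrite sx.
  apply: derivable_within_continuous => x; rewrite in_itv /= => /sub/fdf[].
  by [].
rewrite ler_wpM2r ?subr_ge0//; apply: dfC; apply: sub.
by rewrite in_itv in xst.
Qed.

Lemma derive0_constant (f : R -> R) (u v : R) :
  (forall t : R, u < t < v -> is_derive t 1 f 0) ->
  forall s t, u < s < v -> u < t < v -> f t = f s.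
Proof.
move=> f0; suff H s t : u < s -> s <= t -> t < v -> f t = f s.
  move=> s t /andP[us sv] /andP[ut tv]; have [st|/ltW ts] := leP s t.
    exact: H.
  by rewrite (H t s).
move=> us st tv; apply/eqP; rewrite eq_le -subr_le0 -[X in _ && X]subr_le0.
have := derive_le_increment f0 (fun _ _ => lexx 0) us st tv.
rewrite mul0r => -> /=.
have g0 (x : R) : u < x < v -> is_derive x 1 (- f) 0.
  by move=> /f0 fx; rewrite -[0]oppr0; exact: is_deriveN.
have := derive_le_increment g0 (fun _ _ => lexx 0) us st tv.
by rewrite mul0r /= opprK addrC.
Qed.

(** Domination: for all times in []u, v[] the supports lie in one cube, where the time derivative of
    the integrand is at most [|C| * |K|]. *)
Lemma is_derive_moving_integral N (phi : 'rV[R]_N -> R) (Xi dXi : R -> 'rV[R]_N -> R)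
    (u v M K a : R) : u < a < v -> continuous phi ->
  (forall t, continuous (Xi t)) -> (forall t, continuous (dXi t)) ->
  (forall t p, u < t < v -> Xi t p != 0 -> `|p| <= M) ->
  (forall t p, u < t < v -> dXi t p != 0 -> `|p| <= M) ->
  (forall t p, u < t < v -> `|dXi t p| <= K) ->
  (forall (t : R) p, u < t < v -> is_derive t 1 (Xi ^~ p) (dXi t p)) ->
  is_derive a 1 (fun t => rV_integral (phi \* Xi t))
    (rV_integral (phi \* dXi a)).
Proof.
move=> uav cphi cXi cdXi XiM dXiM dXiK XidXi.
have [C hC] : exists C, forall p, `|p| <= M -> `|phi p| <= C.
  apply: (@continuous_bounded_on _ _ [set p | `|p| <= M]); first exact: compact_norm_le.
  exact: continuous_subspaceT.
pose Y := N.-tuple (measurableTypeR R).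
pose f t (y : Y) := phi (row_of_tuple y) * Xi t (row_of_tuple y).
have M0 : 0 < Num.max M 1 by rewrite lt_max ltr01 orbT.
pose B := @cube R N 0 (Num.max M 1).
pose G (y : Y) := `|C| * `|K| * \1_B y.
have fd t y : u < t < v -> is_derive t 1 (f ^~ y) (phi (row_of_tuple y) * dXi t (row_of_tuple y)).
  move=> tuv; have h := XidXi t (row_of_tuple y) tuv.
  have : is_derive t 1 (phi (row_of_tuple y) *: (Xi ^~ (row_of_tuple y)))
    (phi (row_of_tuple y) *: dXi t (row_of_tuple y)) by exact: is_deriveZ.
  by [].
have Itv t : `]u, v[%classic t -> u < t < v by rewrite /= in_itv.
have aI : `]u, v[%classic a by rewrite /= in_itv.
have intf t : `]u, v[%classic t ->
    (lebesgue_tuple R N).-integrable setT (EFin \o f t).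
  move=> /Itv tuv; apply: (integrable_Cc (f := phi \* Xi t)); apply: CcM => //.
  by split => //; exists M => p; exact: XiM.
have derf t y : `]u, v[%classic t -> setT y -> derivable (f ^~ y) t 1.
  by move=> /Itv tuv _; have [] := fd t y tuv.
have G0 y : 0 <= G y by rewrite mulr_ge0// mulr_ge0.
have intG : (lebesgue_tuple R N).-integrable setT (EFin \o G).
  apply: (integrable_bounded_support _ (measurable_cube 0 (Num.max M 1)) _
     (C := `|C| * `|K|)) => //.
  - apply: measurable_funM => //; apply: measurable_indic; exact: measurable_cube.
  - exact: lebesgue_tuple_cube_lty.
  - move=> y; rewrite /G indicE normrM normrM !normr_id.
    by rewrite ler_piMr ?mulr_ge0//; case: (_ \in _); rewrite ?normr1 ?normr0.
  - move=> y; rewrite /G indicE; case: (boolP (y \in _)) => [/set_mem//|_].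
    by rewrite mulr0 eqxx.
have Gub t y : `]u, v[%classic t -> setT y -> `|partial1of2 f t y| <= G y.
  move=> /Itv tuv _; rewrite partial1of2E (@derive_val _ _ _ _ _ _ _ (fd t y tuv)).
  rewrite /G indicE; have [dXi0|dXi0] := eqVneq (dXi t (row_of_tuple y)) 0.
    by rewrite dXi0 mulr0 normr0 mulr_ge0// mulr_ge0.
  have yM := dXiM _ _ tuv dXi0.
  rewrite mem_set ?mulr1; last first.
    by apply/cubeP; [exact: ltW|rewrite subr0 le_max yM].
  rewrite normrM ler_pM//; first by rewrite (le_trans (hC _ yM))// ler_norm.
  by rewrite (le_trans (dXiK _ _ tuv))// ler_norm.
have dI := derivable_under_integral measurableT aI intf derf G0 intG Gub.
have eI := differentiation_under_integral measurableT aI intf derf G0 intG Gub.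
apply: DeriveDef; first exact: dI.
rewrite -derive1E; rewrite [LHS]eI; apply: eq_Rintegral => y _.
by rewrite partial1of2E (@derive_val _ _ _ _ _ _ _ (fd a y uav)).
Qed.

End moving.

(** * The energy identity *)

Section energy.
Variables (R : realType) (N : nat).
Local Notation V := 'rV[R]_N.
Implicit Types (F G f g : V -> R).

Lemma rV_integral_comb a b f g : Cc f -> Cc g ->
  rV_integral (fun q => a * f q + b * g q) = a * rV_integral f + b * rV_integral g.
Proof.
move=> Cf Cg; rewrite (rV_integralD (f := fun q => a * f q) (g := fun q => b * g q));
  [|exact: CcZ..].
by rewrite !rV_integralZ.
Qed.

(** With [F = X xi] and [G = Y xi] this is the vanishing derivative of the mass of the moving bump;
    the factor [cst 1] matches the form of [is_derive_moving_integral]. *)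
Lemma rV_integral_transport0 a F G : Cc F -> Cc G ->
  rV_integral F = 0 -> rV_integral G = 0 ->
  rV_integral (cst 1 \* (fun q => - F q + a * G q)) = 0.
Proof.
move=> CF CG F0 G0; have := rV_integral_comb (-1) a CF CG.
rewrite F0 G0 !mulr0 addr0 => h; apply: etrans h.
by apply: eq_rV_integral => q /=; rewrite mul1r mulN1r.
Qed.

(** Here [F = X xi], [G = Y xi], and [psi0] is the value of [psi] at the current point of the curve.
    Completing the square, [psi * psi0 = psi ^+ 2 / 2 - (psi - psi0) ^+ 2 / 2 + psi0 ^+ 2 / 2],
    makes the weak equation appear, and the last term integrates to 0 against [G]. [B1] is the
    contribution of the layer; it is exchanged for [B2], which is controlled by [xi]. *)
Lemma energy_estimate (psi om F G xi B1 B2 : V -> R) (sg psi0 c e e2 ratio : R) :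
  continuous psi -> continuous om -> Cc F -> Cc G -> Cc xi -> Cc B1 -> Cc B2 ->
  rV_integral (fun q => - psi q * F q + psi q ^+ 2 / 2 * G q) =
  rV_integral (fun q => om q * xi q) ->
  rV_integral G = 0 -> rV_integral B1 = rV_integral B2 ->
  (forall q, sg * (om q * xi q) - (psi q - psi0) ^+ 2 / 2 * (sg * G q) <=
             (c + e) * xi q + e2 * B1 q) ->
  (forall q, B2 q <= ratio * xi q) -> (forall q, 0 <= xi q) ->
  0 <= e2 -> e2 * ratio <= e ->
  sg * rV_integral (psi \* (fun q => - F q + psi0 * G q)) <=
  (c + 2 * e) * rV_integral xi.
Proof.
move=> cpsi com CF CG Cxi CB1 CB2 weak G0 B12 ptw B2xi xi0 e20 e2e.
have csq : continuous (fun q => psi q ^+ 2 / 2).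
  move=> q; apply: (@continuousM _ _ (fun q => psi q ^+ 2) (cst 2^-1)); last exact: cst_continuous.
  by rewrite /= (_ : (fun q => _) = fun q => psi q * psi q); [apply: continuousM; exact: cpsi|].
have csq' : continuous (fun q => (psi q - psi0) ^+ 2 / 2).
  move=> q; apply: (@continuousM _ _ (fun q => (psi q - psi0) ^+ 2) (cst 2^-1));
    last exact: cst_continuous.
  have cB : continuous (fun q => psi q - psi0).
    by move=> q'; apply: continuousB; [exact: cpsi|exact: cst_continuous].
  by rewrite /= (_ : (fun q => _) = fun q => (psi q - psi0) * (psi q - psi0)); [apply: continuousM;
    exact: cB|].
have CpF : Cc (fun q => psi q * F q) by exact: (CcM cpsi CF).
have CsG : Cc (fun q => psi q ^+ 2 / 2 * G q) by exact: (CcM csq CG).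
have CsG' : Cc (fun q => (psi q - psi0) ^+ 2 / 2 * G q) by exact: (CcM csq' CG).
have Cox : Cc (fun q => om q * xi q) by exact: (CcM com Cxi).
have C1 : Cc (fun q => -1 * (psi q * F q) + 1 * (psi q ^+ 2 / 2 * G q)).
  by apply: CcD; exact: CcZ.
have E1 : rV_integral (psi \* (fun q => - F q + psi0 * G q)) =
    rV_integral (fun q => om q * xi q) - rV_integral (fun q => (psi q - psi0) ^+ 2 / 2 * G q).
  transitivity (rV_integral (fun q => 1 * (fun q => -1 * (psi q * F q) + 1 * (psi q ^+ 2 / 2 * G
    q)) q +
     1 * (fun q => -1 * ((psi q - psi0) ^+ 2 / 2 * G q) + psi0 ^+ 2 / 2 * G q) q)).
    by apply: eq_rV_integral => q /=; field.
  rewrite rV_integral_comb//; last by apply: CcD; exact: CcZ.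
  rewrite !mul1r (rV_integral_comb (-1) (psi0 ^+ 2 / 2) CsG' CG) G0 mulr0 addr0 mulN1r.
  congr (_ - _); rewrite -weak; apply: eq_rV_integral => q; ring.
rewrite E1.
have -> : sg * (rV_integral (fun q => om q * xi q) -
    rV_integral (fun q => (psi q - psi0) ^+ 2 / 2 * G q)) =
    rV_integral (fun q => sg * (om q * xi q) + - sg * ((psi q - psi0) ^+ 2 / 2 * G q)).
  by rewrite (rV_integral_comb _ _ Cox CsG'); ring.
(* The pointwise bound costs one [e], and the layer costs [e2 * ratio <= e]: hence the factor 2. *)
apply: le_trans (_ : (c + e) * rV_integral xi + e2 * rV_integral B1 <= _).
  rewrite -(rV_integral_comb _ _ Cxi CB1); apply: le_rV_integral.
  - by apply: CcD; exact: CcZ.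
  - by apply: CcD; exact: CcZ.
  - move=> q; apply: le_trans (ptw q).
    by rewrite le_eqVlt; apply/orP; left; apply/eqP; ring.
rewrite B12.
have h1 : rV_integral B2 <= ratio * rV_integral xi.
  by rewrite -rV_integralZ//; apply: le_rV_integral => //; exact: CcZ.
have I0 : 0 <= rV_integral xi by exact: rV_integral_ge0.
have h2 : e2 * rV_integral B2 <= e2 * (ratio * rV_integral xi) by rewrite ler_wpM2l.
have h3 : e2 * ratio * rV_integral xi <= e * rV_integral xi by rewrite ler_wpM2r.
have -> : (c + 2 * e) * rV_integral xi = (c + e) * rV_integral xi + e * rV_integral xi by ring.
by rewrite lerD2l (le_trans h2)// mulrA.
Qed.

Lemma integral_average_le (psi xi : V -> R) (a e : R) :
  continuous psi -> Cc xi -> (forall q, 0 <= xi q) ->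
  (forall q, xi q != 0 -> `|psi q - a| <= e) ->
  `|rV_integral (psi \* xi) - a * rV_integral xi| <= e * rV_integral xi.
Proof.
move=> cpsi Cxi xi0 osc.
have Cp : Cc (psi \* xi) by exact: CcM.
have ub : rV_integral (psi \* xi) <= (a + e) * rV_integral xi.
  rewrite -rV_integralZ//; apply: le_rV_integral => // [|q /=]; first exact: CcZ.
  have [->|/osc] := eqVneq (xi q) 0; first by rewrite !mulr0.
  by rewrite ler_distl => /andP[_ h]; rewrite ler_wpM2r.
have lb : (a - e) * rV_integral xi <= rV_integral (psi \* xi).
  rewrite -rV_integralZ//; apply: le_rV_integral => // [|q /=]; first exact: CcZ.
  have [->|/osc] := eqVneq (xi q) 0; first by rewrite !mulr0.
  by rewrite ler_distl => /andP[h _]; rewrite ler_wpM2r.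
by rewrite ler_distl; move: ub lb; rewrite mulrDl mulrBl => -> ->.
Qed.

(** [I1 / J] and [I2 / J] are averages of [psi] over the bump at two times; [a1] and [a2] are its
    values on the curve, each within [de] of the average. *)
Lemma increment_of_averages (sg c de J I1 I2 a1 a2 D : R) :
  sg * sg = 1 -> 0 < J -> `|I1 - a1 * J| <= de * J -> `|I2 - a2 * J| <= de * J ->
  sg * (I2 - I1) <= c * J * D -> sg * (a2 - a1) <= c * D + 2 * de.
Proof.
move=> sg2 J0 o1 o2 Hinc; rewrite -(ler_pM2r J0).
have sg1 : `|sg| = 1 by apply/eqP; rewrite -sqr_norm_eq1 expr2 sg2.
have o1' : sg * (I1 - a1 * J) <= de * J.
  by rewrite (le_trans (ler_norm _))// normrM sg1 mul1r.
have o2' : - sg * (I2 - a2 * J) <= de * J.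
  by rewrite (le_trans (ler_norm _))// normrM normrN sg1 mul1r.
have -> : sg * (a2 - a1) * J =
  - sg * (I2 - a2 * J) + sg * (I1 - a1 * J) + sg * (I2 - I1) by ring.
have -> : (c * D + 2 * de) * J = de * J + de * J + c * J * D by ring.
by rewrite !lerD.
Qed.

End energy.

(** * The moving bump *)

Section derive_along_lemmas.
Variables (R : realType) (N : nat).
Implicit Types (f g : 'rV[R]_N -> R) (p q v w : 'rV[R]_N).

Lemma linear_coord_sum (L : {linear 'rV[R]_N -> 'rV[R]_N}) p i :
  L p ord0 i = \sum_l p ord0 l * L (delta_mx ord0 l) ord0 i.
Proof.
rewrite {1}(row_sum_delta p) linear_sum summxE.
by apply: eq_bigr => l _; rewrite linearZ mxE.
Qed.

Lemma smooth_class_linear (L : {linear 'rV[R]_N -> 'rV[R]_N}) i :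
  smooth_class (fun p => L p ord0 i).
Proof.
rewrite (_ : (fun p => _) = fun p => \sum_l p ord0 l * L (delta_mx ord0 l) ord0 i).
  apply: smooth_class_sum => l; apply: smooth_class_mul; first exact: smooth_class_coord.
  exact: smooth_class_cst.
by apply/funext => p; exact: linear_coord_sum.
Qed.

Lemma smooth_class_comp (T : 'rV[R]_N -> 'rV[R]_N) f :
  (forall i, smooth_class (fun p => T p ord0 i)) -> smooth_class f ->
  smooth_class (f \o T).
Proof.
move=> sT; elim=> {f} [c|i|f g _ sf _ sg|f g _ sf _ sg|P f _ sf].
- exact: smooth_class_cst.
- exact: sT.
- exact: (smooth_class_add sf sg).
- exact: (smooth_class_mul sf sg).
- exact: (smooth_class_flat P sf).
Qed.

Lemma derive_coord_sum f p v : differentiable f p ->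
  'D_v f p = \sum_i v ord0 i * 'D_(delta_mx ord0 i) f p.
Proof.
move=> df; rewrite deriveE// {1}(row_sum_delta v) linear_sum.
by apply: eq_bigr => i _; rewrite linearZ /= -deriveE.
Qed.

Lemma deriveDl f p v w a b : differentiable f p ->
  'D_(a *: v + b *: w) f p = a * 'D_v f p + b * 'D_w f p.
Proof. by move=> df; rewrite !deriveE// linearD !linearZ. Qed.

(** Outside the closed set [S] the function vanishes on a whole neighbourhood. *)
Lemma derive_support f (S : set 'rV[R]_N) p v : closed S ->
  (forall q, f q != 0 -> S q) -> 'D_v f p != 0 -> S p.
Proof.
move=> cS fS; apply: contraNP => Sp.
have : \forall q \near p, ~ S q by apply: open_nbhs_nbhs; split => //; exact: closed_openC.
move=> nS; rewrite (@near_eq_derive _ _ _ _ (cst 0) p v) ?derive_cst//.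
near=> q; apply/eqP/negPn/negP => /fS.
by near: q.
Unshelve. all: by end_near. Qed.

Lemma is_derive_curve f (c : R -> 'rV[R]_N) (t : R) v :
  differentiable f (c t) -> is_derive t 1 c v -> is_derive t 1 (f \o c) ('D_v f (c t)).
Proof.
move=> df [dc cv]; have dc' : differentiable c t by apply/derivable1_diffP.
have dfc : differentiable (f \o c) t by exact: differentiable_comp.
apply: DeriveDef; first exact/derivable1_diffP.
by rewrite deriveE// diff_comp//= -(deriveE _ dc') cv deriveE.
Qed.

Lemma is_derive_coord_curve (c : R -> 'rV[R]_N) (t : R) v i :
  is_derive t 1 c v -> is_derive t 1 (fun s => c s ord0 i) (v ord0 i).
Proof.
move=> dc; rewrite -(derive_coord i (c t) v).
by apply: (is_derive_curve (f := fun p => p ord0 i)) => //; exact: differentiable_coord.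
Qed.

Lemma is_derive_linear_curve (L : {linear 'rV[R]_N -> 'rV[R]_N})
    (c : R -> 'rV[R]_N) (t : R) v i :
  is_derive t 1 c v -> is_derive t 1 (fun s => L (c s) ord0 i) (L v ord0 i).
Proof.
move=> dc.
rewrite (_ : (fun s => _) =
    \sum_l L (delta_mx ord0 l) ord0 i *: (fun s => c s ord0 l)); last first.
  apply/funext => s; rewrite linear_coord_sum fct_sumE.
  by apply: eq_bigr => l _; rewrite mulrC.
rewrite (_ : L v ord0 i = \sum_l L (delta_mx ord0 l) ord0 i *: v ord0 l); last first.
  by rewrite linear_coord_sum; apply: eq_bigr => l _; rewrite mulrC.
by apply: is_derive_sum => l; apply: is_deriveZ; exact: is_derive_coord_curve.
Qed.

Lemma linear_norm_bound (L : {linear 'rV[R]_N -> 'rV[R]_N}) :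
  exists2 K, 0 <= K & forall p, `|L p| <= K * `|p|.
Proof.
exists (\sum_l `|L (delta_mx ord0 l)|); first exact: sumr_ge0.
move=> p; rewrite {1}(row_sum_delta p) linear_sum (le_trans (ler_norm_sum _ _ _))//.
rewrite mulr_suml; apply: ler_sum => l _; rewrite linearZ normrZ mulrC.
by rewrite ler_wpM2l//; exact: coord_le_norm.
Qed.

Lemma is_derive_scale_cst (f : R -> R) (t df : R) p :
  is_derive t 1 f df -> is_derive t 1 (fun s => f s *: p) (df *: p).
Proof.
move=> [dfx fd]; have dfp : differentiable f t by apply/derivable1_diffP.
have dfp' : differentiable (fun s => f s *: p) t by exact: differentiableZl.
apply: DeriveDef; first exact/derivable1_diffP.
rewrite deriveE// (_ : 'd (fun s => f s *: p) t = (fun h => 'd f t h *: p) :> (R -> 'rV[R]_N)).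
  by rewrite -deriveE// fd.
exact: diffZl.
Qed.

Lemma is_derive_scalel (t : R) p : is_derive t 1 (fun s : R => s *: p) p.
Proof.
have := @is_derive_scale_cst id t 1 p (is_derive_id _ _).
by rewrite scale1r.
Qed.

End derive_along_lemmas.

(** Only [x] is confined to the compact set, so membership of the second point never has to be
    checked. *)
Lemma compact_uniform_continuity (R : realType) (V : normedModType R)
    (K : set V) (f : V -> R) (e : R) : compact K -> continuous f -> 0 < e ->
  exists2 d, 0 < d & forall x y, K x -> `|x - y| <= d -> `|f x - f y| <= e.
Proof.
move=> /compact_near_coveringP cK cf e0.
have : \forall d \near (0:R)^'+, K `<=` (fun x => forall y, `|x - y| <= d -> `|f x - f y| <= e).
  apply: (cK R (0^'+) (fun d x => forall y, `|x - y| <= d -> `|f x - f y| <= e)) => x Kx.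
  have /cvgrPdist_le/(_ (e / 2)) := cf x; rewrite divr_gt0// => /(_ isT).
  move=> /nbhs_normP[r /= r0 fr].
  have r20 : 0 < r / 2 by rewrite divr_gt0.
  exists ([set x' | `|x - x'| < r / 2], [set d | d < r / 2]); first split => /=.
  - by apply/nbhs_normP; exists (r / 2).
  - exact: nbhs_right_lt.
  - move=> [x' d] /= [xx' dr] y x'y.
    have h1 : `|f x - f x'| <= e / 2 by apply: fr => /=; rewrite (lt_trans xx')//; lra.
    have h2 : `|f x - f y| <= e / 2.
      apply: fr => /=; rewrite -(subrKA x') (le_lt_trans (ler_normD _ _))//.
      by rewrite [ltRHS](splitr r) ltrD// (le_lt_trans x'y).
    rewrite -(subrKA (f x)) (le_trans (ler_normD _ _))// [leRHS](splitr e) lerD//.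
    by rewrite distrC.
move=> H; have [d [hd d0]] : exists d, (K `<=` (fun x => forall y, `|x - y| <= d ->
  `|f x - f y| <= e)) /\ 0 < d.
  near (0:R)^'+ => d; exists d; split; last by [].
  by near: d.
by exists d => // x y /hd; exact.
Unshelve. all: by end_near. Qed.

(** * The profile of the bump across the layer *)

Section profile.
Variables (R : realType) (ep et : R).
Hypotheses (ep0 : 0 < ep) (et0 : 0 < et).

(* As [et] goes to 0, [profile] tends to the function [ramp] cut off at 0, so
   that its derivative is nonpositive only in a thin layer near 0. *)
Definition ramp (x : R) : R := flatexp (x + ep).
Definition ramp' (x : R) : R := flatexp' (x + ep).
Definition cutoff (x : R) : R := flatexp (- (x / et)).
Definition cutoff' (x : R) : R := - (et^-1 * flatexp' (- (x / et))).
(** A second ramp, starting at [- ep / 2], inside the support of [ramp], and normalised to be at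
    least 1 from [- ep / 4] on. It dominates [ramp] in the layer, while its slope is at most
    [bramp_ratio] times [ramp]. *)
Definition bramp (x : R) : R := (flatexp (ep / 4))^-1 * flatexp (x + ep / 2).
Definition bramp' (x : R) : R := (flatexp (ep / 4))^-1 * flatexp' (x + ep / 2).
Definition bramp_ratio : R := 2 / flatexp (ep / 4) / flatexp (ep / 2).

Let A0 : 0 < (flatexp (ep / 4))^-1.
Proof. by rewrite invr_gt0 flatexp_gt0// divr_gt0. Qed.

Lemma is_derive_flatexp_shift (c x : R) :
  is_derive x 1 (fun y => flatexp (y + c)) (flatexp' (x + c)).
Proof.
have h : is_derive x 1 (@flatexp R \o (fun y : R => y + c)) (flatexp' (x + c) * 1).
  by apply: is_derive1_comp; [exact: is_derive_flatexp|exact: is_derive_shift].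
by rewrite mulr1 in h.
Qed.

Lemma is_derive_ramp (x : R) : is_derive x 1 ramp (ramp' x).
Proof. exact: is_derive_flatexp_shift. Qed.

Lemma is_derive_bramp (x : R) : is_derive x 1 bramp (bramp' x).
Proof.
have h := is_derive_flatexp_shift (ep / 2) x.
exact: (@is_deriveZ _ _ _ _ (flatexp (ep / 4))^-1 _ _ _ h).
Qed.

Lemma is_derive_cutoff (x : R) : is_derive x 1 cutoff (cutoff' x).
Proof.
have hl : is_derive x 1 (fun y : R => - (y / et)) (- et^-1).
  rewrite (_ : (fun y => _) = (- et^-1) *: (id : R -> R)); last first.
    by apply/funext => y; rewrite fctE /= /GRing.scale /= mulNr mulrC.
  rewrite -[X in is_derive _ _ _ X]mulr1; apply: is_deriveZ.
have h : is_derive x 1 (@flatexp R \o (fun y : R => - (y / et))) (flatexp' (- (x / et)) * (-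
  et^-1)).
  by apply: is_derive1_comp; exact: is_derive_flatexp.
by move: h; rewrite mulrN mulrC.
Qed.

Lemma ramp_ge0 x : 0 <= ramp x. Proof. exact: flatexp_ge0. Qed.
Lemma ramp'_ge0 x : 0 <= ramp' x. Proof. exact: flatexp'_ge0. Qed.
Lemma cutoff_ge0 x : 0 <= cutoff x. Proof. exact: flatexp_ge0. Qed.
Lemma bramp_ge0 x : 0 <= bramp x.
Proof. by rewrite mulr_ge0 ?flatexp_ge0// ltW. Qed.

Lemma cutoff'_le0 x : 0 <= - cutoff' x.
Proof. by rewrite opprK mulr_ge0 ?flatexp'_ge0// invr_ge0 ltW. Qed.

Lemma bramp_ratio_ge0 : 0 <= bramp_ratio.
Proof. by rewrite !divr_ge0 ?flatexp_ge0. Qed.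

(** Where the left side is nonzero, [x > - ep / 2], so [ramp x] is at least [flatexp (ep / 2)], and
    the slope of [flatexp] is at most 2. The ratio does not involve [et]. *)
Lemma bramp'_le x : bramp' x <= bramp_ratio * ramp x.
Proof.
rewrite /bramp' /bramp_ratio /ramp; have [x0|x0] := leP (x + ep / 2) 0.
  by rewrite flatexp'_eq0// mulr0 mulr_ge0 ?flatexp_ge0// bramp_ratio_ge0.
have b2 : 0 < flatexp (ep / 2) by rewrite flatexp_gt0// divr_gt0.
have hF : flatexp (ep / 2) <= flatexp (x + ep) by apply: flatexp_homo; lra.
apply: le_trans (_ : (flatexp (ep / 4))^-1 * 2 <= _).
  by rewrite ler_wpM2l ?(ltW A0) ?flatexp'_le2.
have -> : (flatexp (ep / 4))^-1 * 2 = 2 / flatexp (ep / 4) / flatexp (ep / 2) * flatexp (ep / 2).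
  by rewrite divfK ?gt_eqF// mulrC.
by rewrite ler_wpM2l ?bramp_ratio_ge0.
Qed.

(** [m] stands for [(psi - psi(gamma)) ^+ 2]. The term with [ramp'] has a favourable sign. The one
    with [cutoff'] is split at [- s]: closer to 0 the oscillation of [psi] is small and
    [ramp <= 1 <= bramp]; further away [- cutoff'] equals [et / x ^+ 2] times [cutoff], hence at
    most [et / s ^+ 2] times it. *)
Lemma profile_derivative_bound (m s M2 e1 e2 x : R) : 0 <= m -> 0 < s ->
  s <= ep / 4 -> m <= M2 -> (- s < x <= 0 -> m / 2 <= e2) ->
  M2 / 2 * (et / s ^+ 2) <= e1 -> 0 <= e1 -> 0 <= e2 ->
  - (m / 2 * (ramp' x * cutoff x + ramp x * cutoff' x)) <=
  e1 * (ramp x * cutoff x) + e2 * (bramp x * - cutoff' x).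
Proof.
move=> m0 s0 sep mM me2 e1M e10 e20.
have f0 := ramp_ge0 x; have f'0 := ramp'_ge0 x; have r0 := cutoff_ge0 x.
have r'0 := cutoff'_le0 x; have g0 := bramp_ge0 x.
have h1 : 0 <= m / 2 * (ramp' x * cutoff x) by rewrite !mulr_ge0// invr_ge0.
have h2 : 0 <= e1 * (ramp x * cutoff x) by rewrite !mulr_ge0.
have h3 : 0 <= e2 * (bramp x * - cutoff' x) by rewrite mulr_ge0// mulr_ge0.
suff : m / 2 * (ramp x * - cutoff' x) <= e1 * (ramp x * cutoff x) + e2 * (bramp x * - cutoff' x).
  by move: h1; lra.
have [x0|x0] := ltP 0 x.
  have -> : cutoff' x = 0.
    by rewrite /cutoff' flatexp'_eq0 ?mulr0 ?oppr0// oppr_le0 divr_ge0 ?ltW.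
  by rewrite oppr0 !mulr0 addr0.
have [sx|xs] := ltP (- s) x.
  apply: le_trans (_ : e2 * (bramp x * - cutoff' x) <= _); last by rewrite lerDr.
  apply: ler_pM => //; first by rewrite divr_ge0.
  - by rewrite mulr_ge0.
  - by apply: me2; rewrite sx.
  rewrite ler_wpM2r//; apply: (le_trans (flatexp_le1 _)).
  rewrite /bramp ler_pdivlMl ?flatexp_gt0 ?divr_gt0// mulr1.
  by apply: flatexp_homo; lra.
apply: le_trans (_ : e1 * (ramp x * cutoff x) <= _); last by rewrite lerDl.
have xn0 : x != 0 by rewrite lt_eqF// (le_lt_trans xs)// oppr_lt0.
have x2 : 0 < x ^+ 2 by rewrite exprn_even_gt0.
have etn0 : et != 0 by rewrite gt_eqF.
have -> : - cutoff' x = et / x ^+ 2 * cutoff x.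
  by rewrite /cutoff' opprK flatexp'E /cutoff; field; rewrite xn0 etn0.
have -> : m / 2 * (ramp x * (et / x ^+ 2 * cutoff x)) = m / 2 * (et / x ^+ 2) * (ramp x * cutoff x)
  by ring.
rewrite ler_wpM2r//; first by rewrite mulr_ge0.
apply: le_trans e1M.
apply: ler_pM; rewrite ?divr_ge0 ?sqr_ge0 ?(ltW et0)//.
  by rewrite ler_wpM2r// invr_ge0.
rewrite ler_wpM2l ?(ltW et0)// lef_pV2 ?posrE ?x2 ?exprn_gt0//.
by rewrite -(sqrrN x) ler_pXn2r ?nnegrE ?(ltW s0)//; lra.
Qed.

End profile.

(** * Transport by two commuting affine flows *)

Section transport.
Variables (R : realType) (N : nat) (k : 'I_N).
Local Notation V := 'rV[R]_N.
(** The properties kept from the group: [X p = e + L p] is constant along its own flow and along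
    [Y], which makes the flows affine and commuting; [X] has no component along [Y]; the zero
    diagonal of [L] makes [X] divergence free. *)
Variables (e : V) (L : {linear V -> V}).
Let Y : V := delta_mx ord0 k.
Hypotheses (LL : forall p, L (L p) = 0) (Le : L e = 0) (LY : L Y = 0).
Hypotheses (Lk : forall p, L p ord0 k = 0) (ek : e ord0 k = 0).
Hypothesis Ldiv : forall i, L (delta_mx ord0 i) ord0 i = 0.

Let X (p : V) : V := e + L p.

(* Flows back for time [t] along [X], then for time [z] along [Y] *)
Definition backflow (t z : R) (q : V) : V := q - t *: X q - z *: Y.

Let L_X p : L (X p) = 0.
Proof. by rewrite /X linearD Le LL addr0. Qed.

Let X_backflow t z q : X (backflow t z q) = X q.
Proof.
rewrite {1}/X; congr (e + _).
by rewrite /backflow !linearB !linearZ LY L_X /= !oppr0 !scaler0 !addr0.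
Qed.

Let Xk p : X p ord0 k = 0.
Proof. by rewrite /X mxE ek Lk addr0. Qed.

Let Yk : Y ord0 k = 1.
Proof. by rewrite /Y mxE !eqxx. Qed.

Let Yi i : i != k -> Y ord0 i = 0.
Proof. by move=> /negbTE ik; rewrite /Y mxE ik andbF. Qed.

Let backflow_k t z q : backflow t z q ord0 k = q ord0 k - z.
Proof.
rewrite /backflow.
have -> : (q - t *: X q - z *: Y) ord0 k = q ord0 k - t * X q ord0 k - z * Y ord0 k.
  by rewrite !mxE.
by rewrite Xk Yk mulr0 subr0 mulr1.
Qed.

Let backflowD t z q v h : L v = 0 -> backflow t z (h *: v + q) = h *: v + backflow t z q.
Proof.
move=> Lv; rewrite /backflow; have -> : X (h *: v + q) = X q.
  by rewrite /X linearD linearZ Lv /= scaler0 add0r.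
by rewrite !addrA.
Qed.

Let backflow_smooth t z i : smooth_class (fun q => backflow t z q ord0 i).
Proof.
rewrite (_ : (fun q => _) = (fun q : V => q ord0 i + (- t * L q ord0 i + (- t * e ord0 i - z * Y
  ord0 i)))).
  apply: smooth_class_add; first exact: smooth_class_coord.
  apply: smooth_class_add; last exact: smooth_class_cst.
  apply: smooth_class_mul; first exact: smooth_class_cst.
  exact: smooth_class_linear.
by apply/funext => q; rewrite /backflow /X !mxE; ring.
Qed.

Let derive_backflow (f : V -> R) t z q v : L v = 0 -> differentiable f (backflow t z q) ->
  is_derive q v (f \o backflow t z) ('D_v f (backflow t z q)).
Proof.
move=> Lv df; apply: (@is_derive_along _ _ _ f _ (backflow t z q) v).
  by move=> h /=; rewrite backflowD.
by apply/derivableP; exact: diff_derivable.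
Qed.

Lemma derive_X_sum (f : V -> R) q : differentiable f q ->
  'D_(X q) f q = \sum_i X q ord0 i * 'D_(delta_mx ord0 i) f q.
Proof. exact: derive_coord_sum. Qed.

Lemma X_coord_smooth i : smooth_class (fun p => X p ord0 i).
Proof.
rewrite (_ : (fun p => _) = (fun p : V => e ord0 i + L p ord0 i)); last first.
  by apply/funext => p; rewrite mxE.
by apply: smooth_class_add; [exact: smooth_class_cst|exact: smooth_class_linear].
Qed.

Section bounded_smooth.
Variables (f : V -> R) (M : R).
Hypotheses (sf : smooth_class f) (fM : forall p, f p != 0 -> `|p| <= M).

Lemma derive_bounded_support p v : 'D_v f p != 0 -> `|p| <= M.
Proof. exact: (derive_support (@closed_norm_le R N M) fM). Qed.

Lemma Cc_smooth : Cc f.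
Proof. by split; [exact: smooth_class_continuous|exists M]. Qed.

Lemma Cc_derive v : Cc ('D_v f).
Proof.
split; first exact/smooth_class_continuous/smooth_class_derive.
by exists M => p; exact: derive_bounded_support.
Qed.

Lemma derive_X_smooth : smooth_class (fun q => 'D_(X q) f q).
Proof.
rewrite (_ : (fun q => _) = fun q => \sum_i X q ord0 i * 'D_(delta_mx ord0 i) f q).
  apply: smooth_class_sum => i; apply: smooth_class_mul; first exact: X_coord_smooth.
  exact: smooth_class_derive.
by apply/funext => q; rewrite derive_X_sum//; exact: smooth_class_differentiable.
Qed.

Lemma Cc_derive_X : Cc (fun q => 'D_(X q) f q).
Proof.
split; first exact/smooth_class_continuous/derive_X_smooth.
by exists M => p; exact: derive_bounded_support.
Qed.

Lemma rV_integral_derive_delta i : rV_integral ('D_(delta_mx ord0 i) f) = 0.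
Proof.
apply: (rV_integral_derive (i := i) (f := f)).
- exact: Cc_smooth.
- exact: Cc_derive.
- by move=> p; apply/derivableP; exact: smooth_class_derivable.
Qed.

(** By [Ldiv] the coefficient [X q ord0 i] does not depend on the coordinate [i], so each summand is
    the partial derivative of a product with bounded support. *)
Lemma rV_integral_derive_X : rV_integral (fun q => 'D_(X q) f q) = 0.
Proof.
have H (s : seq 'I_N) : Cc (fun q => \sum_(i <- s) X q ord0 i * 'D_(delta_mx ord0 i) f q)
    /\ rV_integral (fun q => \sum_(i <- s) X q ord0 i * 'D_(delta_mx ord0 i) f q) = 0.
  elim: s => [|i s [Cs Is]].
    have -> : (fun q => \sum_(i <- [::]) X q ord0 i * 'D_(delta_mx ord0 i) f q) = cst 0.
      by apply/funext => q; rewrite big_nil.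
    have C0 : Cc (cst 0 : V -> R).
      by split; [exact: cst_continuous|exists 0 => p; rewrite eqxx].
    split => //; have := rV_integralZ 0 C0.
    rewrite [_ * rV_integral _]mul0r => h0; apply: etrans h0.
    by apply: eq_rV_integral => q; rewrite mul0r.
  have -> : (fun q => \sum_(j <- i :: s) X q ord0 j * 'D_(delta_mx ord0 j) f q) =
    (fun q => X q ord0 i * 'D_(delta_mx ord0 i) f q) \+
    (fun q => \sum_(j <- s) X q ord0 j * 'D_(delta_mx ord0 j) f q).
    by apply/funext => q; rewrite big_cons.
  have CX : Cc (fun q => X q ord0 i * 'D_(delta_mx ord0 i) f q).
    apply: CcM; last exact: Cc_derive.
    exact/smooth_class_continuous/X_coord_smooth.
  split; first exact: (CcD CX Cs).
  rewrite (rV_integralD CX Cs) Is addr0.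
  apply: (rV_integral_derive (i := i) (f := fun q => X q ord0 i * f q)) => //.
    by apply: CcM; [exact/smooth_class_continuous/X_coord_smooth|exact: Cc_smooth].
  move=> p.
  have dX : is_derive p (delta_mx ord0 i : V) (fun q => X q ord0 i) 0.
    apply: (@is_derive_along _ _ _ (cst (X p ord0 i) : V -> R) _ p (delta_mx ord0 i)) => h.
    by rewrite /X !mxE linearD linearZ /= !mxE Ldiv mulr0 add0r.
  have df : is_derive p (delta_mx ord0 i : V) f ('D_(delta_mx ord0 i) f p).
    by apply/derivableP; exact: smooth_class_derivable.
  have := is_deriveM dX df; rewrite scaler0 addr0; exact.
have [_ h0] := H (index_enum 'I_N); apply: (etrans _ h0).
apply: eq_rV_integral => q; apply: derive_X_sum; exact: smooth_class_differentiable.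
Qed.

End bounded_smooth.

Section kernel.
Variables (sg rho : R) (p0 : V).
Hypotheses (sg2 : sg * sg = 1) (rho0 : 0 < rho).

Let hat (y : R) : R := flatexp (1 + y / rho) * flatexp (1 - y / rho).

(** The factor of index [k] is 1: the direction of [Y] is left to the profile [h] of [tube], where
    [sg = -1] mirrors the bump. *)
Definition transverse (p : V) : R :=
  \prod_i (if i == k then 1 else hat (p ord0 i - p0 ord0 i)).

Definition tube (h : R -> R) (p : V) : R := h (sg * p ord0 k) * transverse p.

Let hat_ge0 y : 0 <= hat y.
Proof. by rewrite mulr_ge0 ?flatexp_ge0. Qed.

Lemma transverse_ge0 p : 0 <= transverse p.
Proof. by apply: prodr_ge0 => i _; case: ifP. Qed.

Lemma transverse_support p : transverse p != 0 ->
  forall i, i != k -> `|p ord0 i - p0 ord0 i| <= rho.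
Proof.
rewrite /transverse => /prodf_neq0 h i ik; have := h i isT; rewrite (negbTE ik).
rewrite mulf_eq0 negb_or => /andP[h1 h2].
have {}h1 : 0 < 1 + (p ord0 i - p0 ord0 i) / rho.
  by rewrite ltNge; apply: contraNN h1 => /flatexp_eq0->.
have {}h2 : 0 < 1 - (p ord0 i - p0 ord0 i) / rho.
  by rewrite ltNge; apply: contraNN h2 => /flatexp_eq0->.
have : -1 <= (p ord0 i - p0 ord0 i) / rho <= 1 by apply/andP; split; lra.
by rewrite -ler_norml normrM normfV (gtr0_norm rho0) ler_pdivrMr// mul1r.
Qed.

Lemma transverse_gt0 (p : V) :
  (forall i, i != k -> `|p ord0 i - p0 ord0 i| < rho) -> 0 < transverse p.
Proof.
move=> pp0; apply: prodr_gt0 => i _; have [//|ik] := eqVneq i k; move: (pp0 i ik).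
rewrite -[X in _ < X]mul1r -ltr_pdivrMr//.
rewrite -[X in _ / X](gtr0_norm rho0) -normfV -normrM ltr_norml => /andP[h1 h2].
by rewrite mulr_gt0// flatexp_gt0//; lra.
Qed.

Lemma transverse_smooth : smooth_class transverse.
Proof.
apply: smooth_class_prod => i; case: (i == k); first exact: smooth_class_cst.
have sa (a b : R) : smooth_class (fun p : V => a + b * p ord0 i).
  apply: smooth_class_add; first exact: smooth_class_cst.
  by apply: smooth_class_mul; [exact: smooth_class_cst|exact: smooth_class_coord].
rewrite (_ : (fun p => _) =
  (flat 1 \o (fun p : V => 1 - p0 ord0 i / rho + rho^-1 * p ord0 i)) \*
  (flat 1 \o (fun p : V => 1 + p0 ord0 i / rho + (- rho^-1) * p ord0 i))).
  by apply: smooth_class_mul; apply: smooth_class_flat; exact: sa.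
by apply/funext => p; rewrite /hat /flatexp /=; congr (flat _ _ * flat _ _); ring.
Qed.

Lemma transverse_Y t p : transverse (t *: Y + p) = transverse p.
Proof.
apply: eq_bigr => i _; case: (eqVneq i k) => // ik.
have -> : (t *: Y + p) ord0 i = t * Y ord0 i + p ord0 i by rewrite !mxE.
by rewrite Yi// mulr0 add0r.
Qed.

Let backflow_continuous t z : continuous (fun q => sg * backflow t z q ord0 k).
Proof.
apply: (@smooth_class_continuous R N (fun q => sg * backflow t z q ord0 k)).
by apply: smooth_class_mul; [exact: smooth_class_cst|exact: backflow_smooth].
Qed.

Lemma tube_continuous h t z : continuous h -> continuous (tube h \o backflow t z).
Proof.
move=> ch q; apply: (@continuousM _ _ (fun q => h (sg * backflow t z q ord0 k))
   (transverse \o backflow t z)).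
  apply: (@continuous_comp _ _ _ (fun q => sg * backflow t z q ord0 k) h).
    exact: backflow_continuous.
  exact: ch.
apply: smooth_class_continuous; apply: smooth_class_comp => //.
exact: transverse_smooth.
Qed.

(** [transverse] is constant along [Y] and the backflow commutes with translations along [Y], so
    only the profile is differentiated. *)
Lemma is_derive_tube h h' t z q : (forall x : R, is_derive x 1 h (h' x)) ->
  is_derive q Y (tube h \o backflow t z) (sg * tube h' (backflow t z q)).
Proof.
move=> dh; set p := backflow t z q.
pose f1 (x : R) := transverse p *: h (sg * x).
have d1 : is_derive (p ord0 k) 1 f1 (sg * tube h' p).
  have h0 : is_derive (p ord0 k) 1 (fun x : R => sg * x) sg.
    have : is_derive (p ord0 k) 1 (sg *: (id : R -> R)) (sg *: 1).
      by apply: is_deriveZ.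
    by rewrite /GRing.scale /= mulr1.
  have h1 : is_derive (p ord0 k) 1 (h \o (fun x : R => sg * x)) (h' (sg * p ord0 k) * sg).
    by apply: is_derive1_comp.
  have : is_derive (p ord0 k) 1 (transverse p *: (h \o (fun x : R => sg * x)))
     (transverse p *: (h' (sg * p ord0 k) * sg)) by exact: is_deriveZ.
  by rewrite [X in is_derive _ _ _ X](_ : _ = sg * tube h' p)// /tube /GRing.scale /=; ring.
apply: (is_derive_along _ d1) => x; rewrite /f1 /= backflowD// -/p /tube transverse_Y.
have -> : (x *: Y + p) ord0 k = x + p ord0 k by rewrite mxE mxE Yk mulr1.
by rewrite /GRing.scale /= mulr1 mulrC.
Qed.

(** The backflow [p] of [q] is undone by flowing forward, [q = p + t X p + z Y]. Hence [q - g] is a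
    multiple of [Y] plus [d + t L d], where [d] is transverse of norm at most [rho]. *)
Lemma backflow_dist (K t z : R) (q g : V) : (forall p, `|L p| <= K * `|p|) ->
  backflow t z g = p0 -> p0 ord0 k = 0 ->
  (forall i, i != k -> `|backflow t z q ord0 i - p0 ord0 i| <= rho) ->
  `|q - g| <= `|backflow t z q ord0 k| + rho * (1 + `|t| * K).
Proof.
move=> LK gp0 p00 qrho; set p := backflow t z q.
have pE q' : q' = backflow t z q' + t *: X (backflow t z q') + z *: Y.
  by rewrite X_backflow /backflow addrAC !subrK.
pose d := p - p0 - p ord0 k *: Y.
have dE : q - g = d + p ord0 k *: Y + t *: L d.
  have Ld : L d = L p - L p0 by rewrite /d [L _]linearB [L (p - p0)]linearB [L (_ *: _)]linearZ LY
    /= scaler0 subr0.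
  rewrite Ld (pE q) (pE g) gp0 -/p /X; apply/rowP => i; rewrite !mxE; ring.
have drho : `|d| <= rho.
  apply/row_norm_leP; first exact: ltW.
  move=> i; have -> : d ord0 i = p ord0 i - p0 ord0 i - p ord0 k * Y ord0 i by rewrite /d !mxE.
  have [->|ik] := eqVneq i k; first by rewrite Yk p00 subr0 mulr1 subrr normr0 ltW.
  by rewrite Yi// mulr0 subr0 qrho.
have Y1 : `|Y| <= 1.
  apply/row_norm_leP => // i; have [->|ik] := eqVneq i k; first by rewrite Yk normr1.
  by rewrite Yi// normr0.
rewrite dE (le_trans (ler_normD _ _))// (le_trans (lerD (ler_normD _ _) (lexx _)))//.
have K0 : 0 <= K.
  have := le_trans (normr_ge0 _) (LK Y).
  have Y0 : 0 < `|Y| by rewrite normr_gt0; apply/eqP => Y0; have := Yk; rewrite Y0 mxE => /eqP;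
    rewrite eq_sym oner_eq0.
  by rewrite pmulr_lge0.
have h1 : `|p ord0 k *: Y| <= `|p ord0 k| by rewrite normrZ ler_piMr.
have h2 : `|t *: L d| <= `|t| * (K * rho).
  by rewrite normrZ ler_wpM2l// (le_trans (LK _))// ler_wpM2l.
have : `|t| * (K * rho) = rho * (`|t| * K) by ring.
by move: h1 h2 drho; lra.
Qed.

End kernel.

(** * The bump carried along an integral curve *)

Section moving_tube.
Variables (psi omega : V -> R) (a0 : V) (R0 : R) (gamma : R -> V) (u v c sg : R).
Variables (p0 : V) (K T Mpsi : R).
Hypotheses (cpsi : continuous psi) (comega : continuous omega).
Hypothesis weak : forall xi, smooth_class xi ->
  (forall p, xi p != 0 -> `|p - a0| <= R0) ->
  rV_integral (fun p => - psi p * 'D_(X p) xi p + psi p ^+ 2 / 2 * 'D_Y xi p) =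
  rV_integral (fun p => omega p * xi p).
Hypothesis dgamma : forall t : R, u < t < v ->
  is_derive t 1 gamma (X (gamma t) - psi (gamma t) *: Y).
(** In coordinates moving with the two flows the curve stands still, so the moving bump is one fixed
    function, attached to [p0], composed with the backflow. *)
Hypothesis gamma_p0 : forall t, u < t < v ->
  backflow t (gamma t ord0 k) (gamma t) = p0.
Hypotheses (p00 : p0 ord0 k = 0) (sg2 : sg * sg = 1).
Hypothesis omega_c : forall p, `|p - a0| <= R0 -> sg * omega p <= c.
Hypotheses (K0 : 0 <= K) (LK : forall p, `|L p| <= K * `|p|).
Hypothesis timeT : forall t, u < t < v -> `|t| <= T.
Hypothesis psi_gamma : forall t, u < t < v -> `|psi (gamma t)| <= Mpsi.

(** [ep] is the length of the bump along [Y], [rho] its transverse radius, [et] the scale of the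
    cutoff, [s] the depth up to which the sharper oscillation bound [de2] holds; [d] bounds the
    transverse spread of the moved bump. *)
Variables (ep et rho s d de de2 : R).
Hypotheses (ep0 : 0 < ep) (et0 : 0 < et) (rho0 : 0 < rho) (s0 : 0 < s).
Hypotheses (sep : s <= ep / 4) (de0 : 0 <= de) (de20 : 0 <= de2).
Hypothesis rhod : rho * (1 + T * K) <= d.
Hypothesis gamma_near : forall t q, u < t < v ->
  `|q - gamma t| <= ep + d -> `|q - a0| <= R0.
Hypothesis osc_e : forall t q, u < t < v ->
  `|q - gamma t| <= ep + d -> `|psi q - psi (gamma t)| <= de.
Hypothesis osc_s : forall t q, u < t < v ->
  `|q - gamma t| <= s + d -> (psi q - psi (gamma t)) ^+ 2 / 2 <= de2.
Hypotheses (small_et : de ^+ 2 / 2 * (et / s ^+ 2) <= de).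
Hypothesis small_e2 : de2 * bramp_ratio ep <= de.

Let tb := tube sg rho p0.
Let flow t := backflow t (gamma t ord0 k).
Let fr x := ramp ep x * cutoff et x.
Let fr' x := ramp' ep x * cutoff et x + ramp ep x * cutoff' et x.
(** The comparison profile; [gr1] and [gr2] are the two terms of its derivative, exchanged for each
    other in [gr_balance]. *)
Let gr x := bramp ep x * cutoff et x.
Let gr1 x := bramp' ep x * cutoff et x.
Let gr2 x := bramp ep x * cutoff' et x.
Let xi := tb fr.
Let xit t := xi \o flow t.

Let tube_near h t q : u < t < v -> (forall x, h x != 0 -> - ep <= x <= 0) ->
  tb h (flow t q) != 0 ->
  `|q - gamma t| <= `|flow t q ord0 k| + d /\ `|flow t q ord0 k| <= ep.
Proof.
move=> tuv hs; rewrite /tb /tube mulf_eq0 negb_or => /andP[/hs hk tr].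
have kE : `|flow t q ord0 k| = `|sg * flow t q ord0 k|.
  have sg1 : `|sg| = 1.
    by apply/eqP; rewrite -sqr_norm_eq1 expr2 sg2.
  by rewrite normrM sg1 mul1r.
split; last by rewrite kE ler_norml; move: hk ep0; lra.
have := backflow_dist rho0 LK (gamma_p0 tuv) p00 (transverse_support rho0 tr).
move=> /le_trans; apply; rewrite lerD2l; apply: le_trans rhod.
by rewrite ler_wpM2l ?(ltW rho0)// lerD2l ler_wpM2r// timeT.
Qed.

Let tube_near_ep h t q : u < t < v -> (forall x, h x != 0 -> - ep <= x <= 0) ->
  tb h (flow t q) != 0 -> `|q - gamma t| <= ep + d.
Proof.
by move=> tuv hs /(tube_near tuv hs)[/le_trans h1 h2]; apply: h1; rewrite lerD2r.
Qed.

Let cont1 (h h' : R -> R) : (forall x : R, is_derive x 1 h (h' x)) -> continuous h.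
Proof. by move=> dh x; apply/differentiable_continuous/derivable1_diffP; have [] := dh x. Qed.

Let tube_Cc h t : u < t < v -> continuous h ->
  (forall x, h x != 0 -> - ep <= x <= 0) -> Cc (tb h \o flow t).
Proof.
move=> tuv ch hs; split; first exact: tube_continuous.
exists (`|a0| + R0) => q /(tube_near_ep tuv hs) /(gamma_near tuv) qa.
by rewrite -(subrK a0 q) addrC (le_trans (ler_normD _ _))// lerD2l.
Qed.

Let cont_flatexp' (a b : R) : continuous (fun x : R => flatexp' (a * x + b)).
Proof.
move=> x; apply: (@continuous_comp _ _ _ (fun x : R => a * x + b) (@flatexp' R)).
  by apply: continuousD; [exact: mulrl_continuous|exact: cst_continuous].
by apply: cont1 => y; exact: is_derive_flat.
Qed.

Let c_ramp : continuous (ramp ep). Proof. exact/cont1/is_derive_ramp. Qed.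
Let c_bramp : continuous (bramp ep). Proof. exact/cont1/is_derive_bramp. Qed.
Let c_cutoff : continuous (cutoff et). Proof. exact/cont1/is_derive_cutoff. Qed.

Let c_ramp' : continuous (ramp' ep).
Proof.
have -> : ramp' ep = fun x => flatexp' (1 * x + ep) by apply/funext => x; rewrite mul1r.
exact: cont_flatexp'.
Qed.

Let c_bramp' : continuous (bramp' ep).
Proof.
move=> x; apply: (@continuousM _ _ (cst (flatexp (ep / 4))^-1)
  (fun x : R => flatexp' (x + ep / 2))); first exact: cst_continuous.
have -> : (fun x : R => flatexp' (x + ep / 2)) = fun x => flatexp' (1 * x + ep / 2).
  by apply/funext => y; rewrite mul1r.
exact: cont_flatexp'.
Qed.

Let c_cutoff' : continuous (cutoff' et).
Proof.
have -> : cutoff' et = fun x => - et^-1 * flatexp' (- (x / et)).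
  by apply/funext => x; rewrite mulNr.
move=> x; apply: (@continuousM _ _ (cst (- et^-1)) (fun x : R => flatexp' (- (x / et))));
  first exact: cst_continuous.
have -> : (fun x : R => flatexp' (- (x / et))) = fun x => flatexp' (- et^-1 * x + 0).
  by apply/funext => y; rewrite addr0 mulNr mulrC.
exact: cont_flatexp'.
Qed.

Let ramp_supp x : ramp ep x != 0 \/ ramp' ep x != 0 \/ bramp ep x != 0 \/ bramp' ep x != 0 ->
  - ep <= x.
Proof.
move=> h; rewrite leNgt; apply/negP => xep; move: h.
have x1 : x + ep <= 0 by lra.
have x2 : x + ep / 2 <= 0 by move: ep0 xep; lra.
rewrite /ramp /ramp' /bramp /bramp' (flatexp_eq0 x1) (flatexp'_eq0 x1).
by rewrite (flatexp_eq0 x2) (flatexp'_eq0 x2) mulr0 eqxx; intuition.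
Qed.

Let cutoff_supp x : cutoff et x != 0 \/ cutoff' et x != 0 -> x <= 0.
Proof.
move=> h; rewrite leNgt; apply/negP => x0; move: h.
have x1 : - (x / et) <= 0 by rewrite oppr_le0 divr_ge0// ltW.
rewrite /cutoff /cutoff' (flatexp_eq0 x1) (flatexp'_eq0 x1).
by rewrite mulr0 oppr0 eqxx; intuition.
Qed.

Let supp_prod (f g : R -> R) :
  (forall x, f x != 0 -> - ep <= x) -> (forall x, g x != 0 -> x <= 0) ->
  forall x, f x * g x != 0 -> - ep <= x <= 0.
Proof.
by move=> hf hg x; rewrite mulf_eq0 negb_or => /andP[/hf-> /hg->].
Qed.

Let fr_supp x : fr x != 0 -> - ep <= x <= 0.
Proof. by apply: supp_prod => {}x h; [apply: ramp_supp|apply: cutoff_supp]; tauto. Qed.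
Let gr_supp x : gr x != 0 -> - ep <= x <= 0.
Proof. by apply: supp_prod => {}x h; [apply: ramp_supp|apply: cutoff_supp]; tauto. Qed.
Let gr1_supp x : gr1 x != 0 -> - ep <= x <= 0.
Proof. by apply: supp_prod => {}x h; [apply: ramp_supp|apply: cutoff_supp]; tauto. Qed.
Let gr2_supp x : gr2 x != 0 -> - ep <= x <= 0.
Proof. by apply: supp_prod => {}x h; [apply: ramp_supp|apply: cutoff_supp]; tauto. Qed.
Let fr'_supp x : fr' x != 0 -> - ep <= x <= 0.
Proof.
rewrite /fr'; have [->|h _] := eqVneq (ramp' ep x * cutoff et x) 0.
  rewrite add0r => h; apply: (supp_prod _ _ h) => {}x {}h; [apply: ramp_supp|apply: cutoff_supp];
    tauto.
by apply: (supp_prod _ _ h) => {}x {}h; [apply: ramp_supp|apply: cutoff_supp]; tauto.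
Qed.

Let cM (f g : R -> R) : continuous f -> continuous g -> continuous (fun x => f x * g x).
Proof. by move=> cf cg x; apply: continuousM; [exact: cf|exact: cg]. Qed.

Let d_mul (f f' g g' : R -> R) : (forall x : R, is_derive x 1 f (f' x)) ->
  (forall x : R, is_derive x 1 g (g' x)) ->
  forall x : R, is_derive x 1 (fun x => f x * g x) (f' x * g x + f x * g' x).
Proof.
move=> df dg x; have := is_deriveM (df x) (dg x).
by rewrite [X in is_derive _ _ _ X](_ : _ = f' x * g x + f x * g' x)// /GRing.scale /=; ring.
Qed.

Let d_fr (x : R) : is_derive x 1 fr (fr' x).
Proof. by apply: d_mul => y; [exact: is_derive_ramp|exact: is_derive_cutoff]. Qed.

Let d_gr (x : R) : is_derive x 1 gr ((fun x => gr1 x + gr2 x) x).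
Proof. by apply: d_mul => y; [exact: is_derive_bramp|exact: is_derive_cutoff]. Qed.

Let xi_smooth : smooth_class xi.
Proof.
have sa (a b : R) : smooth_class (fun p : V => a + b * p ord0 k).
  apply: smooth_class_add; first exact: smooth_class_cst.
  by apply: smooth_class_mul; [exact: smooth_class_cst|exact: smooth_class_coord].
rewrite (_ : xi = ((flat 1 \o (fun p : V => ep + sg * p ord0 k)) \*
   (flat 1 \o (fun p : V => 0 + (- (sg / et)) * p ord0 k))) \* transverse rho p0).
  by apply: smooth_class_mul; [apply: smooth_class_mul; apply: smooth_class_flat; exact: sa|
    exact: transverse_smooth].
apply/funext => p; rewrite /xi /tb /tube /fr /ramp /cutoff /flatexp /=.
by congr (flat _ _ * flat _ _ * _); ring.
Qed.

Let xit_smooth t : smooth_class (xit t).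
Proof. by apply: smooth_class_comp; [move=> i; exact: backflow_smooth|exact: xi_smooth]. Qed.

Let xit_supp t q : u < t < v -> xit t q != 0 -> `|q - gamma t| <= ep + d.
Proof. by move=> tuv; apply: tube_near_ep => //; exact: fr_supp. Qed.

Let xit_suppM t q : u < t < v -> xit t q != 0 -> `|q| <= `|a0| + R0.
Proof.
move=> tuv /(xit_supp tuv)/(gamma_near tuv) qa.
by rewrite -(subrK a0 q) addrC (le_trans (ler_normD _ _))// lerD2l.
Qed.

Let derive_xit_Y t q : 'D_Y (xit t) q = sg * tb fr' (flow t q).
Proof. by have [_ ->] := is_derive_tube sg rho p0 t (gamma t ord0 k) q d_fr. Qed.

Let DX t q := 'D_(X q) (xit t) q.
Let DY t q := 'D_Y (xit t) q.

Let Cxit t : u < t < v -> Cc (xit t).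
Proof. by move=> tuv; apply: (@Cc_smooth _ (`|a0| + R0)) => // q; exact: xit_suppM. Qed.
Let CDX t : u < t < v -> Cc (DX t).
Proof. by move=> tuv; apply: (@Cc_derive_X _ (`|a0| + R0)) => // q; exact: xit_suppM. Qed.
Let CDY t : u < t < v -> Cc (DY t).
Proof. by move=> tuv; apply: (@Cc_derive _ (`|a0| + R0)) => // q; exact: xit_suppM. Qed.

Let DX0 t : u < t < v -> rV_integral (DX t) = 0.
Proof.
by move=> tuv; apply: (@rV_integral_derive_X _ (`|a0| + R0)) => // q; exact: xit_suppM.
Qed.
Let DY0 t : u < t < v -> rV_integral (DY t) = 0.
Proof.
by move=> tuv; apply: (@rV_integral_derive_delta _ (`|a0| + R0)) => // q; exact: xit_suppM.
Qed.

Let dxit t q := - DX t q + psi (gamma t) * DY t q.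

(** The derivatives along [X] and [Y] commute with the backflow, so [dxit] is expressed by
    derivatives of the fixed function [xi]; this gives bounds uniform in time. *)
Let dxitE t q : dxit t q = 'D_(- X (flow t q) + psi (gamma t) *: Y) xi (flow t q).
Proof.
have dx : differentiable xi (flow t q) by exact: smooth_class_differentiable.
have hX : DX t q = 'D_(X (flow t q)) xi (flow t q).
  by rewrite {2}/flow X_backflow; have [_ h] := derive_backflow (L_X q) dx; exact: h.
have hY : DY t q = 'D_Y xi (flow t q).
  by have [_ h] := derive_backflow LY dx; exact: h.
have -> : - X (flow t q) + psi (gamma t) *: Y = -1 *: X (flow t q) + psi (gamma t) *: Y.
  by rewrite scaleN1r.
rewrite (deriveDl _ _ _ _ dx) mulN1r.
rewrite /dxit.
rewrite hX.
rewrite hY.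
by [].
Qed.

(** The shift along [Y] follows the coordinate [k] of the curve, whose speed is [- psi (gamma t)]
    because [X] has no such component. *)
Let flow_derive (t : R) q : u < t < v ->
  is_derive t 1 (fun t => flow t q) (- X (flow t q) + psi (gamma t) *: Y).
Proof.
move=> tuv; rewrite /flow X_backflow /backflow.
have h1 : is_derive t 1 (fun s : R => s *: X q) (X q).
  exact: is_derive_scalel.
have h2 : is_derive t 1 (fun s : R => gamma s ord0 k *: Y) (- psi (gamma t) *: Y).
  apply: is_derive_scale_cst; have := is_derive_coord_curve k (dgamma tuv).
  have -> // : (X (gamma t) - psi (gamma t) *: Y) ord0 k = - psi (gamma t).
  have -> : (X (gamma t) - psi (gamma t) *: Y) ord0 k = X (gamma t) ord0 k - psi (gamma t) * Y ord0
    k.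
    by rewrite !mxE.
  by rewrite Xk Yk mulr1 sub0r.
have h3 : is_derive t 1 (cst q : R -> V) 0 by exact: is_derive_cst.
have := is_deriveB (is_deriveB h3 h1) h2.
by rewrite sub0r scaleNr opprK.
Qed.

Let xit_derive (t : R) q : u < t < v -> is_derive t 1 (xit ^~ q) (dxit t q).
Proof.
move=> tuv; rewrite dxitE.
apply: (is_derive_curve (f := xi) (c := fun t => flow t q)); last exact: flow_derive.
exact: smooth_class_differentiable.
Qed.

Let xi_bounded_supp p : xi p != 0 -> `|p| <= `|p0| + (ep + rho).
Proof.
rewrite /xi /tb /tube mulf_eq0 negb_or => /andP[/fr_supp hk /(transverse_support rho0) tr].
rewrite -(subrK p0 p) addrC (le_trans (ler_normD _ _))// lerD2l.
apply/row_norm_leP; first by rewrite addr_ge0// ltW.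
move=> i; have -> : (p - p0) ord0 i = p ord0 i - p0 ord0 i by rewrite !mxE.
have [->|/tr h] := eqVneq i k; last by rewrite (le_trans h)// lerDr ltW.
rewrite p00 subr0.
have sg1 : `|sg| = 1 by apply/eqP; rewrite -sqr_norm_eq1 expr2 sg2.
rewrite -[`|_|]mul1r -sg1 -normrM (@le_trans _ _ ep)//; last by rewrite lerDl ltW.
by rewrite ler_norml; move: hk ep0; lra.
Qed.

Let dxit_bounded : exists C, forall t q, u < t < v -> `|dxit t q| <= C.
Proof.
have [C1 h1] := Cc_bounded (Cc_derive_X xi_smooth xi_bounded_supp).
have [C2 h2] := Cc_bounded (Cc_derive xi_smooth xi_bounded_supp Y).
exists (C1 + Mpsi * C2) => t q tuv; rewrite dxitE.
have dx : differentiable xi (flow t q) by exact: smooth_class_differentiable.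
have -> : - X (flow t q) + psi (gamma t) *: Y = -1 *: X (flow t q) + psi (gamma t) *: Y.
  by rewrite scaleN1r.
rewrite (deriveDl _ _ _ _ dx) mulN1r; apply: (le_trans (ler_normD _ _)).
rewrite normrN; apply: lerD; first exact: h1.
by rewrite normrM; apply: ler_pM => //; exact: psi_gamma.
Qed.

Let dxit_supp t q : u < t < v -> dxit t q != 0 -> `|q| <= `|a0| + R0.
Proof.
move=> tuv h; have [h0|h0] := eqVneq (DX t q) 0; last first.
  by apply: (derive_bounded_support _ h0) => p; exact: xit_suppM.
have : DY t q != 0.
  by apply: contraNneq h => hY; rewrite /dxit h0 hY mulr0 oppr0 addr0.
by apply: derive_bounded_support => p; exact: xit_suppM.
Qed.

Let continuous_dxit t : continuous (dxit t).
Proof.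
apply: smooth_class_continuous; apply: smooth_class_add.
  have -> : (fun q => - DX t q) = (fun q => -1 * DX t q) by apply/funext => q; rewrite mulN1r.
  by apply: smooth_class_mul; [exact: smooth_class_cst|exact: derive_X_smooth].
by apply: smooth_class_mul; [exact: smooth_class_cst|exact: smooth_class_derive].
Qed.

Let integral_xit_derive (phi : V -> R) (t : R) : u < t < v -> continuous phi ->
  is_derive t 1 (fun t => rV_integral (phi \* xit t)) (rV_integral (phi \* dxit t)).
Proof.
move=> tuv cphi; have [C hC] := dxit_bounded.
apply: (is_derive_moving_integral tuv cphi (M := `|a0| + R0) (K := C)) => //.
- by move=> x; apply: smooth_class_continuous.
Qed.

Let J t := rV_integral (xit t).

Let J_cst t1 t2 : u < t1 < v -> u < t2 < v -> J t2 = J t1.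
Proof.
have JE x : J x = rV_integral (cst 1 \* xit x).
  by apply: eq_rV_integral => q /=; rewrite mul1r.
rewrite !JE; apply: (derive0_constant (f := fun t => rV_integral (cst 1 \* xit t))) => x xuv.
have := integral_xit_derive xuv (@cst_continuous _ _ (1 : R)).
rewrite [X in is_derive _ _ _ X](_ : _ = 0)//.
exact: (rV_integral_transport0 _ (CDX xuv) (CDY xuv) (DX0 xuv) (DY0 xuv)).
Qed.

Let fr_ge0 x : 0 <= fr x. Proof. by rewrite mulr_ge0 ?ramp_ge0 ?cutoff_ge0. Qed.

Let tube_ge0 h q : (forall x, 0 <= h x) -> 0 <= tb h q.
Proof. by move=> h0; rewrite mulr_ge0 ?transverse_ge0. Qed.

Let xit_ge0 t q : 0 <= xit t q.
Proof. exact: tube_ge0. Qed.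

Let c_gr1 : continuous gr1. Proof. exact: cM. Qed.
Let c_gr2 : continuous gr2. Proof. exact: cM. Qed.
Let c_gr : continuous gr. Proof. exact: cM. Qed.

Let Cgr1 t : u < t < v -> Cc (tb gr1 \o flow t).
Proof. by move=> tuv; apply: tube_Cc => // x; exact: gr1_supp. Qed.
Let Cgr2 t : u < t < v -> Cc (tb gr2 \o flow t).
Proof. by move=> tuv; apply: tube_Cc => // x; exact: gr2_supp. Qed.

Let tubeD h1 h2 q : tb (fun x => h1 x + h2 x) q = tb h1 q + tb h2 q.
Proof. by rewrite /tb /tube mulrDl. Qed.

(** The integral of a derivative along [Y] vanishes; multiplying by [sg] removes the sign of a
    mirrored bump. This trades [cutoff'], which steepens as [et] decreases, for the slope of
    [bramp]. *)
Let gr_balance t : u < t < v ->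
  rV_integral (fun q => -1 * tb gr2 (flow t q)) = rV_integral (tb gr1 \o flow t).
Proof.
move=> tuv.
have I0 : rV_integral (fun q => sg * (tb gr1 \o flow t) q + sg * (tb gr2 \o flow t) q) = 0.
  apply: (rV_integral_derive (i := k) (f := tb gr \o flow t)).
  - by apply: tube_Cc => // x; exact: gr_supp.
  - by apply: CcD; apply: CcZ; [exact: Cgr1|exact: Cgr2].
  - move=> q; have := is_derive_tube sg rho p0 t (gamma t ord0 k) q d_gr.
    by rewrite -/tb -/(flow t q) tubeD mulrDr.
move: I0; rewrite (rV_integral_comb _ _ (Cgr1 tuv) (Cgr2 tuv)) -mulrDr.
move/(congr1 (fun x => sg * x)) => /=; rewrite (mulrA sg sg) sg2 mul1r mulr0 => /eqP.
rewrite addr_eq0 => /eqP ->.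
by rewrite (rV_integralZ _ (Cgr2 tuv)) mulN1r.
Qed.

Let pointwise t q : u < t < v ->
  sg * (omega q * xit t q) - (psi q - psi (gamma t)) ^+ 2 / 2 * (sg * DY t q) <=
  (c + de) * xit t q + de2 * (-1 * tb gr2 (flow t q)).
Proof.
move=> tuv; rewrite /DY derive_xit_Y (mulrA sg sg) sg2 mul1r.
have h1 : sg * (omega q * xit t q) <= c * xit t q.
  have [->|xq] := eqVneq (xit t q) 0; first by rewrite !mulr0.
  rewrite mulrA ler_wpM2r ?xit_ge0//; apply: omega_c.
  exact: (gamma_near tuv (xit_supp tuv xq)).
rewrite mulrDl -addrA lerD//.
have w0 := transverse_ge0 rho p0 (flow t q).
rewrite /xit /xi /= /tb /tube.
set w := transverse _ _ _ in w0 *; set x := sg * _.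
have -> : - ((psi q - psi (gamma t)) ^+ 2 / 2 * (fr' x * w)) =
   - ((psi q - psi (gamma t)) ^+ 2 / 2 * (ramp' ep x * cutoff et x + ramp ep x * cutoff' et x)) * w.
  by rewrite /fr'; ring.
have -> : de * (fr x * w) + de2 * (-1 * (gr2 x * w)) =
   (de * (ramp ep x * cutoff et x) + de2 * (bramp ep x * - cutoff' et x)) * w.
  by rewrite /fr /gr2; ring.
(* The oscillation bounds hold only near the curve, which is ensured when both the weight and [fr']
   are nonzero. If the weight is 0 both sides vanish; if [fr'] is 0 the right side is
   nonnegative. *)
have [w00|wn0] := eqVneq w 0; first by rewrite w00 !mulr0.
rewrite ler_wpM2r//.
have RHS0 : 0 <= de * (ramp ep x * cutoff et x) + de2 * (bramp ep x * - cutoff' et x).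
  apply: addr_ge0; apply: mulr_ge0 => //; apply: mulr_ge0.
  - exact: ramp_ge0.
  - exact: cutoff_ge0.
  - exact: bramp_ge0.
  - exact: cutoff'_le0.
have [f0|fn0] := eqVneq (fr' x) 0; first by rewrite -/(fr' x) f0 mulr0 oppr0.
have tn0 : tb fr' (flow t q) != 0 by rewrite /tb /tube mulf_neq0.
have [qg kep] := tube_near tuv fr'_supp tn0.
have qed : `|q - gamma t| <= ep + d by rewrite (le_trans qg)// lerD2r.
have kE : `|flow t q ord0 k| = `|x|.
  have sg1 : `|sg| = 1 by apply/eqP; rewrite -sqr_norm_eq1 expr2 sg2.
  by rewrite /x normrM sg1 mul1r.
apply: (profile_derivative_bound ep0 et0 (s := s) (M2 := de ^+ 2)) => //.
- exact: sqr_ge0.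
- by rewrite -[leLHS]real_normK ?num_real// ler_pXn2r ?nnegrE//; exact: osc_e.
- move=> /andP[sx x0]; apply: osc_s => //; rewrite (le_trans qg)// lerD2r kE.
  by rewrite ler_norml; apply/andP; split; [exact: ltW|rewrite (le_trans x0)// ltW].
Qed.

Let energy t : u < t < v ->
  sg * rV_integral (psi \* dxit t) <= (c + 2 * de) * J t.
Proof.
move=> tuv.
apply: (energy_estimate cpsi comega (CDX tuv) (CDY tuv) (Cxit tuv)
  (B1 := fun q => -1 * tb gr2 (flow t q)) (B2 := tb gr1 \o flow t) (e2 := de2)
  (ratio := bramp_ratio ep) _ (Cgr1 tuv) _ (DY0 tuv) (gr_balance tuv)) => //.
- exact: (CcZ _ (Cgr2 tuv)).
- apply: weak; first exact: xit_smooth.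
  by move=> q xq; exact: (gamma_near tuv (xit_supp tuv xq)).
- by move=> q; exact: pointwise.
- move=> q; rewrite /xit /xi /= /tb /tube mulrA ler_wpM2r ?transverse_ge0//.
  by rewrite /gr1 /fr mulrA ler_wpM2r ?cutoff_ge0//; exact: bramp'_le.
Qed.

(** [q0] sits at the middle [- ep / 2] of the support of the profile; the margins [ep / 4] and
    [rho / 2] keep the profile and the transverse factor positive, and [1 + |t| K] is a Lipschitz
    constant of the backflow. *)
Let J_gt0 t : u < t < v -> 0 < J t.
Proof.
move=> tuv; pose q0 := gamma t - (sg * (ep / 2)) *: Y.
have TK : 0 < 1 + `|t| * K by rewrite ltr_pwDl// mulr_ge0.
pose m := Num.min (ep / 4) (rho / 2).
have m0 : 0 < m by rewrite lt_min !divr_gt0.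
apply: (@rV_integral_gt0 _ _ _ q0 (m / (1 + `|t| * K))).
- by rewrite divr_gt0.
- exact: Cxit.
- by move=> q; exact: xit_ge0.
move=> q qq0.
have fE : flow t q - (p0 - (sg * (ep / 2)) *: Y) = (q - q0) - t *: L (q - q0).
  have -> : p0 - (sg * (ep / 2)) *: Y = flow t q0.
    have -> : q0 = - (sg * (ep / 2)) *: Y + gamma t by rewrite /q0 scaleNr addrC.
    by rewrite /flow backflowD ?LY// (gamma_p0 tuv) scaleNr addrC.
  have -> : L (q - q0) = L q - L q0 by exact: linearB.
  rewrite /flow /backflow /X; move: (L q) (L q0) => lq lq0.
  set z := gamma t ord0 k; clearbody z; clear qq0; clearbody q0.
  by apply/rowP => i; rewrite !mxE; ring.
have fm : `|flow t q - (p0 - (sg * (ep / 2)) *: Y)| <= m.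
  rewrite fE (le_trans (ler_normB _ _))// normrZ.
  have h : `|t| * `|L (q - q0)| <= `|t| * (K * `|q - q0|) by rewrite ler_wpM2l.
  apply: (le_trans (lerD (lexx _) h)); move: qq0; rewrite ler_pdivlMr//.
  by apply: le_trans; rewrite mulrDr mulr1 lerD2l mulrA mulrC.
have fi i : `|flow t q ord0 i - (p0 ord0 i - sg * (ep / 2) * Y ord0 i)| <= m.
  have := le_trans (coord_le_norm _ i) fm.
  by have -> : (flow t q - (p0 - (sg * (ep / 2)) *: Y)) ord0 i =
     flow t q ord0 i - (p0 ord0 i - sg * (ep / 2) * Y ord0 i) by rewrite !mxE.
have mep : m <= ep / 4 by rewrite ge_min lexx.
have mrho : m <= rho / 2 by rewrite ge_min lexx orbT.
rewrite /xit /xi /= /tb /tube; apply: mulr_gt0; last first.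
  apply: transverse_gt0 => // i ik; have := fi i; rewrite Yi// mulr0 subr0.
  by move=> /le_lt_trans; apply; rewrite (le_lt_trans mrho)//; lra.
have xE : `|sg * flow t q ord0 k + ep / 2| <= m.
  have sg1 : `|sg| = 1 by apply/eqP; rewrite -sqr_norm_eq1 expr2 sg2.
  have := fi k; rewrite Yk mulr1 p00 sub0r opprK -[`|_|]mul1r -{1}sg1 -normrM mulrDr.
  by rewrite (mulrA sg sg) sg2 mul1r.
move: xE; rewrite ler_norml => /andP[xE1 xE2].
apply: mulr_gt0; apply: flatexp_gt0; first by move: xE1 mep ep0; lra.
rewrite oppr_gt0 pmulr_llt0 ?invr_gt0//; move: xE2 mep ep0; lra.
Qed.

(** The weighted integral of [psi] grows at rate at most [c + 2 * de] times the constant mass; the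
    last [2 * de] pays for replacing averages by values on the curve at the two times. *)
Lemma tube_transport t1 t2 : u < t1 -> t1 <= t2 -> t2 < v ->
  sg * (psi (gamma t2) - psi (gamma t1)) <= (c + 2 * de) * (t2 - t1) + 2 * de.
Proof.
move=> ut1 t12 t2v.
have t1uv : u < t1 < v by rewrite ut1 (le_lt_trans t12).
have t2uv : u < t2 < v by rewrite t2v (lt_le_trans ut1).
pose H t := sg *: rV_integral (psi \* xit t).
have dH (t : R) : u < t < v -> is_derive t 1 (fun t => sg *: rV_integral (psi \* xit t))
   (sg *: rV_integral (psi \* dxit t)).
  by move=> tuv; apply: is_deriveZ; exact: integral_xit_derive.
have := derive_le_increment dH (C := (c + 2 * de) * J t1) _ ut1 t12 t2v.
rewrite -mulrBr.
have J0 := J_gt0 t1uv.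
have osc t : u < t < v -> `|rV_integral (psi \* xit t) - psi (gamma t) * J t1| <= de * J t1.
  move=> tuv; have := integral_average_le cpsi (Cxit tuv) (xit_ge0 t)
    (fun q hq => osc_e tuv (xit_supp tuv hq)).
  by rewrite -/(J t) (J_cst t1uv tuv).
have o1 := osc _ t1uv; have o2 := osc _ t2uv.
move=> Hinc; have {}Hinc : sg * (rV_integral (psi \* xit t2) - rV_integral (psi \* xit t1)) <=
    (c + 2 * de) * J t1 * (t2 - t1).
  by apply: Hinc => t tuv; rewrite -(J_cst t1uv tuv); exact: energy.
exact: (increment_of_averages sg2 J0 o1 o2 Hinc).
Qed.

End moving_tube.

(** * Choice of the parameters and passage to the limit *)

Section transport_inequality.
Variables (psi omega : V -> R) (a0 : V) (R0 R1 : R) (gamma : R -> V) (u v c sg : R).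
Hypotheses (cpsi : continuous psi) (comega : continuous omega) (R10 : R1 < R0).
Hypothesis weak : forall xi, smooth_class xi ->
  (forall p, xi p != 0 -> `|p - a0| <= R0) ->
  rV_integral (fun p => - psi p * 'D_(X p) xi p + psi p ^+ 2 / 2 * 'D_Y xi p) =
  rV_integral (fun p => omega p * xi p).
Hypothesis dgamma : forall t : R, u < t < v ->
  is_derive t 1 gamma (X (gamma t) - psi (gamma t) *: Y).
Hypothesis gamma_near : forall t, u < t < v -> `|gamma t - a0| <= R1.
Hypothesis sg2 : sg * sg = 1.
Hypothesis omega_c : forall p, `|p - a0| <= R0 -> sg * omega p <= c.

(** [L] kills [X] and [Y], so [L (gamma t)] is constant, and [X (gamma t)] with it; the derivative
    of the backflow of the curve is then [X - psi Y - X + psi Y]. *)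
Let backflow_gamma : u < v -> exists2 p0 : V, p0 ord0 k = 0 &
  forall t, u < t < v -> backflow t (gamma t ord0 k) (gamma t) = p0.
Proof.
move=> uv; pose m := (u + v) / 2.
have muv : u < m < v by rewrite /m; apply/andP; split; lra.
have LD p a : L (X p - a *: Y) = 0.
  have -> : L (X p - a *: Y) = L (X p) - a *: L Y by rewrite linearB linearZ.
  by rewrite L_X LY scaler0 subr0.
have Lcst t : u < t < v -> L (gamma t) = L (gamma m).
  move=> tuv; apply/rowP => i.
  apply: (derive0_constant (f := fun t => L (gamma t) ord0 i) _ muv tuv) => x xuv.
  by have := is_derive_linear_curve L i (dgamma xuv); rewrite LD mxE.
exists (backflow m (gamma m ord0 k) (gamma m)); first by rewrite backflow_k subrr.
move=> t tuv; apply/rowP => i.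
apply: (derive0_constant (f := fun t => backflow t (gamma t ord0 k) (gamma t) ord0 i) _ muv tuv).
move=> x xuv; set a := psi (gamma x).
have gi j : is_derive x 1 (fun s => gamma s ord0 j) (X (gamma m) ord0 j - a * Y ord0 j).
  have := is_derive_coord_curve j (dgamma xuv).
  have -> : (X (gamma x) - psi (gamma x) *: Y) ord0 j = X (gamma x) ord0 j - a * Y ord0 j by
    rewrite !mxE.
  by rewrite /X (Lcst _ xuv).
have xi : is_derive x 1 (fun s : R => s *: X (gamma m) ord0 i) (X (gamma m) ord0 i).
  have := is_derive_coord_curve i (is_derive_scalel x (X (gamma m))).
  by have -> : (fun s : R => (s *: X (gamma m)) ord0 i) = (fun s : R => s *: X (gamma m) ord0 i)
    by apply/funext => s; rewrite mxE.
have zi : is_derive x 1 (fun s : R => (gamma s ord0 k *: Y) ord0 i) (- a * Y ord0 i).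
  have gk : is_derive x 1 (fun s => gamma s ord0 k) (- a).
    by have := gi k; rewrite Xk Yk mulr1 sub0r.
  have := is_derive_coord_curve i (is_derive_scale_cst Y gk).
  by rewrite [X in is_derive _ _ _ X]mxE.
have := is_deriveB (is_deriveB (gi i) xi) zi.
rewrite [X in is_derive _ _ _ X](_ : _ = 0); last by ring.
apply: near_eq_is_derive; near=> s.
have suv : u < s < v.
  by near: s; apply: near_in_itvoo; rewrite in_itv.
rewrite /backflow.
have -> : (gamma s - s *: X (gamma s) - gamma s ord0 k *: Y) ord0 i =
  gamma s ord0 i - s * X (gamma s) ord0 i - (gamma s ord0 k *: Y) ord0 i by rewrite !mxE.
by rewrite /X (Lcst _ suv).
Unshelve. all: by end_near. Qed.

Let transport_approx (de : R) : 0 < de -> forall t1 t2, u < t1 -> t1 <= t2 -> t2 < v ->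
  sg * (psi (gamma t2) - psi (gamma t1)) <= (c + 2 * de) * (t2 - t1) + 2 * de.
Proof.
move=> de0 t1 t2 ut1 t12 t2v.
have uv : u < v by rewrite (lt_trans ut1)// (le_lt_trans t12).
have [p0 p00 gp0] := backflow_gamma uv.
have [K K0 LK] := linear_norm_bound L.
pose T := `|u| + `|v|.
have T0 : 0 <= T by rewrite addr_ge0.
have timeT t : u < t < v -> `|t| <= T.
  move=> /andP[ut tv]; rewrite ler_norml /T; have := ler_norm u; have := ler_norm v.
  have := ler_norm (- u); have := ler_norm (- v); rewrite !normrN => *.
  apply/andP; split; have := normr_ge0 u; have := normr_ge0 v; lra.
pose Q := [set p : V | `|p - a0| <= R0].
have cQ : compact Q by exact: compact_ball_le.
have gQ t : u < t < v -> Q (gamma t).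
  by move=> /gamma_near h; rewrite /Q /= (le_trans h)// ltW.
have [Mpsi hM] : exists M, forall p, Q p -> `|psi p| <= M.
  by apply: continuous_bounded_on => //; exact: continuous_subspaceT.
have [d1 d10 uc1] := compact_uniform_continuity cQ cpsi de0.
(* As [d <= ep] below, [ep + d <= 2 * ep] stays under the radius of uniform continuity and under the
   gap [R0 - R1]. *)
pose ep := Num.min d1 (R0 - R1) / 4.
have ep0 : 0 < ep by rewrite divr_gt0// lt_min d10 subr_gt0.
have ep1 : 2 * ep <= d1.
  have : Num.min d1 (R0 - R1) <= d1 by rewrite ge_min lexx.
  by move: ep0; rewrite /ep; lra.
have ep2 : 2 * ep <= R0 - R1.
  have : Num.min d1 (R0 - R1) <= R0 - R1 by rewrite ge_min lexx orbT.
  by move: ep0; rewrite /ep; lra.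
(* Calibrated so that the exchanged layer term costs at most [de]. It depends on [ep], so the depth
   [s] of the layer can only be fixed afterwards. *)
pose e2 := de / (1 + bramp_ratio ep).
have rt := bramp_ratio_ge0 ep.
have rt1 : 0 < 1 + bramp_ratio ep by rewrite ltr_pwDl.
have e20 : 0 < e2 by rewrite divr_gt0.
have e2r : e2 * bramp_ratio ep <= de.
  rewrite /e2 mulrAC ler_pdivrMr// ler_wpM2l ?(ltW de0)//.
  by rewrite lerDr.
(* An oscillation that is also at most 1 has a square at most itself. *)
have m0 : 0 < Num.min 1 e2 by rewrite lt_min ltr01.
have [d2 d20 uc2] := compact_uniform_continuity cQ cpsi m0.
pose s := Num.min (ep / 4) (d2 / 2).
have s0 : 0 < s by rewrite lt_min; apply/andP; split; rewrite divr_gt0.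
have s1 : s <= ep / 4 by rewrite ge_min lexx.
have s2 : s <= d2 / 2 by rewrite ge_min lexx orbT.
pose d := Num.min ep (d2 / 2).
have d0 : 0 < d by rewrite lt_min ep0 divr_gt0.
have d11 : d <= ep by rewrite ge_min lexx.
have d12 : d <= d2 / 2 by rewrite ge_min lexx orbT.
have TK : 0 < 1 + T * K by rewrite ltr_pwDl// mulr_ge0.
(* [et = 2 * s ^+ 2 / de] turns [small_et] into an equality, and [rho = d / (1 + T * K)] is the
   largest radius allowed by [rhod]. *)
apply: (@tube_transport psi omega a0 R0 gamma u v c sg p0 K T Mpsi cpsi comega weak
  dgamma gp0 p00 sg2 omega_c K0 LK timeT _ ep (2 * s ^+ 2 / de) (d / (1 + T * K)) s d de e2) => //.
- by move=> t /gQ; exact: hM.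
- by rewrite divr_gt0// mulr_gt0// exprn_gt0.
- by rewrite divr_gt0.
- exact: ltW.
- exact: ltW.
- by rewrite divfK// gt_eqF.
- move=> t q tuv qg; rewrite -(subrKA (gamma t)) (le_trans (ler_normD _ _))//.
  by have := gamma_near tuv; move: qg d11 ep2; lra.
- move=> t q tuv qg; rewrite distrC; apply: uc1; first exact: gQ.
  by rewrite distrC (le_trans qg)//; move: d11 ep1; lra.
- move=> t q tuv qg; have : `|psi (gamma t) - psi q| <= Num.min 1 e2.
    apply: uc2; first exact: gQ.
    by rewrite distrC (le_trans qg)//; move: s2 d12; lra.
  rewrite le_min distrC -[(_ - _) ^+ 2]real_normK ?num_real// => /andP[h1 h2].
  have : `|psi q - psi (gamma t)| ^+ 2 <= `|psi q - psi (gamma t)|.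
    by rewrite expr2 ler_piMr.
  by move: h2 (normr_ge0 (psi q - psi (gamma t))) e20; lra.
- have sn0 : s != 0 by rewrite gt_eqF.
  have den0 : de != 0 by rewrite gt_eqF.
  by rewrite le_eqVlt; apply/orP; left; apply/eqP; field; rewrite sn0 den0.
Qed.

Theorem transport_inequality t1 t2 : u < t1 -> t1 <= t2 -> t2 < v ->
  sg * (psi (gamma t2) - psi (gamma t1)) <= c * (t2 - t1).
Proof.
move=> ut1 t12 t2v; apply/ler_addgt0Pr => e' e'0.
have D0 : 0 < 2 * (t2 - t1) + 2 by rewrite ltr_wpDl// mulr_ge0// subr_ge0.
(* With this [de] the total error is exactly [e']. *)
have := @transport_approx (e' / (2 * (t2 - t1) + 2)) _ t1 t2 ut1 t12 t2v.
rewrite divr_gt0// => /(_ isT) /le_trans; apply.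
rewrite le_eqVlt; apply/orP; left; apply/eqP; field.
by rewrite gt_eqF.
Qed.

End transport_inequality.

End transport.

(** * Peano's theorem *)

Lemma ultra_fmap (T U : Type) (f : T -> U) (G : set_system T) :
  UltraFilter G -> UltraFilter (f @ G).
Proof.
move=> UG; split => [|H PH GH]; first exact: fmap_proper_filter.
apply/seteqP; split => [A HA|]; last exact: GH.
have [//|GnA] := in_ultra_setVsetC (f @^-1` A) UG.
have HnA : H (~` A) by apply: GH.
by have [x []] := @filter_ex _ _ PH _ (@filterI _ _ PH _ _ HA HnA).
Qed.

Lemma is_derive_of_increment (R : realType) (W : normedModType R) (z : R -> W) (t : R) (w : W) :
  (forall e, 0 < e -> exists2 d, 0 < d & forall s, `|s - t| < d ->
      `|z s - z t - (s - t) *: w| <= e * `|s - t|) -> is_derive t 1 z w.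
Proof.
move=> H.
suff h : h^-1 *: ((z \o shift t) (h *: 1) - z t) @[h --> (0:R)^'] --> w.
  apply: DeriveDef; first by apply/cvg_ex; exists w.
  by apply/cvg_lim.
apply/cvgrPdist_le => e e0; have [d d0 hd] := H e e0; near=> r.
have r0 : r != 0 by near: r; exact: nbhs_dnbhs_neq.
have rd : `|r| < d by near: r; exact: dnbhs0_lt.
have := hd (r + t); rewrite addrK => /(_ rd) hr.
rewrite /= [r *: 1]mulr1 distrC.
have -> : r^-1 *: (z (r + t) - z t) - w = r^-1 *: (z (r + t) - z t - r *: w).
  by rewrite [RHS]scalerBr scalerA mulVf// scale1r.
by rewrite normrZ normfV ler_pdivrMl ?normr_gt0// mulrC.
Unshelve. all: by end_near. Qed.

Section peano.
Variables (R : realType) (N : nat).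
Local Notation V := 'rV[R]_N.
Variable M : R.
Hypothesis M0 : 0 <= M.
Implicit Types (F : V -> V) (a p w : V) (h t s e : R).

Definition euler F a h (n : nat) : V := iter n (fun p => p + h *: F p) a.

(** The increment is a sum of [m] steps, each within [h * e] of [h *: w]. *)
Lemma euler_close F a h e w k m : 0 <= h ->
  (forall i, (k <= i < k + m)%N -> `|F (euler F a h i) - w| <= e) ->
  `|euler F a h (k + m) - euler F a h k - (h * m%:R) *: w| <= e * (h * m%:R).
Proof.
move=> h0; elim: m => [|m IH] H.
  by rewrite addn0 mulr0 scale0r subrr subr0 normr0 mulr0.
rewrite addnS /= -/(euler F a h (k + m)).
have -> : euler F a h (k + m) + h *: F (euler F a h (k + m)) - euler F a h k -
    (h * m.+1%:R) *: w = (euler F a h (k + m) - euler F a h k - (h * m%:R) *: w) +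
    h *: (F (euler F a h (k + m)) - w).
  by rewrite -natr1; apply/rowP => i; rewrite !mxE; ring.
have -> : e * (h * m.+1%:R) = e * (h * m%:R) + h * e by rewrite -natr1; ring.
rewrite (le_trans (ler_normD _ _))// lerD//.
  apply: IH => i /andP[ki im]; apply: H; rewrite ki/= addnS.
  by rewrite (leq_trans im)// leqnSn.
by rewrite normrZ ger0_norm// ler_wpM2l// H// leq_addr/= addnS.
Qed.

Lemma euler_lipschitz F a h k m : (forall p, `|F p| <= M) -> 0 <= h ->
  `|euler F a h (k + m) - euler F a h k| <= M * (h * m%:R).
Proof.
move=> FM h0; have := @euler_close F a h M 0 k m h0.
by rewrite scaler0 subr0; apply => i _; rewrite subr0.
Qed.

(* Any two nodes lie within [h] of the times they approximate, whence the error
   terms. *)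
Lemma euler_increment F a h e w (t s : R) : 0 < h -> 0 <= t -> 0 <= s -> 0 <= e ->
  (forall p, `|F p| <= M) ->
  (forall p, `|p - euler F a h (Num.truncn (t / h))| <= M * (`|s - t| + h) ->
     `|F p - w| <= e) -> `|w| <= M ->
  `|euler F a h (Num.truncn (s / h)) - euler F a h (Num.truncn (t / h)) - (s - t) *: w|
    <= e * (`|s - t| + h) + M * h.
Proof.
move=> h0 t0 s0 e0 FM Fw wM.
set k := Num.truncn (t / h); set l := Num.truncn (s / h).
have bnd x : 0 <= x -> h * (Num.truncn (x / h))%:R <= x < h * (Num.truncn (x / h))%:R + h.
  move=> x0; have xh : 0 <= x / h by rewrite divr_ge0// ltW.
  have /andP[h1 h2] := truncn_itv xh.
  rewrite mulrC -ler_pdivlMr// h1 /= -[X in _ + X]mul1r -mulrDl natr1 mulrC.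
  by rewrite mulrC -ltr_pdivrMr.
have /andP[k1 k2] := bnd _ t0; have /andP[l1 l2] := bnd _ s0.
rewrite -/k -/l in k1 k2 l1 l2.
have kl : `|h * l%:R - h * k%:R - (s - t)| <= h.
  by rewrite ler_norml; apply/andP; split; lra.
have klh : `|h * l%:R - h * k%:R| <= `|s - t| + h.
  rewrite -(subrK (s - t) (h * l%:R - h * k%:R)) (le_trans (ler_normD _ _))//.
  by rewrite addrC lerD2l.
have key : `|euler F a h l - euler F a h k - (h * l%:R - h * k%:R) *: w| <= e * (`|s - t| + h).
  have [lk|lk] := leqP k l.
    have lE : l = (k + (l - k))%N by rewrite subnKC.
    have hE : h * (l - k)%:R = h * l%:R - h * k%:R by rewrite natrB// mulrBr.
    have hE0 : 0 <= h * (l - k)%:R by rewrite mulr_ge0// ltW.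
    have := @euler_close F a h e w k (l - k) (ltW h0); rewrite -lE hE => /(_ _)/le_trans; apply.
      move=> i /andP[ki il]; apply: Fw; have -> : i = (k + (i - k))%N by rewrite subnKC.
      apply: (le_trans (euler_lipschitz _ _ _ FM (ltW h0))); rewrite ler_wpM2l//.
      apply: le_trans klh; rewrite -hE ger0_norm// ler_wpM2l ?(ltW h0)// ler_nat.
      by rewrite leq_sub2r// ltnW.
    by rewrite ler_wpM2l// (le_trans _ klh)// ler_norm.
  have lk' := ltnW lk.
  have kE : k = (l + (k - l))%N by rewrite subnKC.
  have hE : h * (k - l)%:R = h * k%:R - h * l%:R by rewrite natrB// mulrBr.
  have hE0 : 0 <= h * (k - l)%:R by rewrite mulr_ge0// ltW.
  have := @euler_close F a h e w l (k - l) (ltW h0); rewrite -kE hE.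
  have -> : euler F a h k - euler F a h l - (h * k%:R - h * l%:R) *: w =
    - (euler F a h l - euler F a h k - (h * l%:R - h * k%:R) *: w).
    by apply/rowP => i; rewrite !mxE; ring.
  rewrite normrN => /(_ _)/le_trans; apply.
    move=> i /andP[li ik]; apply: Fw; rewrite -/k distrC.
    have {1}-> : k = (i + (k - i))%N by rewrite subnKC// ltnW.
    apply: (le_trans (euler_lipschitz _ _ _ FM (ltW h0))); rewrite ler_wpM2l//.
    apply: le_trans klh; rewrite distrC -hE ger0_norm// ler_wpM2l ?(ltW h0)// ler_nat.
    by rewrite leq_sub2l.
  by rewrite ler_wpM2l// (le_trans _ klh)// distrC ler_norm.
have -> : euler F a h l - euler F a h k - (s - t) *: w =
  (euler F a h l - euler F a h k - (h * l%:R - h * k%:R) *: w) +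
  (h * l%:R - h * k%:R - (s - t)) *: w.
  by apply/rowP => i; rewrite !mxE; ring.
rewrite (le_trans (ler_normD _ _))// lerD// normrZ mulrC.
by apply: ler_pM.
Qed.

(** The Euler nodes are used as a step function of time, without interpolation. An ultrafilter finer
    than [\oo] replaces the extraction of a subsequence: at each time the approximations stay in a
    compact ball, so all pointwise limits exist at once. *)
Lemma peano_forward F a : continuous F -> (forall p, `|F p| <= M) ->
  exists z : R -> V, [/\ z 0 = a, forall t, 0 <= t -> `|z t - a| <= M * t &
    forall t e, 0 <= t -> 0 < e -> exists2 d, 0 < d & forall s, 0 <= s -> `|s - t| < d ->
      `|z s - z t - (s - t) *: F (z t)| <= e * `|s - t|].
Proof.
move=> cF FM.
pose h (n : nat) : R := n.+1%:R^-1.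
have h0 n : 0 < h n by rewrite invr_gt0.
pose st (n : nat) (t : R) := euler F a (h n) (Num.truncn (t / h n)).
have st_bound n t : 0 <= t -> `|st n t - a| <= M * t.
  move=> t0; have := euler_lipschitz a 0 (Num.truncn (t / h n)) FM (ltW (h0 n)).
  rewrite add0n => /le_trans; apply; rewrite ler_wpM2l// mulrC -ler_pdivlMr//.
  by have /truncn_itv/andP[] : 0 <= t / h n by rewrite divr_ge0// ltW.
have [G [UG ooG]] := @ultraFilterLemma _ \oo _.
have lim t : exists p, 0 <= t -> st ^~ t @ G --> p.
  have [t0|t0] := boolP (0 <= t); last by exists a.
  have UGt := ultra_fmap (st ^~ t) UG.
  have := @compact_ball_le R N a (M * t); rewrite compact_ultra.
  move=> /(_ _ UGt)[|p [_ hp]]; last by exists p => _.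
  by apply: ooG; exists 0%N => // n _; exact: st_bound.
have [z hz] := choice lim.
have near_st t e : 0 <= t -> 0 < e -> G [set n | `|z t - st n t| < e].
  by move=> t0 e0; have /cvgrPdist_lt := hz t t0; apply.
have near_h e : 0 < e -> G [set n | h n < e].
  move=> e0; apply: ooG; exists (Num.truncn e^-1) => // n /= en.
  rewrite /h invf_plt ?posrE//; apply: (lt_le_trans (truncnS_gt _)).
  by rewrite ler_nat.
exists z; split.
- apply/eqP; rewrite -subr_eq0 -normr_le0; apply/ler_addgt0Pr => e e0; rewrite add0r.
  have [n /= hn] := filter_ex (near_st 0 e (lexx 0) e0).
  move: hn; rewrite /st mul0r truncn0 /=; exact: ltW.
- move=> t t0; apply/ler_addgt0Pr => e e0.
  have [n /= hn] := filter_ex (near_st t e t0 e0).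
  rewrite -(subrKA (st n t)) (le_trans (ler_normD _ _))// addrC lerD//; last exact: ltW.
  exact: st_bound.
move=> t e t0 e0.
have /cvgrPdist_le/(_ e e0)/nbhs_normP[d /= d0 hd] := cF (z t).
have M1 : 0 < M + 1 by rewrite ltr_wpDl.
(* If [|s - t|] and the step are both below this value, the nodes involved move by less than
   [d / 2]; [M + 1] avoids a division by 0. *)
exists (d / 4 / (M + 1)); first by rewrite !divr_gt0.
(* [r] is the slack of the final inequality: a quarter for the distance from [z] to the
   approximation at each of [s] and [t], a quarter for the terms carrying the step size. *)
move=> s s0 st_d; apply/ler_addgt0Pr => r r0.
have r4 : 0 < r / 4 by rewrite divr_gt0.
have d4 : 0 < d / 4 by rewrite divr_gt0.
have g1 := near_st t _ t0 r4; have g2 := near_st s _ s0 r4.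
have g3 := near_st t _ t0 d4.
have g4 : G [set n | h n < d / 4 / (M + 1)] by apply: near_h; rewrite divr_gt0.
have g5 : G [set n | h n < r / 4 / (M + e)] by apply: near_h; rewrite divr_gt0// ltr_wpDl.
have [n /= [[[[n1 n2] n3] n4] n5]] := filter_ex (filterI (filterI (filterI (filterI g1 g2) g3) g4)
  g5).
have inc := @euler_increment F a (h n) e (F (z t)) t s (h0 n) t0 s0 (ltW e0) FM _ (FM _).
have {}inc : `|st n s - st n t - (s - t) *: F (z t)| <= e * (`|s - t| + h n) + M * h n.
  apply: inc => p pp; rewrite distrC; apply: hd => /=.
  rewrite -(subrKA (st n t)) (le_lt_trans (ler_normD _ _))//.
  rewrite -/(st n t) in pp; rewrite distrC in pp.
  have : M * (`|s - t| + h n) <= (M + 1) * (`|s - t| + h n).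
    by rewrite ler_wpM2r ?addr_ge0 ?(ltW (h0 n))// lerDl.
  have : (M + 1) * (`|s - t| + h n) < d / 4 + d / 4.
    rewrite mulrC mulrDl; apply: ltrD; rewrite -ltr_pdivlMr//.
  by move: n3 pp d0; lra.
have n5' : (M + e) * h n <= r / 4.
  by rewrite mulrC -ler_pdivlMr ?ltr_wpDl// ltW.
have -> : z s - z t - (s - t) *: F (z t) = (z s - st n s) - (z t - st n t) +
   (st n s - st n t - (s - t) *: F (z t)).
  by apply/rowP => i; rewrite !mxE; ring.
rewrite (le_trans (ler_normD _ _))// (le_trans (lerD (ler_normB _ _) (lexx _)))//.
by move: n1 n2 inc n5' r0; rewrite mulrDl mulrDr; lra.
Qed.

(** Backward in time the curve is a forward solution for [- F]; at 0 the two one-sided increment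
    estimates are combined. *)
Theorem peano F a : continuous F -> (forall p, `|F p| <= M) ->
  exists z : R -> V, [/\ z 0 = a, forall t, `|z t - a| <= M * `|t| &
    forall t : R, is_derive t 1 z (F (z t))].
Proof.
move=> cF FM.
have [zp [zp0 zpM zpd]] := peano_forward a cF FM.
have [||zm [zm0 zmM zmd]] := @peano_forward (fun p => - F p) a.
- by move=> p; apply: continuousN; exact: cF.
- by move=> p; rewrite normrN.
pose z t := if 0 <= t then zp t else zm (- t).
have zpE t : 0 <= t -> z t = zp t by rewrite /z => ->.
have zmE t : t <= 0 -> z t = zm (- t).
  rewrite /z; case: ifP => // t0 t1; have -> : t = 0 by apply: le_anti; rewrite t1.
  by rewrite oppr0 zp0 zm0.
exists z; split; first by rewrite zpE.
  move=> t; have [t0|t0] := boolP (0 <= t).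
    by rewrite (zpE _ t0) ger0_norm//; exact: zpM.
  have {}t0 : t <= 0 by rewrite ltW// ltNge.
  by rewrite (zmE _ t0) ler0_norm//; apply: zmM; rewrite oppr_ge0.
move=> t; apply: is_derive_of_increment => e e0.
have H1 : 0 <= t -> exists2 d, 0 < d & forall s, 0 <= s -> `|s - t| < d ->
      `|z s - z t - (s - t) *: F (z t)| <= e * `|s - t|.
  move=> t0; have [d d0 hd] := zpd t e t0 e0; exists d => // s s0 sd.
  by rewrite !zpE//; exact: hd.
have H2 : t <= 0 -> exists2 d, 0 < d & forall s, s <= 0 -> `|s - t| < d ->
      `|z s - z t - (s - t) *: F (z t)| <= e * `|s - t|.
  move=> t0; have nt0 : 0 <= - t by rewrite oppr_ge0.
  have [d d0 hd] := zmd (- t) e nt0 e0; exists d => // s s0 sd.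
  have ns0 : 0 <= - s by rewrite oppr_ge0.
  have E : `|- s - - t| = `|s - t| by rewrite opprK addrC distrC.
  have := hd (- s) ns0; rewrite E => /(_ sd).
  by rewrite !zmE// -opprD scaleNr scalerN opprK.
have [t0|t0|t0] := ltgtP t 0.
- have [d d0 hd] := H2 (ltW t0); exists (Num.min d (- t)).
    by rewrite lt_min d0 oppr_gt0.
  move=> s; rewrite lt_min => /andP[sd st]; apply: hd => //.
  by move: st; rewrite ltr_norml => /andP[_]; lra.
- have [d d0 hd] := H1 (ltW t0); exists (Num.min d t); first by rewrite lt_min d0.
  move=> s; rewrite lt_min => /andP[sd st]; apply: hd => //.
  by move: st; rewrite ltr_norml => /andP[+ _]; lra.
have [|d1 d10 hd1] := H1; first by rewrite t0.
have [|d2 d20 hd2] := H2; first by rewrite t0.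
exists (Num.min d1 d2); first by rewrite lt_min d10.
move=> s; rewrite lt_min => /andP[s1 s2]; have [s0|/ltW s0] := leP 0 s.
  exact: hd1.
exact: hd2.
Qed.

End peano.

(** * Homogeneous norms *)

Local Notation invF := Defs.invF.
Local Notation point := Defs.point.

Lemma continuous_of_modulus (R : realType) (V W : normedModType R) (f : V -> W) :
  (forall x e, 0 < e -> exists2 d, 0 < d &
     forall y, `|x - y| < d -> `|f x - f y| <= e) -> continuous f.
Proof.
move=> H x; apply/cvgrPdist_le => e /(H x)[d d0 hd].
by apply/nbhs_normP; exists d => //.
Qed.

Section homogeneous_norm.
Variables (R : realType) (m : nat).
Implicit Types (q w a : carnot R m) (c e t : R).

Lemma carnot_norm_leP q c : 0 <= c ->
  (`|q| <= c) <-> (forall i, `|xc q i| <= c) /\ (forall v, `|yc q v| <= c).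
Proof.
move=> c0; rewrite /Num.norm /= ge_max; split.
  move=> /andP[/(row_norm_leP _ c0) h1 /(row_norm_leP _ c0) h2].
  by split => [i|v]; [exact: h1|exact: h2].
move=> [h1 h2]; apply/andP; split; apply/(row_norm_leP _ c0) => i; first exact: h1.
by have := h2 (enum_val i); rewrite /yc enum_valK.
Qed.

Lemma xc_le_norm q i : `|xc q i| <= `|q|.
Proof. by have [+ _] := (carnot_norm_leP q (normr_ge0 q)).1 (lexx _); exact. Qed.

Lemma yc_le_norm q v : `|yc q v| <= `|q|.
Proof. by have [_ +] := (carnot_norm_leP q (normr_ge0 q)).1 (lexx _); exact. Qed.

Lemma xcB q w i : xc (q - w) i = xc q i - xc w i.
Proof. by rewrite /xc !mxE. Qed.

Lemma ycB q w v : yc (q - w) v = yc q v - yc w v.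
Proof. by rewrite /yc !mxE. Qed.

Lemma mulF_invK w q : mulF w (mulF (invF w) q) = q.
Proof.
have mulFN : mulF w (invF w) = 0.
  apply: eq_carnot => [i|v];
    rewrite ?xc_point ?yc_point ?xc0 ?yc0 ?xcN ?ycN; ring.
by rewrite mulFA mulFN mul0F.
Qed.

Lemma norm_half_bracket (x1 x2 x3 x4 b d : R) : `|x1| <= b -> `|x2| <= d ->
  `|x3| <= d -> `|x4| <= b -> `|2^-1 * (x1 * x2 - x3 * x4)| <= b * d.
Proof.
move=> h1 h2 h3 h4; rewrite normrM ger0_norm ?invr_ge0//.
have h5 : `|x1 * x2 - x3 * x4| <= b * d + b * d.
  rewrite (le_trans (ler_normB _ _))// !normrM lerD//; first exact: ler_pM.
  by rewrite mulrC ler_pM.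
by rewrite mulrC ler_pdivrMr// mulr_natr mulr2n.
Qed.

Lemma mulFB_norm a w : `|mulF a w - a| <= `|w| * (1 + `|a|).
Proof.
apply/carnot_norm_leP; first by rewrite mulr_ge0// addr_ge0.
split=> [i|v].
  rewrite xcB xc_point addrC addKr (le_trans (xc_le_norm w i))//.
  by rewrite ler_peMr// lerDl.
rewrite ycB yc_point.
have -> : yc a v + yc w v + 2^-1 * (xc a (upper v) * xc w (lower v) - xc w (upper v) * xc a (lower
  v)) - yc a v
  = yc w v + 2^-1 * (xc a (upper v) * xc w (lower v) - xc w (upper v) * xc a (lower v)) by ring.
have -> : `|w| * (1 + `|a|) = `|w| + `|a| * `|w| by ring.
rewrite (le_trans (ler_normD _ _))// lerD ?yc_le_norm//.
by apply: norm_half_bracket; exact: xc_le_norm.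
Qed.

Lemma mulNF_norm a q : `|mulF (invF a) q| <= `|q - a| * (1 + `|a|).
Proof.
apply/carnot_norm_leP; first by rewrite mulr_ge0// addr_ge0.
split=> [i|v].
  rewrite xc_point xcN addrC -xcB (le_trans (xc_le_norm _ i))//.
  by rewrite ler_peMr// lerDl.
rewrite yc_point !xcN ycN.
have -> : - yc a v + yc q v + 2^-1 * (- xc a (upper v) * xc q (lower v) - xc q (upper v) * - xc a
  (lower v))
  = yc (q - a) v + 2^-1 * ((- xc a (upper v)) * xc (q - a) (lower v) - xc (q - a) (upper v) * (- xc
    a (lower v))).
  by rewrite ycB !xcB; ring.
have -> : `|q - a| * (1 + `|a|) = `|q - a| + `|a| * `|q - a| by ring.
rewrite (le_trans (ler_normD _ _))// lerD ?yc_le_norm//.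
by apply: norm_half_bracket; rewrite ?normrN; exact: xc_le_norm.
Qed.

(** Elements of coordinate one-parameter subgroups: dilations and inversion determine the norm on
    them, linear in [|t|] on the first layer and of order [sqrt |t|] on the second. *)
Definition hx (i : 'I_m) (t : R) : carnot R m :=
  point (fun j => if j == i then t else 0) (fun=> 0).
Definition hy (v : vidx m) (t : R) : carnot R m :=
  point (fun=> 0) (fun u => if u == v then t else 0).

Variable nrm : carnot R m -> R.
Hypothesis hnrm : homogeneous_norm nrm.

Let nrmZ r q : 0 < r -> nrm (dilF r q) = r * nrm q. Proof. by case: hnrm => + _ _ _; exact. Qed.
Let nrmD q w : nrm (mulF q w) <= nrm q + nrm w. Proof. by case: hnrm. Qed.
Let nrmN q : nrm (invF q) = nrm q. Proof. by case: hnrm. Qed.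
Let nrm0 : nrm 0 = 0. Proof. by case: hnrm => _ _ _ h; apply/h. Qed.
Let nrm_eq0 q : nrm q = 0 -> q = 0. Proof. by case: hnrm => _ _ _ h; apply: (h q).1. Qed.

Lemma homogeneous_norm_ge0 q : 0 <= nrm q.
Proof. by have := nrmD (invF q) q; rewrite mulNF nrm0 nrmN; lra. Qed.
Let nrm_ge0 := homogeneous_norm_ge0.

Let nrm_split w q : nrm q <= nrm w + nrm (mulF (invF w) q).
Proof. by rewrite -{1}(mulF_invK w q) nrmD. Qed.

Let nrm_hx i t : nrm (hx i t) = `|t| * nrm (hx i 1).
Proof.
have pos s : 0 < s -> nrm (hx i s) = s * nrm (hx i 1).
  move=> s0; rewrite -nrmZ//; congr nrm; apply: eq_carnot => [j|v].
    by rewrite !xc_point; case: ifP => _; rewrite ?mulr1 ?mulr0.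
  by rewrite !yc_point mulr0.
have [t0|t0|->] := ltgtP t 0.
- rewrite ltr0_norm// -pos ?oppr_gt0// -nrmN; congr nrm; apply: eq_carnot => [j|v].
    by rewrite xcN !xc_point; case: ifP => _; rewrite ?oppr0.
  by rewrite ycN !yc_point oppr0.
- by rewrite gtr0_norm// pos.
- rewrite normr0 mul0r -nrm0; congr nrm; apply: eq_carnot => [j|v].
    by rewrite xc_point xc0; case: ifP.
  by rewrite yc_point yc0.
Qed.

Let nrm_hy v t : nrm (hy v t) = Num.sqrt `|t| * nrm (hy v 1).
Proof.
have pos s : 0 < s -> nrm (hy v s) = Num.sqrt s * nrm (hy v 1).
  move=> s0; rewrite -nrmZ ?sqrtr_gt0//; congr nrm; apply: eq_carnot => [j|u].
    by rewrite !xc_point mulr0.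
  by rewrite !yc_point; case: ifP => _; rewrite ?mulr1 ?mulr0// sqr_sqrtr// ltW.
have [t0|t0|->] := ltgtP t 0.
- rewrite ltr0_norm// -pos ?oppr_gt0// -nrmN; congr nrm; apply: eq_carnot => [j|u].
    by rewrite xcN !xc_point oppr0.
  by rewrite ycN !yc_point; case: ifP => _; rewrite ?oppr0.
- by rewrite gtr0_norm// pos.
- rewrite normr0 sqrtr0 mul0r -nrm0; congr nrm; apply: eq_carnot => [j|u].
    by rewrite xc_point xc0.
  by rewrite yc_point yc0; case: ifP.
Qed.

Let small_hx i e : 0 < e -> exists2 d, 0 < d & forall t, `|t| < d -> nrm (hx i t) <= e.
Proof.
move=> e0; have n1 : 0 < nrm (hx i 1) + 1 by rewrite ltr_wpDl.
exists (e / (nrm (hx i 1) + 1)); first by rewrite divr_gt0.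
move=> t td; rewrite nrm_hx; apply: le_trans (_ : `|t| * (nrm (hx i 1) + 1) <= _).
  by rewrite ler_wpM2l// lerDl.
by rewrite -ler_pdivlMr// ltW.
Qed.

Let small_hy v e : 0 < e -> exists2 d, 0 < d & forall t, `|t| < d -> nrm (hy v t) <= e.
Proof.
move=> e0; have n1 : 0 < nrm (hy v 1) + 1 by rewrite ltr_wpDl.
have en : 0 < e / (nrm (hy v 1) + 1) by rewrite divr_gt0.
exists ((e / (nrm (hy v 1) + 1)) ^+ 2); first by rewrite exprn_gt0.
move=> t td; rewrite nrm_hy; apply: le_trans (_ : Num.sqrt `|t| * (nrm (hy v 1) + 1) <= _).
  by rewrite ler_wpM2l ?sqrtr_ge0// lerDl.
rewrite -ler_pdivlMr//; apply: le_trans (ler_wsqrtr (ltW td)) _.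
by rewrite sqrtr_sqr ger0_norm// ltW.
Qed.

(* Coordinates are cleared one at a time, by left translations. *)
Let small_y n e : 0 < e -> exists2 d, 0 < d & forall q, `|q| < d ->
  (forall i, xc q i = 0) -> (forall v, (n <= enum_rank v)%N -> yc q v = 0) -> nrm q <= e.
Proof.
elim: n e => [|n IH] e e0.
  exists 1 => // q _ qx qy; rewrite (_ : q = 0) ?nrm0 ?ltW//.
  by apply: eq_carnot => [i|v]; rewrite ?xc0 ?yc0 ?qx ?qy.
have e2 : 0 < e / 2 by rewrite divr_gt0.
have [d d0 hd] := IH _ e2.
have [[v vn]|nv] := pselect (exists v : vidx m, enum_rank v = n :> nat); last first.
  exists d => // q qd qx qy; apply: (le_trans (hd q qd qx _)); last by lra.
  move=> v nv'; apply: qy; rewrite ltn_neqAle nv' andbT.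
  by apply/eqP => nE; apply: nv; exists v.
have [d' d'0 hd'] := small_hy v e2.
exists (Num.min d d'); first by rewrite lt_min d0.
move=> q; rewrite lt_min => /andP[qd qd'] qx qy.
rewrite (le_trans (nrm_split (hy v (yc q v)) q))// [leRHS](splitr e) lerD//.
  by apply: hd'; rewrite (le_lt_trans (yc_le_norm q v)).
set q' := mulF _ _.
have q'x i : xc q' i = 0 by rewrite /q' xc_point xcN xc_point qx oppr0 addr0.
(* The first-layer coordinates of [q] vanish, so no bracket term arises and the translation changes
   the coordinate [v] only. *)
have q'y u : yc q' u = if u == v then 0 else yc q u.
  rewrite /q' yc_point ycN !xcN yc_point !qx !xc_point !(mulr0, mul0r, oppr0, subr0, addr0).
  by case: eqP => [->|_]; rewrite ?addNr ?oppr0 ?add0r.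
apply: hd => //.
- apply: le_lt_trans qd; apply/carnot_norm_leP => //.
  split=> [i|u]; first by rewrite q'x normr0.
  by rewrite q'y; case: ifP => _; rewrite ?normr0 ?yc_le_norm.
- move=> u nu; rewrite q'y; case: eqP => // /eqP uv; apply: qy.
  rewrite ltn_neqAle nu andbT -vn; apply: contraNN uv => /eqP/val_inj/enum_rank_inj->.
  by [].
Qed.

Let small_x n e : 0 < e -> exists2 d, 0 < d & forall q, `|q| < d ->
  (forall i : 'I_m, (n <= i)%N -> xc q i = 0) -> nrm q <= e.
Proof.
elim: n e => [|n IH] e e0.
  have [d d0 hd] := small_y (vdim m) e0; exists d => // q qd qx; apply: hd => //.
    by move=> i; exact: qx.
  by move=> v; rewrite leqNgt ltn_ord.
have e2 : 0 < e / 2 by rewrite divr_gt0.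
have [d d0 hd] := IH _ e2.
have [nm|mn] := ltnP n m; last first.
  exists d => // q qd qx; apply: (le_trans (hd q qd _)); last by lra.
  by move=> i ni; have := leq_trans mn ni; rewrite leqNgt ltn_ord.
pose i0 := Ordinal nm.
have [d' d'0 hd'] := small_hx i0 e2.
(* Here the translation also disturbs the second layer; for [|q| < 1] the bound on the sup norm at
   most doubles, whence [d / 2]. *)
exists (Num.min (Num.min (d / 2) 1) d'); first by rewrite !lt_min d'0 ltr01 divr_gt0.
move=> q; rewrite !lt_min => /andP[/andP[qd q1] qd'] qx.
rewrite (le_trans (nrm_split (hx i0 (xc q i0)) q))// [leRHS](splitr e) lerD//.
  by apply: hd'; rewrite (le_lt_trans (xc_le_norm q i0)).
apply: hd.
- apply: le_lt_trans (mulNF_norm _ _) _.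
  have h1 : `|hx i0 (xc q i0)| <= `|q|.
    apply/carnot_norm_leP => //; split=> [i|u].
      by rewrite xc_point; case: ifP => _; rewrite ?normr0 ?xc_le_norm.
    by rewrite yc_point normr0.
  have h2 : `|q - hx i0 (xc q i0)| <= `|q|.
    apply/carnot_norm_leP => //; split=> [i|u].
      rewrite xcB xc_point; case: eqP => [->|_]; first by rewrite subrr normr0.
      by rewrite subr0 xc_le_norm.
    by rewrite ycB yc_point subr0 yc_le_norm.
  apply: le_lt_trans (_ : `|q| * (1 + 1) < _); last by move: qd; lra.
  by apply: ler_pM => //; rewrite lerD2l (le_trans h1)// ltW.
- move=> i ni; rewrite xc_point xcN xc_point; case: eqP => [->|/eqP ii0]; first by rewrite addNr.
  rewrite oppr0 add0r; apply: qx; rewrite ltn_neqAle ni andbT.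
  by apply: contraNN ii0 => /eqP nE; apply/eqP/val_inj.
Qed.

Lemma homogeneous_norm_small e : 0 < e ->
  exists2 d, 0 < d & forall q, `|q| < d -> nrm q <= e.
Proof.
move=> /(small_x m)[d d0 hd]; exists d => // q qd; apply: hd => // i.
by rewrite leqNgt ltn_ord.
Qed.

Let nrm_continuous : continuous nrm.
Proof.
apply: continuous_of_modulus => q e e0.
have [d d0 hd] := homogeneous_norm_small e0.
have dq : 0 < d / 2 / (1 + (`|q| + 1)) by rewrite !divr_gt0// ltr_pwDl// addr_ge0.
exists (Num.min 1 (d / 2 / (1 + (`|q| + 1)))); first by rewrite lt_min ltr01.
move=> w; rewrite lt_min => /andP[qw1 qw].
have n1 : nrm q - nrm w <= nrm (mulF (invF w) q).
  by rewrite lerBlDl nrm_split.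
have n2 : nrm w - nrm q <= nrm (mulF (invF w) q).
  rewrite lerBlDl (le_trans (nrm_split q w))// lerD2l -nrmN.
  rewrite le_eqVlt; apply/orP; left; apply/eqP; congr nrm; apply: eq_carnot => [i|v];
    rewrite ?xcN ?ycN ?xc_point ?yc_point ?xcN ?ycN; ring.
have small : nrm (mulF (invF w) q) <= e.
  apply: hd; apply: le_lt_trans (mulNF_norm _ _) _.
  have w1 : `|w| <= `|q| + 1.
    by rewrite -(subrK q w) addrC (le_trans (ler_normD _ _))// lerD2l distrC ltW.
  apply: le_lt_trans (_ : `|q - w| * (1 + (`|q| + 1)) < _).
    by rewrite ler_wpM2l// lerD2l.
  rewrite -ltr_pdivlMr; last by rewrite ltr_pwDl// addr_ge0.
  by rewrite (lt_trans qw)// ltr_pM2r ?invr_gt0 ?ltr_pwDl ?addr_ge0//; lra.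
by rewrite ler_norml; apply/andP; split; lra.
Qed.

(** By compactness [nrm] has a positive minimum on the sup-norm sphere of radius [k]. A dilation of
    factor at most 1 brings any point beyond the sphere onto it, and does not increase [nrm]. *)
Lemma homogeneous_norm_large k : 0 < k ->
  exists2 r, 0 < r & forall q, nrm q < r -> `|q| <= k.
Proof.
move=> k0; pose S := [set q : carnot R m | `|q| = k].
have cS : compact S.
  apply: (@subclosed_compact _ _ ([set x : 'rV[R]_m | `|x| <= k] `*` [set y : 'rV[R]_(vdim m) |
    `|y| <= k])).
  - have -> : S = Num.norm @^-1` [set k] by [].
    by apply: closed_comp => [p _|]; [exact: norm_continuous|exact: closed_eq].
  - by apply: compact_setX; exact: compact_norm_le.
  - move=> q /= qk; have : `|q| <= k by rewrite qk.
    by rewrite /Num.norm /= ge_max => /andP[].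
have cross q : k < `|q| -> exists2 t, 0 < t <= 1 & S (dilF t q).
  move=> kq; pose f (t : R) : R := `|dilF t q|.
  have cf : continuous f.
    have dilE : (fun t => dilF t q) = fun t => (t *: q.1, t ^+ 2 *: q.2).
      apply/funext => t; apply: eq_carnot => [i|v].
        by rewrite xc_point /xc mxE.
      by rewrite yc_point /yc mxE.
    move=> t; apply: (@continuous_comp _ _ _ (fun t => dilF t q) Num.norm); last first.
      exact: norm_continuous.
    have c1 : (fun s : R => s *: q.1) @ t --> t *: q.1 by exact: scalel_continuous.
    have c2 : (fun s : R => s ^+ 2 *: q.2) @ t --> t ^+ 2 *: q.2.
      apply: (@continuous_comp _ _ _ (fun t : R => t ^+ 2) (fun t => t *: q.2)).
        exact: exprn_continuous.
      exact: scalel_continuous.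
    rewrite dilE; exact: (cvg_pair c1 c2).
  have f0 : f 0 = 0.
    rewrite /f (_ : dilF 0 q = 0) ?normr0//.
    by apply: eq_carnot => [i|v]; rewrite ?xc_point ?yc_point ?xc0 ?yc0 ?expr0n mul0r.
  have f1 : f 1 = `|q|.
    rewrite /f; congr (`|_|).
    by apply: eq_carnot => [i|v]; rewrite ?xc_point ?yc_point ?expr1n mul1r.
  have [||t] := @IVT R f 0 1 k ler01.
  - exact: continuous_subspaceT.
  - by rewrite f0 f1 min_l ?max_r ?(ltW k0) ?(ltW kq)// (le_trans (ltW k0))// ltW.
  rewrite in_itv /= => /andP[t0 t1] ft; exists t => //.
  rewrite t1 andbT lt_neqAle t0 andbT; apply/eqP => t0'.
  by move: ft; rewrite -t0' f0 => k0'; rewrite -k0' ltxx in k0.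
(* If the sphere is empty, no point has norm above [k], and any radius works. *)
have [[q0 Sq0]|S0] := pselect (S !=set0); last first.
  exists 1 => // q _; rewrite leNgt; apply/negP => /cross[t _ St].
  by apply: S0; exists (dilF t q).
have [||c cS' hc] := @compact_EVT_min _ R nrm S _ cS.
- by exists q0.
- exact: continuous_subspaceT.
have c0 : 0 < nrm c.
  rewrite lt_neqAle nrm_ge0 andbT eq_sym; apply/eqP => /nrm_eq0 c0.
  by move: cS'; rewrite inE /S /= c0 normr0 => k0'; rewrite -k0' ltxx in k0.
exists (nrm c) => // q qc; rewrite leNgt; apply/negP => /cross[t /andP[t0 t1] St].
have := hc (dilF t q); rewrite inE => /(_ St); rewrite nrmZ// => h.
have : t * nrm q <= nrm q by rewrite ler_piMl.
by move: h qc; lra.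
Qed.

Lemma xWB (p p' : wspace R m) i : xW (p - p') i = xW p i - xW p' i.
Proof. by rewrite /xW; case: insubP => [j _ _|_]; rewrite ?mxE ?subr0. Qed.

Lemma embW_dist (p p' : wspace R m) : `|embW p - embW p'| = `|p - p'|.
Proof.
have ex i : xc (embW p - embW p') i = xW (p - p') i by rewrite xcB !xc_point xWB.
have ey v : yc (embW p - embW p') v = (p - p') ord0 (enum_rank (inr v : widx m)).
  by rewrite ycB !yc_point /yW !mxE.
apply/eqP; rewrite eq_le; apply/andP; split.
  apply/carnot_norm_leP => //; split=> [i|v]; last by rewrite ey; exact: coord_le_norm.
  by rewrite ex /xW; case: insubP => [j _ _|_]; rewrite ?normr0//; exact: coord_le_norm.
apply/row_norm_leP => // i; rewrite -(enum_valK i); case: (enum_val i) => [j|v].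
  have := xc_le_norm (embW p - embW p') (val j); rewrite ex /xW.
  case: insubP => [j' _ jj'|]; last by rewrite (valP j).
  by have -> : j' = j by exact: val_inj.
by have := yc_le_norm (embW p - embW p') v; rewrite ey.
Qed.

(** [closed_ballW] is a closure taken in the whole group: half of [k] is spent on approximating by a
    point of the open ball. *)
Lemma closed_ballW_small (a : wspace R m) k : 0 < k ->
  exists2 r, 0 < r & forall p, closed_ballW nrm a r p -> `|p - a| <= k.
Proof.
move=> k0; have A0 : 0 < 1 + `|embW a| by rewrite ltr_pwDl.
have [|r r0 hr] := @homogeneous_norm_large (k / 2 / (1 + `|embW a|)).
  by rewrite !divr_gt0.
exists r => // p /(_ (ball (embW p) (k / 2))) [|q [/= qa pq]].
  by apply: nbhsx_ballx; rewrite divr_gt0.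
rewrite -embW_dist -(subrKA q) (le_trans (ler_normD _ _))// [leRHS](splitr k) lerD//.
  by move: pq; rewrite -ball_normE /= => /ltW.
rewrite -(mulF_invK (embW a) q) (le_trans (mulFB_norm _ _))//.
by rewrite -ler_pdivlMr//; exact: hr.
Qed.

Lemma closed_ballW_nbhs (a : wspace R m) r : 0 < r ->
  exists2 k, 0 < k & forall p, `|p - a| <= k -> closed_ballW nrm a r p.
Proof.
move=> r0; have A0 : 0 < 1 + `|embW a| by rewrite ltr_pwDl.
have [|d d0 hd] := @homogeneous_norm_small (r / 2); first by rewrite divr_gt0.
exists (d / 2 / (1 + `|embW a|)); first by rewrite !divr_gt0.
move=> p pa; apply: subset_closure; rewrite /ballF /=.
apply: le_lt_trans (_ : r / 2 < r); last by lra.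
apply: hd; apply: le_lt_trans (mulNF_norm _ _) _.
by rewrite embW_dist; move: pa; rewrite ler_pdivlMr// => /le_lt_trans; apply; lra.
Qed.

Lemma closed_ballW_mono (a : wspace R m) r r' : r <= r' ->
  closed_ballW nrm a r `<=` closed_ballW nrm a r'.
Proof.
move=> rr' p; apply: closure_subset => q; rewrite /ballF /= => /lt_le_trans; exact.
Qed.

End homogeneous_norm.

(** * Projected vector fields *)

Lemma linear_rV_continuous (R : realType) (N : nat)
    (L : {linear 'rV[R]_N -> 'rV[R]_N}) : continuous L.
Proof.
have [K K0 LK] := linear_norm_bound L.
apply: continuous_of_modulus => p e e0; have K1 : 0 < K + 1 by rewrite ltr_wpDl.
exists (e / (K + 1)) => [|q pq]; first by rewrite divr_gt0.
rewrite -linearB (le_trans (LK _))//.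
apply: le_trans (_ : (K + 1) * `|p - q| <= _); first by rewrite ler_wpM2r// lerDl.
by rewrite mulrC -ler_pdivlMr// ltW.
Qed.

Section clamp.
Variables (R : realType) (N : nat) (a : 'rV[R]_N) (r : R).
Hypothesis r0 : 0 <= r.

(** The coordinatewise projection onto a closed cube, a 1-Lipschitz retraction: composing with it
    extends functions continuous on the cube to the whole space. *)
Definition clamp (p : 'rV[R]_N) : 'rV[R]_N :=
  \row_i Num.max (a ord0 i - r) (Num.min (a ord0 i + r) (p ord0 i)).

Lemma clamp_id p : `|p - a| <= r -> clamp p = p.
Proof.
move=> /(row_norm_leP _ r0) pa; apply/rowP => i; rewrite mxE.
have := pa i; rewrite !mxE ler_distl => /andP[h1 h2].
by rewrite min_r// max_r.
Qed.

Lemma clamp_in p : `|clamp p - a| <= r.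
Proof.
apply/row_norm_leP => // i; rewrite !mxE ler_distl le_max lexx /= ge_max.
by rewrite ge_min lexx andbT; move: r0; lra.
Qed.

Lemma clamp_continuous : continuous clamp.
Proof.
apply: lipschitz1_continuous => p q; apply/row_norm_leP => // i.
have pq := coord_le_norm (p - q) i; rewrite !mxE in pq *.
apply: le_trans pq.
have maxL (c x y : R) : `|Num.max c x - Num.max c y| <= `|x - y|.
  wlog xy : x y / x <= y => [H|].
    by have [/H//|/ltW/H] := leP x y; rewrite distrC (distrC y).
  rewrite distrC (distrC x) !ger0_norm ?subr_ge0// ?ge_max ?le_max ?lexx ?xy ?orbT//.
  by case: (leP c x) => cx; case: (leP c y) => cy; lra.
have minL (c x y : R) : `|Num.min c x - Num.min c y| <= `|x - y|.
  by have := maxL (- c) (- x) (- y); rewrite -!oppr_min -!opprD !normrN.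
exact: le_trans (maxL _ _ _) (minL _ _ _).
Qed.

End clamp.

Section fields.
Variables (R : realType) (m : nat) (j : hidx m).
Local Notation V := (wspace R m).

Definition Xlin (p : V) : V :=
  2^-1 *: (\sum_(v : vidx m | lower v == val j) xW p (upper v) *: eY R v)
  - 2^-1 *: (\sum_(v : vidx m | (upper v == val j) && (0 < lower v)%N)
               xW p (lower v) *: eY R v).

Lemma xW_linear c (p q : V) i : xW (c *: p + q) i = c * xW p i + xW q i.
Proof. by rewrite /xW; case: insubP => [k _ _|_]; rewrite ?mxE ?mulr0 ?addr0. Qed.

Lemma Xlin_linear : linear Xlin.
Proof.
move=> c p q; rewrite /Xlin.
rewrite (eq_bigr (fun v => c *: (xW p (upper v) *: eY R v) + xW q (upper v) *: eY R v)); last first.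
  by move=> v _; rewrite xW_linear scalerDl scalerA.
rewrite [X in _ - _ *: X](eq_bigr (fun v => c *: (xW p (lower v) *: eY R v) + xW q (lower v) *: eY
  R v)); last first.
  by move=> v _; rewrite xW_linear scalerDl scalerA.
rewrite !big_split /= -!scaler_sumr.
move: (\sum_(i | _) _) (\sum_(i | _) _) (\sum_(i | _) _) (\sum_(i | _) _) => A B C D.
by apply/rowP => i; rewrite !mxE; ring.
Qed.

HB.instance Definition _ := GRing.isLinear.Build R V V _ Xlin Xlin_linear.

Lemma DpsiE psi (p : V) :
  Dpsi psi j p = (eX R j + Xlin p) - psi p *: eY R (vidx1 j).
Proof.
rewrite /Dpsi /Xlin; move: (2^-1 *: _) (2^-1 *: _) => A B.
by apply/rowP => i; rewrite !mxE; ring.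
Qed.

(** The coefficients of [Xlin] involve [xW p i] for [i] other than [j] only, since
    [lower v < upper v]. *)
Lemma Xlin_vanish (p : V) : (forall i, i != val j -> xW p i = 0) -> Xlin p = 0.
Proof.
move=> p0; rewrite /Xlin !big1 ?scaler0 ?subr0// => v.
  move=> /andP[/eqP vj _]; rewrite p0 ?scale0r// -vj.
  by rewrite -val_eqE /= neq_ltn (valP v).
move=> /eqP vj; rewrite p0 ?scale0r// -vj.
by rewrite -val_eqE /= neq_ltn (valP v) orbT.
Qed.

Lemma eY_inl v k : eY R v ord0 (enum_rank (inl k : widx m)) = 0.
Proof. by rewrite mxE eqxx /= (inj_eq enum_rank_inj). Qed.

Lemma Xlin_inl (p : V) k : Xlin p ord0 (enum_rank (inl k : widx m)) = 0.
Proof.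
rewrite /Xlin !mxE !summxE !big1 ?mulr0 ?subr0// => v _.
  by rewrite mxE eY_inl mulr0.
by rewrite mxE eY_inl mulr0.
Qed.

Lemma xW_eq0 (p : V) i : (forall k, p ord0 (enum_rank (inl k : widx m)) = 0) -> xW p i = 0.
Proof. by move=> p0; rewrite /xW; case: insubP. Qed.

Lemma Xlin_Xlin p : Xlin (Xlin p) = 0.
Proof. by apply: Xlin_vanish => i _; apply: xW_eq0 => k; exact: Xlin_inl. Qed.

Lemma Xlin_eY v : Xlin (eY R v) = 0.
Proof. by apply: Xlin_vanish => i _; apply: xW_eq0 => k; exact: eY_inl. Qed.

Lemma Xlin_eX : Xlin (eX R j) = 0.
Proof.
apply: Xlin_vanish => i ij; rewrite /xW; case: insubP => // k _ ki.
rewrite mxE eqxx /= (inj_eq enum_rank_inj); case: eqP => // -[kj].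
by move: ij; rewrite -ki kj eqxx.
Qed.

(** The pair [(j, 1)] occurs in neither sum: the first asks for a lower index equal to [j], which is
    positive, and the second for a positive lower index. *)
Lemma Xlin_vidx1 (p : V) : Xlin p ord0 (enum_rank (inr (vidx1 j) : widx m)) = 0.
Proof.
have e0 v : v != vidx1 j -> eY R v ord0 (enum_rank (inr (vidx1 j) : widx m)) = 0.
  move=> vj; rewrite mxE eqxx /= (inj_eq enum_rank_inj); case: eqP => // -[vj'].
  by rewrite vj' eqxx in vj.
rewrite /Xlin !mxE !summxE !big1 ?mulr0 ?subr0// => v.
  move=> /andP[_ v0]; rewrite mxE e0 ?mulr0//; apply: contraTneq v0 => ->.
  by [].
move=> /eqP vj; rewrite mxE e0 ?mulr0//; apply/eqP => vE.
by have := valP j; rewrite -vj vE /lower /= ltnn.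
Qed.

Lemma eX_vidx1 : eX R j ord0 (enum_rank (inr (vidx1 j) : widx m)) = 0.
Proof. by rewrite mxE eqxx /= (inj_eq enum_rank_inj). Qed.

Lemma Xlin_div i : Xlin (delta_mx ord0 i) ord0 i = 0.
Proof.
rewrite -(enum_valK i); case: (enum_val i) => [k|v]; first exact: Xlin_inl.
by have := Xlin_eY v; rewrite /eY /basisW => ->; rewrite mxE.
Qed.

Lemma derive_Xlin (f : V -> R) p : differentiable f p ->
  'D_(eX R j + Xlin p) f p = 'D_(eX R j) f p
  + 2^-1 * (\sum_(v : vidx m | lower v == val j) xW p (upper v) * 'D_(eY R v) f p)
  - 2^-1 * (\sum_(v : vidx m | (upper v == val j) && (0 < lower v)%N)
               xW p (lower v) * 'D_(eY R v) f p).
Proof.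
move=> df.
have hs (P : pred (vidx m)) (c : vidx m -> R) :
    'd f p (\sum_(v | P v) c v *: eY R v) = \sum_(v | P v) c v * 'D_(eY R v) f p.
  by rewrite linear_sum; apply: eq_bigr => v _; rewrite linearZ deriveE.
have hl (a A B : V) : 'd f p (a + (2^-1 *: A - 2^-1 *: B)) =
    'd f p a + 2^-1 * 'd f p A - 2^-1 * 'd f p B.
  have -> : a + (2^-1 *: A - 2^-1 *: B) = a + 2^-1 *: A + (- 2^-1) *: B.
    by rewrite addrA scaleNr.
  by rewrite !linearD !linearZ /= /GRing.scale /= mulNr mulrN.
by rewrite deriveE// /Xlin hl !hs -deriveE.
Qed.

End fields.

(** * The derivative of a solution along integral curves *)

Section solution.
Variables (R : realType) (m : nat).
Local Notation V := (wspace R m).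
Variables (Omega : set V) (oOmega : open Omega).
Variables (psi : V -> R) (omega : hidx m -> V -> R).
Hypothesis psi_cont : {within Omega, continuous psi}.
Hypothesis omega_cont : forall j, {within Omega, continuous (omega j)}.
Hypothesis psi_sol : distributional Omega psi omega.

Lemma open_cube (a : V) : Omega a -> exists2 r, 0 < r & [set p | `|p - a| <= r] `<=` Omega.
Proof.
move=> Oa; have /nbhs_normP[r /= r0 rO] : nbhs a Omega by exact: open_nbhs_nbhs.
exists (r / 2); first by rewrite divr_gt0.
move=> p /= pa; apply: rO => /=; rewrite distrC (le_lt_trans pa)//; lra.
Qed.

Lemma continuous_clamp (f : V -> R) a r : 0 <= r -> {within Omega, continuous f} ->
  [set p | `|p - a| <= r] `<=` Omega -> continuous (f \o clamp a r).
Proof.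
move=> r0; rewrite (continuous_open_subspace _ oOmega) => cf rO p.
apply: continuous_comp; first exact: clamp_continuous.
by apply: cf; rewrite inE; apply: rO; exact: clamp_in.
Qed.

(** On the cube [clamp] is the identity; off it [xi] and its derivatives vanish, so clamping changes
    neither integral. *)
Lemma weak_on_cube (j : hidx m) a r xi : 0 <= r -> [set p | `|p - a| <= r] `<=` Omega ->
  smooth_class xi -> (forall p, xi p != 0 -> `|p - a| <= r) ->
  rV_integral (fun p => - (psi \o clamp a r) p * 'D_(eX R j + Xlin j p) xi p +
    (psi \o clamp a r) p ^+ 2 / 2 * 'D_(eY R (vidx1 j)) xi p) =
  rV_integral (fun p => (omega j \o clamp a r) p * xi p).
Proof.
move=> r0 rO sxi xir; pose Q := [set p : V | `|p - a| <= r].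
have cQ : compact Q by exact: compact_ball_le.
have clQ : closed Q.
  by apply: compact_closed => //; exact: norm_hausdorff.
have xiQ : closure [set p | xi p != 0] `<=` Q.
  rewrite (closure_id Q).1//; apply: closure_subset; exact: xir.
have test : test_function Omega xi.
  split; [exact: smooth_class_smooth| |exact: subset_trans xiQ rO].
  by apply: subclosed_compact xiQ => //; exact: closed_closure.
have DQ p v : ~ Q p -> 'D_v xi p = 0.
  move=> nQ; apply/eqP; apply/negPn/negP => h; apply: nQ.
  exact: (derive_support clQ _ h).
have xi0 p : ~ Q p -> xi p = 0.
  by move=> nQ; apply/eqP; apply/negPn/negP => /xir.
have := @psi_sol j xi test; rewrite /integral_rV [LHS]Rintegral_mkcond [RHS]Rintegral_mkcond => H.
have E (f g : V -> R) : (forall p, Q p -> f p = g p) -> (forall p, ~ Q p -> f p = 0) ->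
   (forall p, ~ Q p -> g p = 0) ->
   \int[lebesgue_tuple R (wdim m)]_x
     ((fun t => f (row_of_tuple t)) \_ (@row_of_tuple R (wdim m) @^-1` Omega)) x = rV_integral g.
  move=> fg f0 g0; apply: eq_Rintegral => t _; rewrite patchE.
  have [Qt|nQt] := pselect (Q (row_of_tuple t)).
    by rewrite mem_set ?fg//; exact: rO.
  by rewrite (g0 _ nQt); case: ifP => // _; exact: f0.
pose F1 p := - psi p * 'D_(eX R j) xi p
      + psi p ^+ 2 / 2 * 'D_(eY R (vidx1 j)) xi p
      - 2^-1 * (\sum_(v : vidx m | lower v == val j)
                  xW p (upper v) * psi p * 'D_(eY R v) xi p)
      + 2^-1 * (\sum_(v : vidx m | (upper v == val j) && (0 < lower v)%N)
                  xW p (lower v) * psi p * 'D_(eY R v) xi p).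
pose F2 p := omega j p * xi p.
rewrite -(E F1); first rewrite -(E F2); first exact: H.
- by move=> p Qp /=; rewrite clamp_id.
- by move=> p nQ; rewrite /F2 xi0// mulr0.
- by move=> p nQ; rewrite xi0// mulr0.
- move=> p Qp /=; rewrite clamp_id// derive_Xlin; last exact: smooth_class_differentiable.
  have hs (P : pred (vidx m)) (c : vidx m -> R) :
      \sum_(v | P v) c v * psi p * 'D_(eY R v) xi p = psi p * \sum_(v | P v) c v * 'D_(eY R v) xi p.
    by rewrite mulr_sumr; apply: eq_bigr => v _; rewrite mulrAC mulrC.
  by rewrite /F1 !hs; ring.
- move=> p nQ.
  have s0 (P : pred (vidx m)) (c : vidx m -> R) :
      \sum_(v | P v) c v * psi p * 'D_(eY R v) xi p = 0.
    by apply: big1 => v _; rewrite (DQ _ _ nQ) mulr0.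
  by rewrite /F1 !s0 !(DQ _ _ nQ) !mulr0 subr0 !addr0.
- by move=> p nQ; rewrite !(DQ _ _ nQ) !mulr0 addr0.
Qed.

(** The two bounds are the transport inequality for the bump, with [c = w + e], and for its mirror
    image, with [c = e - w]. *)
Lemma psi_increment (j : hidx m) (a : V) (r r' : R) (gamma : R -> V) (u v w e : R) :
  0 <= r' -> r' < r -> [set p | `|p - a| <= r] `<=` Omega ->
  (forall t : R, u < t < v -> is_derive t 1 gamma (Dpsi psi j (gamma t))) ->
  (forall t, u < t < v -> `|gamma t - a| <= r') ->
  (forall p, `|p - a| <= r -> `|omega j p - w| <= e) ->
  forall t1 t2, u < t1 -> t1 <= t2 -> t2 < v ->
  `|psi (gamma t2) - psi (gamma t1) - w * (t2 - t1)| <= e * (t2 - t1).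
Proof.
move=> r'0 r'r rO dg gr' we t1 t2 ut1 t12 t2v.
have r0 : 0 <= r by rewrite (le_trans r'0)// ltW.
pose psit := psi \o clamp a r; pose omt := omega j \o clamp a r.
have cpsi : continuous psit by exact: continuous_clamp.
have com : continuous omt by apply: continuous_clamp.
have psiE t : u < t < v -> psit (gamma t) = psi (gamma t).
  by move=> /gr' h; rewrite /psit /= clamp_id// (le_trans h)// ltW.
have dg' (t : R) : u < t < v -> is_derive t 1 gamma
   (eX R j + Xlin j (gamma t) - psit (gamma t) *: eY R (vidx1 j)).
  by move=> tuv; rewrite (psiE _ tuv) -DpsiE; exact: dg.
have omE p : `|p - a| <= r -> omt p = omega j p.
  by move=> pa; rewrite /omt /= clamp_id.
have T sg c : sg * sg = 1 -> (forall p, `|p - a| <= r -> sg * omt p <= c) ->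
    sg * (psit (gamma t2) - psit (gamma t1)) <= c * (t2 - t1).
  move=> sg2 hc.
  exact: (@transport_inequality R (wdim m) (enum_rank (inr (vidx1 j) : widx m)) (eX R j) (Xlin j)
    (@Xlin_Xlin R m j) (@Xlin_eX R m j) (Xlin_eY R j _) (@Xlin_vidx1 R m j) (@eX_vidx1 R m j)
    (@Xlin_div R m j) psit omt a r r' gamma u v c sg cpsi com r'r
    (fun xi sxi hxi => weak_on_cube j r0 rO sxi hxi) dg' gr' sg2 hc t1 t2 ut1 t12 t2v).
have t1uv : u < t1 < v by rewrite ut1 (le_lt_trans t12).
have t2uv : u < t2 < v by rewrite t2v (lt_le_trans ut1).
have h1 : psi (gamma t2) - psi (gamma t1) <= (w + e) * (t2 - t1).
  rewrite -(psiE _ t2uv) -(psiE _ t1uv) -[leLHS]mul1r; apply: T => [|p pa].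
    by rewrite mulr1.
  by rewrite mul1r omE//; have := we _ pa; rewrite ler_distl => /andP[_].
have h2 : - (psi (gamma t2) - psi (gamma t1)) <= (e - w) * (t2 - t1).
  rewrite -(psiE _ t2uv) -(psiE _ t1uv) -[leLHS]mulN1r; apply: T => [|p pa].
    by rewrite mulrNN mulr1.
  by rewrite mulN1r omE//; have := we _ pa; rewrite ler_distl => /andP[+ _]; lra.
by rewrite ler_norml; apply/andP; split; move: h1 h2; rewrite mulrDl mulrBl; lra.
Qed.

(** On a small cube around [gamma t] the values of [omega j] are within [e] of the one at the
    centre, and [psi_increment] then puts the difference quotient within [e] of it. *)
Lemma is_derive_psi (j : hidx m) (gamma : R -> V) (u v : R) :
  (forall t, u < t < v -> Omega (gamma t)) ->
  (forall t : R, u < t < v -> is_derive t 1 gamma (Dpsi psi j (gamma t))) ->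
  forall t : R, u < t < v -> is_derive t 1 (psi \o gamma) (omega j (gamma t)).
Proof.
move=> gO dg t tuv; apply: is_derive_of_increment => e e0.
have Ot := gO t tuv.
have [r1 r10 rO] := open_cube Ot.
have co : {for gamma t, continuous (omega j)}.
  have := @omega_cont j; rewrite (continuous_open_subspace _ oOmega); apply.
  by rewrite inE.
have /cvgrPdist_le/(_ e e0)/nbhs_normP[r2 /= r20 hr2] := co.
pose r := Num.min r1 (r2 / 2).
have r0 : 0 < r by rewrite lt_min r10 divr_gt0.
have gc : {for t, continuous gamma}.
  by apply/differentiable_continuous/derivable1_diffP; have [] := dg t tuv.
(* The curve is kept in the cube of half the radius, which leaves the bump room inside the larger
   one. *)
have r20' : 0 < r / 2 by rewrite divr_gt0.
have /cvgrPdist_le/(_ (r / 2) r20')/nbhs_normP[d /= d0 hd] := gc.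
pose d' := Num.min d (Num.min (t - u) (v - t)).
have d'0 : 0 < d'.
  by case/andP: tuv => ut tv; rewrite !lt_min d0 !subr_gt0 ut.
have sub s : t - d' < s < t + d' -> u < s < v /\ `|gamma s - gamma t| <= r / 2.
  move=> /andP[s1 s2].
  have m1 : d' <= d by rewrite ge_min lexx.
  have m2 : d' <= t - u by rewrite !ge_min lexx orbT.
  have m3 : d' <= v - t by rewrite !ge_min lexx !orbT.
  split; first by apply/andP; split; lra.
  rewrite distrC; apply: hd => /=; rewrite ltr_distlC.
  by apply/andP; split; lra.
have H t1 t2 : t - d' < t1 -> t1 <= t2 -> t2 < t + d' ->
   `|psi (gamma t2) - psi (gamma t1) - omega j (gamma t) * (t2 - t1)| <= e * (t2 - t1).
  apply: (@psi_increment j (gamma t) r (r / 2)) => //.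
  - exact: ltW.
  - by lra.
  - by move=> p /= pr; apply: rO => /=; rewrite (le_trans pr)// ge_min lexx.
  - by move=> s /sub[suv _]; exact: dg.
  - by move=> s /sub[_].
  - move=> p pr; rewrite distrC; apply: hr2 => /=; rewrite distrC (le_lt_trans pr)//.
    by rewrite gt_min; apply/orP; right; lra.
exists d' => // s; rewrite ltr_distl => /andP[s1 s2].
have -> : (s - t) *: omega j (gamma t) = omega j (gamma t) * (s - t) by exact: mulrC.
have [ts|st] := boolP (t <= s).
  have := H t s _ ts s2; rewrite gtrBl d'0 => /(_ isT).
  by rewrite [`|s - t|]ger0_norm ?subr_ge0.
have {}st : s <= t by rewrite ltW// ltNge.
have := H s t s1 st _; rewrite ltrDl d'0 => /(_ isT).
rewrite [`|s - t|]ler0_norm ?subr_le0// opprB; apply: le_trans.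
rewrite -normrN /=; rewrite le_eqVlt; apply/orP; left; apply/eqP; congr (`|_|).
by ring.
Qed.

End solution.

(** * Derivatives relative to a closed interval *)

Section derive_within.
Variables (R : realType) (N : nat).
Implicit Types (I : set R) (gamma : R -> 'rV[R]_N) (t : R) (w : 'rV[R]_N).

Lemma derive_within_increment I gamma t w : derive_within I gamma t w ->
  forall e, 0 < e -> exists2 d, 0 < d & forall s, I s -> `|s - t| < d ->
    `|gamma s - gamma t - (s - t) *: w| <= e * `|s - t|.
Proof.
move=> /cvgrPdist_le dw e e0.
have /nbhs_normP[d /= d0 hd] := dw e e0.
exists d => // s Is sd; have [->|st] := eqVneq s t.
  by rewrite !subrr scale0r subrr !normr0 mulr0.
have := hd s; rewrite /= distrC => /(_ sd st Is) h.
have s0 : s - t != 0 by rewrite subr_eq0.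
have -> : gamma s - gamma t - (s - t) *: w =
    (s - t) *: ((s - t)^-1 *: (gamma s - gamma t) - w).
  by rewrite scalerBr scalerA divff// scale1r.
by rewrite normrZ mulrC ler_wpM2r// distrC.
Qed.

Lemma derive_within_interior (u v : R) gamma t w : u < t < v ->
  derive_within `[u, v] gamma t w -> is_derive t 1 gamma w.
Proof.
move=> /andP[ut tv] /derive_within_increment dw.
apply: is_derive_of_increment => e /dw[d d0 hd].
exists (Num.min d (Num.min (t - u) (v - t))); first by rewrite !lt_min d0 !subr_gt0 ut.
move=> s; rewrite !lt_min => /andP[sd /andP[su sv]]; apply: hd => //.
rewrite /= in_itv /=; move: su sv; rewrite !ltr_norml => /andP[h1 _] /andP[_ h2].
by apply/andP; split; lra.
Qed.

Lemma derive_within_continuous I gamma (dgamma : R -> 'rV[R]_N) :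
  (forall t, I t -> derive_within I gamma t (dgamma t)) -> {within I, continuous gamma}.
Proof.
move=> dg; apply/subspace_continuousP => t It; apply/cvgrPdist_le => e e0.
have [d d0 hd] := derive_within_increment (dg t It) ltr01.
have w0 : 0 < 1 + `|dgamma t| by rewrite ltr_pwDl.
apply/nbhs_normP; exists (Num.min d (e / (1 + `|dgamma t|))).
  by rewrite /= lt_min d0 divr_gt0.
move=> s /=; rewrite distrC lt_min => /andP[sd se] Is.
have h := hd s Is sd; rewrite distrC -(subrK ((s - t) *: dgamma t) (gamma s - gamma t)).
rewrite (le_trans (ler_normD _ _))// normrZ (le_trans (lerD h (lexx _)))//.
by rewrite mulrC -mulrDr -ler_pdivlMr// ltW.
Qed.

Lemma derive_within_of_derive I gamma t w : is_derive t 1 gamma w -> derive_within I gamma t w.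
Proof.
move=> [dg gw]; apply/cvgrPdist_le => e e0.
have : h^-1 *: ((gamma \o shift t) (h *: 1) - gamma t) @[h --> (0:R)^'] --> w.
  by rewrite -gw; exact: dg.
move=> /cvgrPdist_le/(_ e e0)/nbhs_normP[d /= d0 hd].
apply/nbhs_normP; exists d => // s /= ts st _.
have := hd (s - t); rewrite /= sub0r normrN distrC subr_eq0 => /(_ ts st).
by rewrite [_ *: 1]mulr1 subrK.
Qed.

End derive_within.

(** * Lipschitz bound and broad* solutions *)

Section conclusion.
Variables (R : realType) (m : nat).
Local Notation V := (wspace R m).
Variables (Omega : set V) (oOmega : open Omega).
Variables (psi : V -> R) (omega : hidx m -> V -> R).
Hypothesis psi_cont : {within Omega, continuous psi}.
Hypothesis omega_cont : forall j, {within Omega, continuous (omega j)}.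
Hypothesis psi_sol : distributional Omega psi omega.

Lemma comp_curve_continuous (f : V -> R) (I : set R) (gamma : R -> V) :
  {within Omega, continuous f} -> {within I, continuous gamma} ->
  (forall t, I t -> Omega (gamma t)) -> {within I, continuous (f \o gamma)}.
Proof.
rewrite (continuous_open_subspace _ oOmega) => cf cg gO t.
apply/subspace_continuousP : t => t It.
have ct : {for gamma t, continuous f} by apply: cf; rewrite inE; exact: gO.
have gt : gamma @ within I (nbhs t) --> gamma t by move/subspace_continuousP : cg; exact.
exact: (cvg_comp gamma f gt ct).
Qed.

(** The mean value theorem asks for derivatives in the open interval only, where [is_derive_psi]
    applies; at the endpoints continuity suffices. *)
Lemma psi_curve_lipschitz (j : hidx m) (T C : R) (gamma : R -> V) :
  integral_curve Omega psi j `[0, T] gamma ->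
  (forall t, t \in `[0, T] -> `|omega j (gamma t)| <= C) ->
  forall s t, s \in `[0, T] -> t \in `[0, T] ->
  `|psi (gamma s) - psi (gamma t)| <= C * `|s - t|.
Proof.
move=> [gO [_ dg]] hC s t; wlog st : s t / s <= t => [H|].
  have [st|/ltW ts] := leP s t; first exact: H.
  by move=> sT tT; rewrite distrC (distrC s); exact: H.
move=> sT tT; have sub x : x \in `[s, t] -> x \in `[0, T].
  move: sT tT; rewrite !in_itv /= => /andP[s0 _] /andP[_ tT] /andP[sx xt].
  by rewrite (le_trans s0 sx) (le_trans xt tT).
have cg := derive_within_continuous dg.
have [c cst] : exists2 c, c \in `[s, t] & psi (gamma t) - psi (gamma s) = omega j (gamma c) * (t -
  s).
  apply: (@MVT_segment _ (psi \o gamma) (fun x => omega j (gamma x))) => //.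
    move=> x xst; apply: (is_derive_psi oOmega psi_cont omega_cont psi_sol (u := s) (v := t)) => //.
    - by move=> y yst; apply: gO; apply: sub; rewrite in_itv /= !ltW //; case/andP: yst.
    - move=> y /andP[sy yt]; apply: (derive_within_interior (u := 0) (v := T)).
        move: sT tT; rewrite !in_itv /= => /andP[s0 _] /andP[_ tT].
        by rewrite (le_lt_trans s0 sy) (lt_le_trans yt tT).
      by apply: dg; apply: sub; rewrite in_itv /= !ltW.
  apply: (@continuous_subspaceW _ _ _ `[0, T]%classic) => [x /sub//|].
  exact: comp_curve_continuous.
rewrite distrC => ->; rewrite normrM (distrC s) ler_wpM2r//.
by apply: hC; exact: sub.
Qed.

Lemma FTC_on_open (G g : R -> R) (u v a b : R) : u < a -> a <= b -> b < v ->
  (forall t : R, u < t < v -> is_derive t 1 G (g t)) ->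
  (forall t, u < t < v -> {for t, continuous g}) ->
  \int[lebesgue_measure]_(s in `[a, b]) g s = G b - G a.
Proof.
move=> ua ab bv dG cg; have [<-|anb] := eqVneq a b.
  by rewrite set_itv1 Rintegral_set1 subrr.
have {}ab : a < b by rewrite lt_neqAle anb.
have sub x : x \in `[a, b] -> u < x < v.
  by rewrite in_itv /= => /andP[ax xb]; rewrite (lt_le_trans ua ax) (le_lt_trans xb bv).
have cG x : u < x < v -> {for x, continuous G}.
  by move=> /dG[dGx _]; apply/differentiable_continuous/derivable1_diffP.
rewrite /Rintegral (continuous_FTC2 (F := G)) //.
- apply/subspace_continuousP => x xab; apply: cvg_within_filter; apply: cg; exact: sub.
- split.
  + by move=> x /subset_itv_oo_cc/sub/dG[].
  + by apply: cvg_at_right_filter; apply: cG; rewrite ua (lt_trans ab).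
  + by apply: cvg_at_left_filter; apply: cG; rewrite bv (lt_trans ua).
- by move=> x /subset_itv_oo_cc/sub/dG[_ <-]; rewrite derive1E.
Qed.

Lemma oriented_FTC (G g : R -> R) (u v t : R) : u < 0 < v -> u < t < v ->
  (forall t : R, u < t < v -> is_derive t 1 G (g t)) ->
  (forall t, u < t < v -> {for t, continuous g}) ->
  G t - G 0 = oriented_integral 0 t g.
Proof.
move=> /andP[u0 v0] /andP[ut tv] dG cg; rewrite /oriented_integral.
case: ifPn => [t0|]; first by rewrite (FTC_on_open _ t0 _ dG cg).
rewrite -ltNge => /ltW t0.
by rewrite (FTC_on_open _ t0 _ dG cg)// opprB.
Qed.

Lemma broad_star_solution (nrm : carnot R m -> R) :
  homogeneous_norm nrm -> broad_star nrm Omega psi omega.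
Proof.
move=> hn a0 Oa0.
have [r r0 rO] := open_cube oOmega Oa0.
(* [r1] serves as [d1]. Balls and cubes are nested: the ball of radius [r1] lies in the cube [r] and
   contains the cube [k], and the ball of radius [r2] lies in the cube [k / 2]. *)
have [r1 r10 hr1] := closed_ballW_small hn a0 r0.
have [k' k'0 hk'] := closed_ballW_nbhs hn a0 r10.
pose k := Num.min r k'.
have k0 : 0 < k by rewrite lt_min r0.
have kr : k <= r by rewrite ge_min lexx.
have kk' : k <= k' by rewrite ge_min lexx orbT.
have k20 : 0 < k / 2 by rewrite divr_gt0.
have [r2 r20 hr2] := closed_ballW_small hn a0 k20.
pose psit := psi \o clamp a0 r.
have cpsit : continuous psit by exact: (continuous_clamp oOmega (ltW r0) psi_cont rO).
(* Peano's theorem is applied to a bounded continuous field on the whole space; the curves stay in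
   the cube, where clamping changes nothing. *)
pose F j (p : V) := Dpsi psi j (clamp a0 r p).
have FX j p : F j p = (eX R j + Xlin j (clamp a0 r p)) - psit p *: eY R (vidx1 j).
  by rewrite /F DpsiE.
have cF j : continuous (F j).
  rewrite (_ : F j = fun p => (eX R j + Xlin j (clamp a0 r p)) - psit p *: eY R (vidx1 j)).
    2: by apply/funext => p; exact: FX.
  have cA : continuous (fun p => eX R j + Xlin j (clamp a0 r p)).
    move=> p; apply: (@continuousD _ _ _ (cst (eX R j)) (Xlin j \o clamp a0 r)).
      exact: cst_continuous.
    apply: continuous_comp; first exact: clamp_continuous.
    exact: linear_rV_continuous.
  have cB : continuous (fun p => psit p *: eY R (vidx1 j)).
    move=> p; apply: (@continuous_comp _ _ _ psit (fun c => c *: eY R (vidx1 j))).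
      exact: cpsit.
    exact: scalel_continuous.
  by move=> p; have := continuousB (cA p) (cB p).
have hM j : exists M, forall p, `|F j p| <= M.
  have [K K0 hK] := @linear_norm_bound R (wdim m) (Xlin j).
  have [C hC] : exists C, forall p, `|p - a0| <= r -> `|psit p| <= C.
    apply: (@continuous_bounded_on _ _ [set p : V | `|p - a0| <= r] psit).
      exact: compact_ball_le.
    exact: continuous_subspaceT.
  exists (`|eX R j| + K * (`|a0| + r) + C * `|eY R (vidx1 j)|) => p; rewrite FX.
  have cp := clamp_in a0 (ltW r0) p.
  rewrite (le_trans (ler_normB _ _))// lerD//.
    rewrite (le_trans (ler_normD _ _))// lerD2l (le_trans (hK _))// ler_wpM2l//.
    by rewrite -(subrK a0 (clamp _ _ _)) addrC (le_trans (ler_normD _ _))// lerD2l.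
  rewrite normrZ ler_wpM2r//.
  by have := hC _ cp; rewrite /psit /= (clamp_id (ltW r0) cp).
have [Mj hMj] := choice hM.
(* One speed bound for all [j], since [d2] may not depend on [j]. *)
pose M := \sum_j `|Mj j|.
have M0 : 0 <= M by exact: sumr_ge0.
have FM j p : `|F j p| <= M.
  rewrite (le_trans (hMj j p))// (le_trans (ler_norm _))// /M (bigD1 j)//=.
  by rewrite lerDl sumr_ge0.
(* A curve starting within [k / 2] of [a0] moves by at most [M * (2 * d2) <= k / 4], so it stays in
   the cube [k] even on twice the time interval. *)
pose d2 := Num.min (r1 / 2) (Num.min r2 (k / 8 / (M + 1))).
have M1 : 0 < M + 1 by rewrite ltr_wpDl.
have d20 : 0 < d2 by rewrite !lt_min r20 !divr_gt0.
have d2r1 : d2 < r1.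
  by have : d2 <= r1 / 2 by [rewrite ge_min lexx]; move: r10; lra.
have d2r2 : d2 <= r2 by rewrite !ge_min lexx orbT.
have d2k : d2 <= k / 8 / (M + 1) by rewrite !ge_min lexx !orbT.
have Md2 : M * (2 * d2) <= k / 4.
  have : (M + 1) * d2 <= k / 8 by rewrite mulrC -ler_pdivlMr.
  by move: d20; lra.
exists r1, d2; split => //; first by move=> p /hr1; exact: rO.
have hz j a := peano M0 a (cF j) (FM j).
have hE (ja : hidx m * V) : exists z : R -> V, [/\ z 0 = ja.2,
   forall t, `|z t - ja.2| <= M * `|t| &
   forall t : R, is_derive t 1 z (F ja.1 (z t))] by exact: hz.
have [E0 hE0] := choice hE.
exists (fun j a t => E0 (j, a) t) => a ad2 j.
have [/= Ea EM Ed] := hE0 (j, a).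
have aa0 : `|a - a0| <= k / 2 by apply: hr2; exact: (closed_ballW_mono d2r2).
(* Working on the doubled open interval makes [- d2] and [d2] interior points, where two-sided
   derivatives are available. *)
have near_t t : - (2 * d2) < t < 2 * d2 -> `|E0 (j, a) t - a0| <= k.
  rewrite -ltr_norml => td; rewrite -(subrKA a) (le_trans (ler_normD _ _))//.
  have h : M * `|t| <= M * (2 * d2) by rewrite ler_wpM2l// ltW.
  by have := EM t; move: h Md2 aa0 k0; lra.
have Odom t : - (2 * d2) < t < 2 * d2 -> Omega (E0 (j, a) t).
  by move=> /near_t h; apply: rO; rewrite /= (le_trans h).
have FE t : - (2 * d2) < t < 2 * d2 -> F j (E0 (j, a) t) = Dpsi psi j (E0 (j, a) t).
  by move=> /near_t h; rewrite /F clamp_id ?(ltW r0)// (le_trans h).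
have dE (t : R) : - (2 * d2) < t < 2 * d2 ->
    is_derive t 1 (E0 (j, a)) (Dpsi psi j (E0 (j, a) t)).
  by move=> h; rewrite -FE.
have dpsi (t : R) := is_derive_psi oOmega psi_cont omega_cont psi_sol Odom dE (t := t).
have Ec t : {for t, continuous (E0 (j, a))}.
  by apply/differentiable_continuous/derivable1_diffP; have [] := Ed t.
have sub t : t \in `[- d2, d2] -> - (2 * d2) < t < 2 * d2.
  by rewrite in_itv /= => /andP[h1 h2]; apply/andP; split; move: d20; lra.
split; [|exact: Ea|..].
- by move=> t /sub/near_t h; apply: hk'; rewrite (le_trans h).
- split; first by move=> t /sub; exact: Odom.
  split; last by move=> t /sub/dE; exact: derive_within_of_derive.
  have cFE : {within `[- d2, d2], continuous (F j \o E0 (j, a))}.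
    apply: continuous_subspaceT => t; apply: continuous_comp; [exact: Ec|exact: cF].
  apply: subspace_eq_continuous cFE => t; rewrite inE => /sub; exact: FE.
- move=> t /sub td.
  have z0 : - (2 * d2) < 0 < 2 * d2 by apply/andP; split; move: d20; lra.
  have co s : - (2 * d2) < s < 2 * d2 -> {for s, continuous (omega j \o E0 (j, a))}.
    move=> /Odom Os; apply: continuous_comp; first exact: Ec.
    have := @omega_cont j; rewrite (continuous_open_subspace _ oOmega); apply.
    by rewrite inE.
  have := oriented_FTC z0 td dpsi co; rewrite /= Ea; exact.
Qed.

End conclusion.

Theorem proposition3p2 (R : realType) (m : nat) (m_ge2 : (2 <= m)%N)
    (Omega : set (wspace R m)) (Omega_open : open Omega)
    (omega : hidx m -> wspace R m -> R)
    (omega_cont : forall j, {within Omega, continuous (omega j)}) :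
  exists Lip : hidx m -> set (wspace R m) -> R,
  forall (psi : wspace R m -> R) (psi_cont : {within Omega, continuous psi})
    (psi_sol : distributional Omega psi omega),
  (forall (j : hidx m) (T : R) (gamma : R -> wspace R m),
     0 <= T -> integral_curve Omega psi j `[0, T] gamma ->
     [lipschitz (psi (gamma t)) | t in `[0, T]] /\
     forall A : set (wspace R m), A `<=` Omega -> [bounded omega j p | p in A] ->
       (forall t, t \in `[0, T] -> A (gamma t)) ->
       (Lip j A).-lipschitz_(`[0, T]) (psi \o gamma))
  /\
  (forall nrm : carnot R m -> R, homogeneous_norm nrm ->
     broad_star nrm Omega psi omega).
Proof.
(* [Lip j A] will be any bound of [omega j] on [A], chosen before [psi] is introduced; 0 is a dummy
   value when there is none. *)
have bound (jA : hidx m * set (wspace R m)) : exists C : R,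
    [bounded omega jA.1 p | p in jA.2] -> forall p, jA.2 p -> `|omega jA.1 p| <= C.
  have [b|nb] := pselect [bounded omega jA.1 p | p in jA.2]; last by exists 0.
  have [M [_ hM]] := b; exists (M + 1) => _ p Ap.
  by apply: (hM (M + 1)) => //; rewrite ltrDl.
have [C hC] := choice bound.
exists (fun j A => C (j, A)) => psi psi_cont psi_sol; split; last first.
  by move=> nrm; exact: broad_star_solution.
move=> j T gamma T0 curve.
have lip := psi_curve_lipschitz Omega_open psi_cont omega_cont psi_sol curve.
split; last first.
  move=> A _ bA gA [s t] /= [sT tT]; apply: lip => // x xT.
  by apply: (hC (j, A) bA); exact: gA.
have [gO [_ dg]] := curve.
(* For a single curve a bound of [omega j] always exists, by compactness of the time interval. *)
have [D hD] : exists D, forall t, `[0, T]%classic t -> `|(omega j \o gamma) t| <= D.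
  apply: continuous_bounded_on; first exact: segment_compact.
  apply: (comp_curve_continuous Omega_open (omega_cont j) _ gO).
  exact: derive_within_continuous dg.
exists D; split => [|M DM [s t] /= [sT tT]]; first exact: num_real.
apply: (@le_trans _ _ (D * `|s - t|)); last by rewrite ler_wpM2r// ltW.
by apply: lip => // x xT; exact: hD.
Qed.
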